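(* Consider the conductances $\omega$ on $\mathbb{Z}$ given by $\omega(n,n+1)=\omega(n+1,n)=n^2+1$ for $n\in\mathbb{Z}$ (and $\omega(m,n)=0$ if $|m-n|\neq1$). Then the SDE $$d\phi_t(x)=\sum_{y\sim x}\omega(x,y)(\phi_t(y)-\phi_t(x))\,dt+\sqrt2\,dB_t(x),\qquad x\in\mathbb{Z},$$ admits both reversible and non-reversible stationary measures on $\mathcal{S}'(\mathbb{Z})$. Moreover, there is an initial distribution $\nu_0$ on $\mathcal{S}'(\mathbb{Z})$ and a time-period $\tau>0$ such that if the SDE is initialised with $\phi_0\sim\nu_0$, then $\phi_t\not\sim\nu_0$ for all $t\in(0,\tau)$ and $\phi_\tau\sim\nu_0$.
   Context: Here $x\sim y$ means $|x-y|=1$ for points of $\mathbb{Z}$, while $\phi\sim\nu$ for a random element $\phi$ means that $\phi$ has law $\nu$; $(B_t(x))_{x\in\mathbb{Z},t\ge0}$ are independent standard Brownian motions, independent of $\phi_0$ when $\phi_0$ is random. Write $\langle x\rangle=(1+|x|^2)^{1/2}$. For $N\ge0$, $H_{\pm N}$ is the space of $f:\mathbb{Z}\to\mathbb{R}$ with $\sum_x\langle x\rangle^{\pm2N}|f(x)|^2<\infty$; $\mathcal{S}=\bigcap_{N\ge0}H_N$ and $\mathcal{S}'=\mathcal{S}'(\mathbb{Z})=\bigcup_{N\ge0}H_{-N}$, with pairing $\langle u,\xi\rangle=\sum_xu(x)\xi(x)$. The variable speed random walk is the continuous-time Markov chain $(X_t)_{t\geq 0}$ on $\mathbb{Z}$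 jumping from $x$ to $y$ at rate $\omega(x,y)$; it is non-explosive for these conductances, and $p_t(x,y)=\mathbf{P}_x[X_t=y]$. For every $\phi_0\in\mathcal{S}'$ the SDE has a unique adapted solution with continuous paths in some $H_{-N}$, namely $\phi_t(x)=\sum_yp_t(x,y)\phi_0(y)+\sqrt2\sum_y\int_0^tp_{t-s}(x,y)\,dB_s(y)$. Let $\mathbb{E}_\phi$ denote expectation for the solution with $\phi_0=\phi$. A probability measure $\nu$ on $\mathcal{S}'$ is stationary if $\int\mathbb{E}_\phi[F(\phi_t)]\nu(d\phi)=\int F\,d\nu$ for all $t\ge0$ and all bounded measurable $F:\mathcal{S}'\to\mathbb{R}$. It is reversible if for all $0\le s<t<\infty$ and $u,v\in\mathcal{S}$, $$\int_{\mathcal{S}'}\mathbb{E}_\phi\big[e^{i(\langle u,\phi_t\rangle+\langle v,\phi_s\rangle)}\big]\nu(d\phi)=\int_{\mathcal{S}'}\mathbb{E}_\phi\big[e^{i(\langle u,\phi_s\rangle+\langle v,\phi_t\rangle)}\big]\nu(d\phi).$$ *)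

(* Defs.v *)
From HB Require Import structures.
From mathcomp Require Import all_boot all_order all_algebra.
From mathcomp Require Import all_classical all_reals all_analysis.
From mathcomp Require Import complex.

Set Implicit Arguments.
Unset Strict Implicit.
Unset Printing Implicit Defensive.

Import Order.TTheory GRing.Theory Num.Theory.
Import numFieldNormedType.Exports.

Local Open Scope classical_set_scope.
Local Open Scope ring_scope.

Section Sequences.
Variable R : realType.
Implicit Types (f u : int -> R) (k : int) (N : nat).

(* Since <x>^(2k) = (1 + |x|^2)^k, this is the squared norm of H_k, with
   value +oo outside H_k.  The index k is a signed integer. *)
Definition sqnormH k f : \bar R :=
  \esum_(x in [set: int]) ((1 + x%:~R ^+ 2) ^ k * f x ^+ 2)%:E.

Definition inH k f : Prop := (sqnormH k f < +oo)%E.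

Definition schwartz : set (int -> R) :=
  [set u | forall N, inH (Posz N) u].

Definition tempered : set (int -> R) :=
  [set f | exists N, inH (- Posz N) f].

(* The sum over Z, pairing the term at n >= 0 with the one at -(n+1); it is
   only used for absolutely convergent sums. *)
Definition sumZ f : R :=
  limn (series (fun n : nat => f (Posz n) + f (Negz n))).

Definition pairing u f : R := sumZ (fun x => u x * f x).

Definition continuousH k (f : R -> int -> R) : Prop :=
  (forall t : R, 0 <= t -> inH k (f t)) /\
  (forall t : R, 0 <= t ->
    sqnormH k (fun x => f s x - f t x) @[s --> within `[0, +oo[ (nbhs t)]
      --> 0%E).

Lemma tempered0 : tempered (fun=> 0).
Proof.
exists 0%N; rewrite /inH /sqnormH esum1 ?ltry// => x _.
by rewrite expr0n mulr0.
Qed.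

End Sequences.

Record Sprime0 (R : realType) := MkSprime {
  Sprime_fun :> int -> R;
  Sprime_tempered : tempered Sprime_fun
}.

HB.instance Definition _ (R : realType) := gen_eqMixin (Sprime0 R).
HB.instance Definition _ (R : realType) := gen_choiceMixin (Sprime0 R).
HB.instance Definition _ (R : realType) :=
  isPointed.Build (Sprime0 R) (MkSprime (@tempered0 R)).

Definition cylinders (R : realType) : set (set (Sprime0 R)) :=
  \bigcup_(u in @schwartz R)
    preimage_set_system setT (fun f : Sprime0 R => pairing u f) measurable.

(* The sigma-algebra generated by the pairings with elements of S is the Borel
   sigma-algebra of S' for both its weak and its strong topology. *)
Notation Sprime R := (g_sigma_algebraType (@cylinders R)).

Section Probability.
Context {R : realType} {d : measure_display} {Om : measurableType d}.
Variable P : probability Om R.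

Definition has_law {d'} {T : measurableType d'} (X : Om -> T)
    (nu : set T -> \bar R) : Prop :=
  measurable_fun setT X /\
  forall A : set T, measurable A -> P (X @^-1` A) = nu A.

Definition sigma_of {d'} {T : measurableType d'} {I : Type} (D : set I)
    (X : I -> Om -> T) : set (set Om) :=
  <<s \bigcup_(i in D) preimage_set_system setT (X i) measurable >>.

Definition independent {I : eqType} (G : I -> set (set Om)) : Prop :=
  forall (J : seq I) (E : I -> set Om), uniq J ->
    (forall i, i \in J -> G i (E i)) ->
    P (\bigcap_(i in [set` J]) E i) = (\prod_(i <- J) P (E i))%E.

Definition independent2 (G1 G2 : set (set Om)) : Prop :=
  forall E1 E2, G1 E1 -> G2 E2 -> P (E1 `&` E2) = (P E1 * P E2)%E.

Record brownian (W : R -> Om -> R) : Prop := {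
  brownian_measurable : forall t : R, 0 <= t -> measurable_fun setT (W t);
  brownian_start : {ae P, forall w, W 0 w = 0};
  brownian_continuous :
    {ae P, forall w, {within `[0, +oo[, continuous (fun t => W t w)}};
  brownian_gaussian : forall s t : R, 0 <= s -> s < t ->
    has_law (fun w => W t w - W s w) (normal_prob 0 (Num.sqrt (t - s)));
  brownian_increments : forall r : nat -> R, 0 <= r 0%N ->
    {homo r : m n / (m <= n)%N >-> m <= n} ->
    independent (fun n : nat =>
      sigma_of [set: unit] (fun _ w => W (r n.+1) w - W (r n) w))
}.

Definition brownian_family (B : int -> R -> Om -> R) : Prop :=
  (forall x, brownian (B x)) /\
  independent (fun x => sigma_of `[0, +oo[ (B x)).

Variables (omega : int -> int -> R) (B : int -> R -> Om -> R).

Definition drift (f : int -> R) (x : int) : R :=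
  \sum_(y \in [set y : int | `|x - y| = 1]) omega x y * (f y - f x).

(* The filtration generated by the initial value and the Brownian motions,
   augmented by the P-null sets. *)
Definition filtration (phi0 : Om -> Sprime R) (t : R) : set (set Om) :=
  [set E | measurable E /\ exists2 E' : set Om,
    <<s sigma_of [set: unit] (fun=> phi0) `|`
        sigma_of ([set: int] `*` `[0, t]) (fun p => B p.1 p.2) >> E' &
    P.-negligible ((E `\` E') `|` (E' `\` E))].

(* The noise is additive, so the SDE is an integral equation along the paths
   and involves no stochastic integral.  Only the values of phi at nonnegative
   times matter, and N may depend on the path. *)
Record solution (phi0 : Om -> Sprime R) (phi : R -> Om -> Sprime R) : Prop := {
  solution_adapted : forall t : R, 0 <= t -> forall A : set (Sprime R),
    measurable A -> filtration phi0 t (phi t @^-1` A);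
  solution_continuous : {ae P, forall w, exists N : nat,
    continuousH (- Posz N) (fun t => phi t w : int -> R)};
  solution_start : {ae P, forall w, phi 0 w = phi0 w};
  solution_sde : {ae P, forall w, forall (t : R) (x : int), 0 <= t ->
    phi t w x = phi0 w x
      + (\int[lebesgue_measure]_(s in `[0, t]) drift (phi s w) x)
      + Num.sqrt 2 * B x t w}
}.

(* Phi f is the solution started from f, so that the expectation of a
   functional of Phi f under P is E_f. *)
Variable Phi : Sprime R -> R -> Om -> Sprime R.

Definition stationary (nu : probability (Sprime R) R) : Prop :=
  forall (t : R) (F : Sprime R -> R), 0 <= t -> measurable_fun setT F ->
    (exists M : R, forall f, `|F f| <= M) ->
    (\int[nu]_f 'E_P[fun w => F (Phi f t w)] = \int[nu]_f (F f)%:E)%E.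

Local Open Scope complex_scope.

Definition expi (a : R) : R[i] := cos a +i* sin a.

Definition cintegral {d'} {T : measurableType d'} (mu : probability T R)
    (h : T -> R[i]) : R[i] :=
  (\int[mu]_z complex.Re (h z)) +i* (\int[mu]_z complex.Im (h z)).

Definition reversible (nu : probability (Sprime R) R) : Prop :=
  forall (s t : R) (u v : int -> R), 0 <= s -> s < t ->
    schwartz u -> schwartz v ->
    cintegral nu (fun f => cintegral P (fun w =>
      expi (pairing u (Phi f t w) + pairing v (Phi f s w)))) =
    cintegral nu (fun f => cintegral P (fun w =>
      expi (pairing u (Phi f s w) + pairing v (Phi f t w)))).

End Probability.

Definition conductance (R : realType) (m n : int) : R :=
  if n == m + 1 then m%:~R ^+ 2 + 1
  else if m == n + 1 then n%:~R ^+ 2 + 1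
  else 0.

(* Main.v *)
(* Write L for the generator and a(n) = n^2 + 1.  Since the resistances 1/a(n)
   are summable, gamma(n) = W(r(n)), with W a Brownian motion and r a bounded
   antiderivative of 1/a, is an invariant Gaussian field: its covariance
   inverts -L.  The equation L f = i f has a solution f = f1 + i f2 of
   quadratic growth, and the noiseless evolution rotates it,
   f -> exp(i t) f, so that sums of gamma and of combinations of f1 and f2
   evolve explicitly.  Take the laws of
     alpha f1 + beta (xi1 f1 + xi2 f2) + gamma,   xi1, xi2 standard normal:
   (alpha, beta) = (0, 0) is reversible; (0, 1) is invariant under the rotation
   but sees its direction, so it is stationary and not reversible; (1, 0) has
   exact period 2 pi.

   To identify the law at time t, test functions are evolved backwards by an
   explicit Euler scheme for L cut to [-M, M): weighted l1 norms of the scheme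
   are bounded uniformly in M, because L (1 + x^2)^p <= C (1 + x^2)^p, hence
   boundary effects are O(1/M).  This shows that
     E cos (<u, phi_t> + <v, phi_s> + c) = kappa E cos (ell phi_0 + c)
   with ell f = <u, S_t f> + <v, S_s f> for the noiseless flow S.  The noise
   variance, hence kappa, follows from the energy identity for the Green
   quadratic form Q, and its cross term <u, S_(t-s) G v> is symmetric in u and
   v, which is the reversibility of gamma. *)

Require Import Defs.
From HB Require Import structures.
From mathcomp Require Import all_boot all_order all_algebra.
From mathcomp Require Import all_classical all_reals all_analysis.
From mathcomp Require Import measurable_realfun ring lra zify complex.

Set Implicit Arguments.
Unset Strict Implicit.
Unset Printing Implicit Defensive.

Import Order.TTheory GRing.Theory Num.Theory.
Import numFieldNormedType.Exports.

Local Open Scope classical_set_scope.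
Local Open Scope ring_scope.

(** * Expectations of bounded functions and monotone classes *)

(** No heat kernel or semigroup is constructed. The flow S comes from the solutions themselves: two
    solutions driven by the same Brownian path differ by a noiseless one. Two limits of different
    nature have to be combined: in a fixed window the number n of time steps tends to infinity
    without a rate, since a noisy path is merely continuous, whereas the boundary terms are O(1/M)
    uniformly over all fine n. A diagonal sequence of grids does this. Laws are tested on real
    functions cos (. + c): the phase c = - pi / 2 turns the cosine into a sine, so the family
    replaces the complex exponential and determines a law on S'. The limit of the noise variance is
    not computed directly: the energy identity gives the limit of its sum with the Green form of the
    evolved test function, and the law of gamma identifies the latter. Thus kappa is a quotient,
    whose denominator is positive because variances are nonnegative. *)

Lemma cvgP_eps (R : realType) (u : nat -> R) (l : R) :
  (u n @[n --> \oo] --> l) <->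
  (forall e, 0 < e -> exists N, forall n, (N <= n)%N -> `|u n - l| <= e).
Proof.
split.
- move=> /cvgrPdist_le H e e0; have [N _ HN] := H e e0.
  by exists N => n Nn; rewrite distrC; exact: HN.
- move=> H; apply/cvgrPdist_le => e e0; have [N HN] := H e e0.
  by exists N => // n Nn /=; rewrite distrC; exact: HN.
Qed.

Lemma cvg_abs_le (R : realType) (u : nat -> R) (l M : R) :
  u n @[n --> \oo] --> l -> (forall n, `|u n| <= M) -> `|l| <= M.
Proof.
move=> /cvgP_eps ul uM; apply/ler_addgt0Pl => e e0.
have [N HN] := ul e e0; have := HN N (leqnn N).
rewrite -[in `|l|](subKr (u N) l) => h.
by rewrite (le_trans (ler_normB _ _))// addrC lerD.
Qed.

Lemma measurable_cos (R : realType) : measurable_fun setT (@cos R).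
Proof. by apply: continuous_measurable_fun; exact: continuous_cos. Qed.

Lemma measurable_sin (R : realType) : measurable_fun setT (@sin R).
Proof. by apply: continuous_measurable_fun; exact: continuous_sin. Qed.

Lemma cos_abs_le1 (R : realType) (x : R) : `|cos x| <= 1.
Proof. by rewrite ler_norml cos_geN1 cos_le1. Qed.

Lemma sin_abs_le1 (R : realType) (x : R) : `|sin x| <= 1.
Proof. by rewrite ler_norml sin_geN1 sin_le1. Qed.

Lemma cos_dist (R : realType) (x y : R) : `|cos x - cos y| <= `|x - y|.
Proof.
wlog xy : x y / x < y.
  move=> H; have [|yx|->] := ltgtP x y; [exact: H| |by rewrite !subrr].
  by rewrite distrC [leRHS]distrC; exact: H.
have cc z : {for z, continuous (@cos R)} by exact: continuous_cos.
have [|c _] := @MVT R cos (fun z => - sin z) x y xy.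
  by apply: continuous_subspaceT => z; exact: continuous_cos.
rewrite distrC => ->; rewrite normrM normrN (distrC x).
by rewrite ler_piMl// sin_abs_le1.
Qed.

Section Expectation.
Context {R : realType} {d : measure_display} {T : measurableType d}.
Variable P : probability T R.
Implicit Types (f g : T -> R).

Definition bmeas f := measurable_fun setT f /\ exists M : R, forall x, `|f x| <= M.

Lemma bmeas_integrable f : bmeas f -> P.-integrable setT (EFin \o f).
Proof.
move=> [mf [M fM]]; apply: measurable_bounded_integrable => //.
  by rewrite (le_lt_trans (probability_le1 P _))// ltry.
exists `|M|; split => [|r Mr x _ /=]; first exact: num_real.
by rewrite (le_trans (fM x))// (le_trans (ler_norm M))// ltW.
Qed.

Lemma bmeas_cos f : measurable_fun setT f -> bmeas (fun x => cos (f x)).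
Proof.
move=> mf; split; last by exists 1 => x; exact: cos_abs_le1.
by apply: measurableT_comp => //; exact: measurable_cos.
Qed.

Lemma bmeas_sin f : measurable_fun setT f -> bmeas (fun x => sin (f x)).
Proof.
move=> mf; split; last by exists 1 => x; exact: sin_abs_le1.
by apply: measurableT_comp => //; exact: measurable_sin.
Qed.

Lemma bmeas_cst c : bmeas (fun=> c).
Proof. by split; [exact: measurable_cst|exists `|c|]. Qed.

Lemma bmeasD f g : bmeas f -> bmeas g -> bmeas (fun x => f x + g x).
Proof.
move=> [mf [M fM]] [mg [N gN]]; split; first exact: measurable_funD.
by exists (M + N) => x; rewrite (le_trans (ler_normD _ _))// lerD.
Qed.

Lemma bmeasM f g : bmeas f -> bmeas g -> bmeas (fun x => f x * g x).
Proof.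
move=> [mf [M fM]] [mg [N gN]]; split; first exact: measurable_funM.
by exists (M * N) => x; rewrite normrM ler_pM.
Qed.

Lemma bmeasZ c f : bmeas f -> bmeas (fun x => c * f x).
Proof. by move=> bf; apply: bmeasM => //; exact: bmeas_cst. Qed.

Lemma bmeasN f : bmeas f -> bmeas (fun x => - f x).
Proof.
by move=> /(bmeasZ (-1)) H; under eq_fun do rewrite -mulN1r.
Qed.

Lemma bmeasB f g : bmeas f -> bmeas g -> bmeas (fun x => f x - g x).
Proof. by move=> bf bg; apply: bmeasD => //; exact: bmeasN. Qed.

Lemma bmeas_indic A : measurable A -> bmeas \1_A.
Proof.
move=> mA; split; first exact: measurable_indic.
by exists 1 => x; rewrite indicE; case: (_ \in _); rewrite ?normr1 ?normr0.
Qed.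

Lemma bmeas_norm f : bmeas f -> bmeas (fun x => `|f x|).
Proof.
move=> [mf [M fM]]; split; first exact: measurableT_comp.
by exists M => x; rewrite normr_id.
Qed.

Lemma EexpD f g : bmeas f -> bmeas g ->
  \int[P]_x (f x + g x) = \int[P]_x f x + \int[P]_x g x.
Proof. by move=> /bmeas_integrable bf /bmeas_integrable bg; exact: RintegralD. Qed.

Lemma EexpB f g : bmeas f -> bmeas g ->
  \int[P]_x (f x - g x) = \int[P]_x f x - \int[P]_x g x.
Proof. by move=> /bmeas_integrable bf /bmeas_integrable bg; exact: RintegralB. Qed.

Lemma EexpZ c f : bmeas f -> \int[P]_x (c * f x) = c * \int[P]_x f x.
Proof. by move=> /bmeas_integrable bf; exact: RintegralZl. Qed.

Lemma Eexp_cst c : \int[P]_x c = c.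
Proof.
rewrite Rintegral_cst// [X in fine X](_ : _ = 1%E) ?mulr1//.
exact: probability_setT.
Qed.

Lemma Eexp_le f g : bmeas f -> bmeas g -> (forall x, f x <= g x) ->
  \int[P]_x f x <= \int[P]_x g x.
Proof.
by move=> /bmeas_integrable bf /bmeas_integrable bg fg; exact: le_Rintegral.
Qed.

Lemma Eexp_abs f : bmeas f -> `|\int[P]_x f x| <= \int[P]_x `|f x|.
Proof. by move=> /bmeas_integrable bf; exact: le_normr_Rintegral. Qed.

Lemma Eexp_abs_le f (M : R) : measurable_fun setT f -> (forall x, `|f x| <= M) ->
  `|\int[P]_x f x| <= M.
Proof.
move=> mf fM; have bf : bmeas f by split=> //; exists M.
rewrite (le_trans (Eexp_abs bf))// -[leRHS]Eexp_cst.
by apply: Eexp_le => //; [exact: bmeas_norm|exact: bmeas_cst].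
Qed.

Lemma EexpE f : bmeas f -> (\int[P]_x (f x)%:E)%E = (\int[P]_x f x)%:E.
Proof.
by move=> bf; rewrite /Rintegral fineK//; apply: integrable_fin_num => //;
   exact: bmeas_integrable.
Qed.

Lemma Eexp_indic A : measurable A -> \int[P]_x \1_A x = fine (P A).
Proof. by move=> mA; rewrite /Rintegral integral_indic// setIT. Qed.

Lemma Eexp_ae_eq f g : measurable_fun setT f -> measurable_fun setT g ->
  {ae P, forall x, f x = g x} -> \int[P]_x f x = \int[P]_x g x.
Proof.
move=> mf mg fg; rewrite /Rintegral; congr fine; apply: ae_eq_integral => //.
- exact/measurable_EFinP.
- exact/measurable_EFinP.
- by case: fg => N [mN N0 H]; exists N; split=> //; apply: subset_trans H => x /=;
    apply: contra_not => -> _.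
Qed.

Lemma Eexp_cvg (f_ : nat -> T -> R) f (M : R) :
  (forall n, measurable_fun setT (f_ n)) -> measurable_fun setT f ->
  (forall n x, `|f_ n x| <= M) ->
  {ae P, forall x, f_ n x @[n --> \oo] --> f x} ->
  \int[P]_x f_ n x @[n --> \oo] --> \int[P]_x f x.
Proof.
move=> mf_ mf fM fc.
have M0 : 0 <= M by rewrite (le_trans _ (fM 0%N point)).
have [||||| fi _ H] := @dominated_convergence _ _ _ P setT measurableT
  (fun n x => (f_ n x)%:E) (EFin \o f) (EFin \o (fun=> M)).
- by move=> n; exact/measurable_EFinP.
- exact/measurable_EFinP.
- case: fc => N [mN N0 HN]; exists N; split=> //; apply: subset_trans HN => x /=.
  by apply: contra_not => H _; apply: cvg_EFin => //; exact: nearW.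
- by apply: bmeas_integrable; exact: bmeas_cst.
- by apply: aeW => x n _; rewrite /= lee_fin.
rewrite /Rintegral; apply: fine_cvg; rewrite fineK//.
exact: integrable_fin_num.
Qed.

End Expectation.

Lemma Eexp_pushforward (R : realType) d d' (T : measurableType d)
  (T' : measurableType d') (P : probability T R) (Q : probability T' R)
  (X : T -> T') (f : T' -> R) : has_law P X Q -> bmeas f ->
  \int[Q]_y f y = \int[P]_x f (X x).
Proof.
move=> [mX lX] bf; rewrite /Rintegral.
congr fine; rewrite (eq_measure_integral (pushforward P X)); last first.
  by move=> A mA _; exact/esym/lX.
rewrite integral_pushforward//.
  by apply/measurable_EFinP; case: bf.
apply: bmeas_integrable; case: bf => mf [M fM]; split; last by exists M.
exact: measurableT_comp.
Qed.

(** * Monotone class theorems, ending with one for trigonometric functions *)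

Section MonotoneClass.
Context {R : realType}.

(* Closure under bounded pointwise limits is only ever used for sequences. *)
Record bclass {T : Type} (H : (T -> R) -> Prop) : Prop := {
  bclassL : forall f g a b, H f -> H g -> H (fun x => a * f x + b * g x);
  bclass_lim : forall (f_ : nat -> T -> R) f (M : R), (forall n, H (f_ n)) ->
    (forall n x, `|f_ n x| <= M) ->
    (forall x, f_ n x @[n --> \oo] --> f x) -> H f }.

Section Theory.
Context {T : Type} (H : (T -> R) -> Prop).
Hypothesis bH : bclass H.

Lemma bclassZ f a : H f -> H (fun x => a * f x).
Proof.
move=> Hf; have := bclassL bH a 0 Hf Hf.
by under eq_fun do rewrite mul0r addr0.
Qed.

Lemma bclassD f g : H f -> H g -> H (fun x => f x + g x).
Proof.
move=> Hf Hg; have := bclassL bH 1 1 Hf Hg.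
by under eq_fun do rewrite !mul1r.
Qed.

Lemma bclassB f g : H f -> H g -> H (fun x => f x - g x).
Proof.
move=> Hf Hg; have := bclassL bH 1 (-1) Hf Hg.
by under eq_fun do rewrite mul1r mulN1r.
Qed.

Lemma bclass_sum f : H f -> forall (g : nat -> T -> R) n,
  (forall k, H (g k)) -> H (fun x => \sum_(k < n) g k x).
Proof.
move=> Hf g n Hg; elim: n => [|n IH].
  have := bclassZ 0 Hf; under eq_fun do rewrite mul0r.
  by under [X in _ -> H X]eq_fun do rewrite big_ord0.
by under eq_fun do rewrite big_ord_recr/=; exact: bclassD.
Qed.

End Theory.

(** The sum counts the positive integers up to [y], so it is the floor of [y]. *)
Lemma threshold_sum (y : R) (K : nat) : 0 <= y <= K%:R ->
  `|\sum_(k < K) ((k.+1%:R <= y)%R%:R : R) - y| <= 1.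
Proof.
elim: K => [|K IH] /andP[y0 yK].
  by rewrite big_ord0 sub0r normrN ger0_norm// (le_trans yK).
rewrite big_ord_recr/=; have [yK'|Ky] := leP y K%:R.
  have -> : (K.+1%:R <= y) = false by apply/negbTE; rewrite -ltNge (le_lt_trans yK')// ltr_nat.
  by rewrite addr0 IH// y0.
rewrite (eq_bigr (fun=> 1)) => [|i _]; last first.
  by rewrite (le_trans _ (ltW Ky))// ler_nat.
rewrite sumr_const card_ord; have [yK1|yK1] := leP K.+1%:R y.
  by have -> : y = K.+1%:R; [lra|rewrite -natr1 subrr normr0].
by rewrite addr0 ler_norml; rewrite -natr1 in yK; lra.
Qed.

(** Layer cake: after a shift making it nonnegative, [f] is within 1/(n+1) of the average of
    indicators of its superlevel sets at the levels (k+1)/(n+1). *)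
Lemma bclass_indic d (T : measurableType d) (H : (T -> R) -> Prop) :
  bclass H -> (forall A, measurable A -> H \1_A) ->
  forall f, bmeas f -> H f.
Proof.
move=> bH HA f [mf [M fM]].
have [M' M'M] : exists M' : nat, M <= M'%:R.
  by exists (Num.truncn M).+1; rewrite ltW// truncnS_gt.
pose g x := f x + M'%:R.
have g0 x : 0 <= g x <= (2 * M')%:R.
  have := le_trans (fM x) M'M; rewrite ler_norml natrM /g; lra.
have H1 : H \1_[set: T] by exact: HA.
pose A n k := [set x | k.+1%:R <= n.+1%:R * g x].
have mA n k : measurable (A n k).
  have -> : A n k = (fun x => n.+1%:R * g x) @^-1` `[k.+1%:R, +oo[.
    by apply/seteqP; split=> x; rewrite /A/= in_itv/= andbT.
  rewrite -[X in measurable X]setTI; apply: measurable_funM => //.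
  exact: measurable_funD.
pose s n x : R := n.+1%:R^-1 * (\sum_(k < n.+1 * (2 * M')) \1_(A n k) x) - M'%:R * \1_[set: T] x.
have sg n x : `|s n x - f x| <= n.+1%:R^-1.
  have n0 : 0 < n.+1%:R :> R by rewrite ltr0n.
  have -> : s n x - f x = n.+1%:R^-1 *
      (\sum_(k < n.+1 * (2 * M')) \1_(A n k) x - n.+1%:R * g x).
    by rewrite /s /g indicT /=; field; rewrite lt0r_neq0.
  rewrite normrM gtr0_norm ?invr_gt0// ler_piMr ?invr_ge0 ?ler0n//.
  rewrite (eq_bigr (fun k : 'I_ _ => (k.+1%:R <= n.+1%:R * g x)%R%:R)); last first.
    by move=> k _; rewrite indicE /A; congr (_%:R); congr nat_of_bool;
       apply/idP/idP; rewrite inE.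
  apply: threshold_sum; have /andP[g1 g2] := g0 x.
  by rewrite mulr_ge0//= natrM ler_pM2l.
apply: (bclass_lim bH (f_ := s) (M := `|M| + 1)).
- move=> n; apply: bclassB => //; last exact: bclassZ.
  by apply: bclassZ => //; apply: (bclass_sum bH H1 (g := fun k => \1_(A n k))) => // k; exact: HA.
- move=> n x; rewrite -(subrK (f x) (s n x)) (le_trans (ler_normD _ _))//.
  rewrite addrC lerD ?(le_trans (fM x)) ?ler_norm// (le_trans (sg n x))//.
  by rewrite invf_le1// ler1n.
- move=> x; apply/cvgP_eps => e e0.
  have [N Ne] : exists N : nat, e^-1 <= N.+1%:R.
    by exists (Num.truncn e^-1); rewrite ltW// truncnS_gt.
  exists N => n Nn; rewrite (le_trans (sg n x))// invf_ple ?posrE ?ltr0n//.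
  by rewrite (le_trans Ne)// ler_nat ltnS.
Qed.

Lemma bclass_dynkin d (T : measurableType d) (H : (T -> R) -> Prop)
  (G : set (set T)) : bclass H -> @measurable _ T = <<s G >> ->
  setI_closed G -> H (fun=> 1) -> (forall A, G A -> H \1_A) ->
  forall f, bmeas f -> H f.
Proof.
move=> bH GE GI H1 HG; apply: bclass_indic => // A mA.
apply: (dynkin_induction (P := fun A => H \1_A) GE GI) => //.
- by rewrite indicT.
- move=> S mS HS; have -> : \1_(~` S) = (fun x => 1 - \1_S x) :> (T -> R).
    apply/funext => x; rewrite !indicE in_setC.
    by case: (x \in S); rewrite ?subrr ?subr0.
  exact: bclassB.
- move=> F mF tF HF.
  apply: (bclass_lim bH (f_ := fun n x => \sum_(k < n) \1_(F k) x) (M := 1)).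
  + by move=> n; apply: (bclass_sum bH H1 (g := fun k => \1_(F k))).
  + move=> n x; rewrite ger0_norm; last by apply: sumr_ge0 => k _; rewrite indicE.
    have [[k kn Fkx]|nF] := pselect (exists2 k : nat, (k < n)%N & F k x).
      rewrite (bigD1 (Ordinal kn))//= big1 ?addr0 ?indicE ?mem_set// => j jk.
      rewrite indicE memNset// => Fjx; move/eqP: jk; apply; apply/val_inj => /=.
      by apply: (tF j k) => //; exists x.
    by rewrite big1// => j _; rewrite indicE memNset// => Fjx; apply: nF; exists j.
  + move=> x; apply: cvg_near_cst; have [[k _ Fkx]|nF] := pselect ((\bigcup_k F k) x).
      exists k.+1 => // n /= kn; rewrite (bigD1 (Ordinal kn))//= big1 ?addr0.
        by rewrite !indicE !mem_set//; exists k.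
      move=> j jk; rewrite indicE memNset// => Fjx; move/eqP: jk; apply; apply/val_inj => /=.
      by apply: (tF j k) => //; exists x.
    apply: nearW => n; rewrite big1 ?indicE ?memNset// => j _.
    by rewrite indicE memNset// => Fjx; apply: nF; exists j.
- by rewrite -GE.
Qed.

Lemma bernoulli_ineq (z : R) m : -1 <= z -> 1 + m%:R * z <= (1 + z) ^+ m.
Proof.
move=> z1; elim: m => [|m IH]; first by rewrite mul0r addr0.
have z0 : 0 <= 1 + z by lra.
rewrite exprS; apply: le_trans (ler_wpM2l z0 IH).
by rewrite -natr1; have := mulr_ge0 (ler0n R m) (sqr_ge0 z); nra.
Qed.

(** The polynomial from the elementary proof of the Stone-Weierstrass theorem, steep at y = 1/2.
    Since 2^N y^N = (2 y)^N, both bounds are Bernoulli's inequality with exponent 2^N, the second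
    one through (1 - t)(1 + t) <= 1. *)
Lemma pow_threshold (y : R) (N : nat) : 0 <= y <= 1 ->
  1 - (2 * y) ^+ N <= (1 - y ^+ N) ^+ (2 ^ N) <= 1 /\
  (1 - y ^+ N) ^+ (2 ^ N) * (2 * y) ^+ N <= 1.
Proof.
move=> /andP[y0 y1]; set t := y ^+ N.
have t0 : 0 <= t by rewrite exprn_ge0.
have t1 : t <= 1 by rewrite exprn_ile1.
have E : (2 * y) ^+ N = (2 ^ N)%:R * t by rewrite exprMn natrX.
rewrite E; split.
  rewrite exprn_ile1 ?subr_ge0//; last lra.
  by rewrite andbT -mulrN; apply: bernoulli_ineq; lra.
have : (1 - t) ^+ (2 ^ N) * (1 + (2 ^ N)%:R * t) <= 1.
  apply: (le_trans (y := ((1 - t) * (1 + t)) ^+ (2 ^ N))).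
    rewrite exprMn ler_wpM2l ?exprn_ge0 ?subr_ge0//; apply: bernoulli_ineq; lra.
  by rewrite exprn_ile1//; nra.
have : 0 <= (1 - t) ^+ (2 ^ N) by rewrite exprn_ge0// subr_ge0.
nra.
Qed.

(** The division by 8 and the shift 1/(n+4) keep the base in [0, 1]. The shift also puts it strictly
    above 1/2 when a = b, so the limit is the strict indicator. The exponent n^2 is needed there: (1
    + 2/(n+4))^n stays bounded, while the power n^2 grows at least linearly. *)
Lemma cvg_threshold (a b : R) : -1 <= a <= 1 -> -1 <= b <= 1 ->
  (1 - (2^-1 + (a - b) / 8 + n.+4%:R^-1) ^+ (n ^ 2)) ^+ (2 ^ (n ^ 2))
    @[n --> \oo] --> ((a < b)%R%:R : R).
Proof.
move=> a1 b1; pose y n := 2^-1 + (a - b) / 8 + n.+4%:R^-1 : R.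
have i4 n : 0 < (n.+4%:R^-1 : R) <= 4^-1.
  by rewrite invr_gt0 ltr0n/= lef_pV2 ?posrE ?ltr0n// ler_nat.
have y01 n : 0 <= y n <= 1 by have := i4 n; rewrite /y; move: (n.+4%:R^-1) => w; lra.
have cy : y n @[n --> \oo] --> 2^-1 + (a - b) / 8 + 0.
  apply: cvgD; first exact: cvg_cst.
  have := @cvg_harmonic R; rewrite -(cvg_shiftn 3) /harmonic/=.
  by under eq_fun do rewrite addn3.
have q01 n : 0 <= (1 - y n ^+ (n ^ 2)) ^+ (2 ^ (n ^ 2)).
  have /andP[? ?] := y01 n; rewrite exprn_ge0// subr_ge0 exprn_ile1//.
have [ab|ba] := ltP a b.
  have [z z1 yz] : exists2 z : R, 0 <= z < 1 & \forall n \near \oo, 2 * y n <= z.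
    exists (1 + (a - b) / 8); first lra.
    have := cvgr_lt _ cy (2^-1 + (a - b) / 8 / 2) _.
    rewrite addr0 => /(_ _)[]; first lra.
    move=> N _ HN; exists N => // n Nn; have := HN n Nn; rewrite /=; lra.
  apply: (@squeeze_cvgr _ _ _ _ (fun n => 1 - z ^+ n) (fun=> 1)).
  - near=> n.
    have [/andP[h1 h2] _] := pow_threshold (n ^ 2) (y01 n).
    rewrite h2 andbT; apply: le_trans h1; rewrite lerD2l lerN2.
    have yn : 2 * y n <= z by near: n.
    have yn0 : 0 <= 2 * y n by have := y01 n; lra.
    apply: (le_trans (y := z ^+ (n ^ 2))).
      by rewrite lerXn2r ?nnegrE//; lra.
    have n0 : (0 < n)%N by near: n; exists 1%N.
    by apply: ler_wiXn2l; [lra|lra|rewrite expnS expn1 leq_pmulr].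
  - rewrite -[X in _ --> X]subr0; apply: cvgB; first exact: cvg_cst.
    by apply: cvg_expr; rewrite ger0_norm; lra.
  - exact: cvg_cst.
apply: (@squeeze_cvgr _ _ _ _ (fun=> 0) (fun n => 6 * n.+1%:R^-1)).
- near=> n.
  have [_ h] := pow_threshold (n ^ 2) (y01 n).
  rewrite q01 /=.
  have n0 : 1 <= n%:R :> R by rewrite ler1n; near: n; exists 1%N.
  have h3 : n.+1%:R <= 6 * (2 * y n) ^+ (n ^ 2).
    have h4 : 1 + (n ^ 2)%:R * (2 * n.+4%:R^-1) <= (2 * y n) ^+ (n ^ 2).
      apply: le_trans (bernoulli_ineq _ _) _; first by have := i4 n; move: (n.+4%:R^-1) => w; lra.
      by rewrite lerXn2r ?nnegrE//; have := i4 n; rewrite /y; move: (n.+4%:R^-1) => w; lra.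
    have h5 : n.+4%:R * n.+4%:R^-1 = 1 :> R by rewrite divff// pnatr_eq0.
    move: h4 h5; have := i4 n; rewrite natrX -[n.+4]addn4 -[n.+1]addn1 !natrD.
    by set w := (_ + _)^-1; nra.
  by rewrite ler_pdivlMr ?ltr0n//; have := q01 n; nra.
- exact: cvg_cst.
- by rewrite -[X in _ --> X](mulr0 6); apply: cvgZr; exact: cvg_harmonic.
Unshelve. all: by end_near.
Qed.

(** For large n both arguments lie in [-1, 1], where sine is increasing, so the two comparisons
    agree from some n on. *)
Lemma cvg_sin_threshold (z c : R) :
  (((sin (n.+1%:R^-1 * z) < sin (n.+1%:R^-1 * c))%R%:R : R))
    @[n --> \oo] --> ((z < c)%R%:R : R).
Proof.
apply: cvg_near_cst.
have [N HN] : exists N : nat, `|z| + `|c| <= N.+1%:R.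
  by exists (Num.truncn (`|z| + `|c|)); rewrite ltW// truncnS_gt.
exists N => // n /= Nn.
have n0 : 0 < n.+1%:R :> R by rewrite ltr0n.
have bnd (y : R) : `|y| <= n.+1%:R -> n.+1%:R^-1 * y \in `[- (pi / 2), pi / 2].
  move=> yn; rewrite in_itv/= -ler_norml normrM gtr0_norm ?invr_gt0//.
  rewrite (le_trans (y := 1))//; last by have := @pi_ge2 R; lra.
  by rewrite mulrC ler_pdivrMr// mul1r.
have Nn' : N.+1%:R <= n.+1%:R :> R by rewrite ler_nat ltnS.
have z0 := normr_ge0 z; have c0 := normr_ge0 c.
by rewrite ltr_sin ?bnd//; [rewrite ltr_pM2l ?invr_gt0|lra|lra].
Qed.

Section Trig.
Context {d : measure_display} {T : measurableType d} (H L : (T -> R) -> Prop).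
Hypothesis bH : bclass H.
Hypothesis LL : forall f g a b, L f -> L g -> L (fun x => a * f x + b * g x).
Hypothesis HL : forall l c, L l -> H (fun x => cos (l x + c)).

(* Multiplying by [p (sin (a z))], [p] a polynomial, keeps the trigonometric
   form; steep polynomials turn into the indicator of [z < c]. *)
Lemma bclass_threshold (l0 : T -> R) c0 (W : T -> R) : L l0 ->
  (forall x, 0 <= W x <= 1) ->
  (forall l c, L l -> H (fun x => cos (l x + c) * W x)) ->
  forall l c, L l ->
    H (fun x => cos (l x + c) * ((l0 x < c0)%R%:R * W x)).
Proof.
move=> Ll0 W01 HW.
pose K (g : R -> R) :=
  forall l c, L l -> H (fun x => cos (l x + c) * (g (l0 x) * W x)).
have KL g h a b : K g -> K h -> K (fun z => a * g z + b * h z).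
  move=> Kg Kh l c Ll; have := bclassL bH a b (Kg l c Ll) (Kh l c Ll).
  by congr H; apply/funext => x; ring.
have Klim (g_ : nat -> R -> R) g : (forall n, K (g_ n)) ->
    (forall n z, `|g_ n z| <= 1) -> (forall z, g_ n z @[n --> \oo] --> g z) -> K g.
  move=> Kg g1 gc l c Ll.
  apply: (bclass_lim bH (f_ := fun n x => cos (l x + c) * (g_ n (l0 x) * W x)) (M := 1)).
  - by move=> n; exact: Kg.
  - move=> n x; rewrite normrM mulr_ile1 ?cos_abs_le1// normrM mulr_ile1//.
    by have := W01 x; rewrite ler_norml; lra.
  - move=> x; apply: cvgM; first exact: cvg_cst.
    by apply: cvgM; [exact: gc|exact: cvg_cst].
have K1 : K (fun=> 1).
  by move=> l c Ll; under eq_fun do rewrite mul1r; exact: HW.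
(* Product to sum: 2 cos A sin B = sin (A + B) - sin (A - B), each sine being a cosine with phase
   lowered by pi / 2. *)
have Ksin a g : K g -> K (fun z => sin (a * z) * g z).
  move=> Kg l c Ll.
  have Lp : L (fun x => 1 * l x + a * l0 x) by exact: LL.
  have Lm : L (fun x => 1 * l x + (- a) * l0 x) by exact: LL.
  have := bclassL bH (2^-1) (- 2^-1) (Kg _ (c - pi / 2) Lp) (Kg _ (c - pi / 2) Lm).
  congr H; apply/funext => x.
  have cs (y : R) : cos (y - pi / 2) = sin y by rewrite cosB sin_pihalf cos_pihalf; ring.
  rewrite !addrA !cs (_ : 1 * l x + a * l0 x + c = (l x + c) + a * l0 x); last ring.
  rewrite (_ : 1 * l x + - a * l0 x + c = (l x + c) - a * l0 x); last ring.
  by rewrite sinB sinD; field.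
have Kaff a u v g : K g -> K (fun z => (u + v * sin (a * z)) * g z).
  move=> Kg; have := KL _ _ u v Kg (Ksin a g Kg).
  by congr K; apply/funext => z; ring.
have Kpow a u v N g : K g -> K (fun z => (u + v * sin (a * z)) ^+ N * g z).
  move=> Kg; elim: N => [|N IH].
    by under eq_fun do rewrite expr0 mul1r.
  by have := Kaff a u v _ IH; under eq_fun do rewrite mulrA -exprS.
have Kpoly a u v N m g : K g ->
    K (fun z => (1 - (u + v * sin (a * z)) ^+ N) ^+ m * g z).
  move=> Kg; elim: m => [|m IH].
    by under eq_fun do rewrite expr0 mul1r.
  have := KL _ _ 1 (-1) IH (Kpow a u v N _ IH).
  by congr K; apply/funext => z; rewrite exprS; ring.
have Kthr a b : -1 <= b <= 1 -> K (fun z => (sin (a * z) < b)%R%:R).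
  move=> b1.
  apply: (Klim (fun n z => (1 - ((2^-1 - b / 8 + n.+4%:R^-1) + 8^-1 * sin (a * z)) ^+ (n ^ 2)) ^+ (2 ^ (n ^ 2)))).
  - by move=> n; have := Kpoly a (2^-1 - b / 8 + n.+4%:R^-1) 8^-1 (n ^ 2)%N (2 ^ (n ^ 2))%N _ K1;
      under eq_fun do rewrite mulr1.
  - move=> n z; set y := (_ + 8^-1 * _).
    have y01 : 0 <= y <= 1.
      have : 0 < (n.+4%:R^-1 : R) <= 4^-1.
        by rewrite invr_gt0 ltr0n/= lef_pV2 ?posrE ?ltr0n// ler_nat.
      have := sin_le1 (a * z); have := sin_geN1 (a * z).
      by rewrite /y; move: (sin _) (n.+4%:R^-1) => s w; lra.
    have /andP[y0 y1] := y01.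
    have t0 : 0 <= y ^+ (n ^ 2) by rewrite exprn_ge0.
    have t1 : y ^+ (n ^ 2) <= 1 by rewrite exprn_ile1.
    by rewrite ger0_norm ?exprn_ge0 ?subr_ge0// exprn_ile1 ?subr_ge0//; lra.
  - move=> z; have := @cvg_threshold (sin (a * z)) b _ b1.
    rewrite sin_le1 sin_geN1 => /(_ isT) h.
    under eq_fun => n.
      rewrite (_ : _ + 8^-1 * _ = 2^-1 + (sin (a * z) - b) / 8 + n.+4%:R^-1); last first.
        by move: (sin _) (n.+4%:R^-1) => s w; lra.
      over.
    exact: h.
have Kc0 : K (fun z => (z < c0)%R%:R).
  apply: (Klim (fun n z => (sin (n.+1%:R^-1 * z) < sin (n.+1%:R^-1 * c0))%R%:R)).
  - by move=> n; apply: Kthr; rewrite sin_le1 sin_geN1.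
  - by move=> n z; case: (_ < _)%R; rewrite ?normr1 ?normr0.
  - by move=> z; exact: cvg_sin_threshold.
exact: Kc0.
Qed.

(** Finite intersections of half spaces [l i < c i] form a pi-system generating the sigma-algebra,
    and their indicators are products of thresholds, reached one factor at a time by
    [bclass_threshold]. *)
Lemma bclass_trig : L (fun=> 0) ->
  @measurable _ T = <<s \bigcup_(l in L) preimage_set_system setT l measurable >> ->
  forall f, bmeas f -> H f.
Proof.
move=> L0 gen.
pose A n (l : nat -> T -> R) (c : nat -> R) :=
  [set x | forall i, (i < n)%N -> l i x < c i].
pose G := [set B | exists n l c, (forall i, L (l i)) /\ B = A n l c].
have mL l : L l -> measurable_fun setT l.
  move=> Ll _ B mB; rewrite gen; apply: sub_sigma_algebra.
  by exists l => //; exists B.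
have GI : setI_closed G.
  move=> _ _ [n [l [c [Ll ->]]]] [n' [l' [c' [Ll' ->]]]].
  exists (n + n')%N, (fun i => if (i < n)%N then l i else l' (i - n)%N),
    (fun i => if (i < n)%N then c i else c' (i - n)%N); split.
    by move=> i; case: ifP.
  apply/seteqP; split=> x; rewrite /A/=.
    move=> [h1 h2] i ilt; case: ifP => [|/negbT]; first exact: h1.
    by rewrite -leqNgt => ni; apply: h2; lia.
  move=> h; split=> i ilt.
    by have := h i; rewrite ilt; apply; lia.
  by have := h (n + i)%N; rewrite ltn_add2l => /(_ ilt); rewrite ltnNge leq_addr/= addKn.
have GE : @measurable _ T = <<s G >>.
  apply/seteqP; split; last first.
    apply: smallest_sub; first exact: sigma_algebra_measurable.
    move=> _ [n [l [c [Ll ->]]]].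
    have -> : A n l c = \bigcap_(i in `I_n) (l i @^-1` `]-oo, c i[).
      by apply/seteqP; split=> x /= h i; have := h i; rewrite /= in_itv/=.
    apply: bigcap_measurableType => i _.
    by rewrite -[X in measurable X]setTI; exact: mL.
  rewrite [X in X `<=` _]gen; apply: smallest_sub; first exact: smallest_sigma_algebra.
  move=> _ [l Ll [B mB <-]].
  pose TG := g_sigma_algebraType G.
  suff : measurable_fun (setT : set TG) (l : TG -> R) by exact.
  apply: (measurability _ (RGenInftyO.measurableE R)).
  move=> _ [_ [c ->] <-]; apply: sub_sigma_algebra.
  exists 1%N, (fun=> l), (fun=> c); split=> //.
  rewrite setTI; apply/seteqP; split=> x /=; rewrite in_itv/=; first by move=> lx i _.
  by move=> /(_ 0%N); apply.
apply: (bclass_dynkin bH GE GI).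
  by have := HL 0 L0; under eq_fun do rewrite addr0 cos0.
move=> _ [n [l [c [Ll ->]]]].
(* The free cosine is what makes the induction on the number of half spaces possible; it is removed
   at the end by taking it equal to 1. *)
suff K l0 c0 : L l0 -> H (fun x => cos (l0 x + c0) * \1_(A n l c) x).
  by have := K _ 0 L0; under eq_fun do rewrite addr0 cos0 mul1r.
elim: n l0 c0 => [|n IH] l0 c0 Ll0.
  under eq_fun do rewrite indicE mem_set// mulr1; exact: HL.
have := @bclass_threshold (l n) (c n) (\1_(A n l c)) (Ll n) _ IH l0 c0 Ll0.
have h x : 0 <= (\1_(A n l c) x : R) <= 1 by rewrite indicE; case: (_ \in _) => /=; lra.
move=> /(_ h); congr H; apply/funext => x; congr (_ * _).
rewrite !indicE; have [xA|xA] := pselect (A n l c x); last first.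
  by rewrite memNset// mulr0 memNset// => h'; apply: xA => i /ltnW ?; exact: h'.
rewrite mem_set// mulr1; congr (_%:R); congr nat_of_bool.
apply/idP/idP; last by rewrite inE => /(_ n (ltnSn n)).
by move=> ?; rewrite inE /A/= => i; rewrite ltnS leq_eqVlt => /predU1P[->|/xA].
Qed.

End Trig.
End MonotoneClass.

(** * Gaussian variables *)

Section NormalChf.
Context {R : realType}.
Local Notation mu := (@lebesgue_measure R).
Implicit Types (k a y : R).
Variable c : R.

Let g (k y : R) := expR (- (k * y ^+ 2)).

Let mg k : measurable_fun setT (g k).
Proof.
apply: measurableT_comp => //; apply: measurableT_comp => //.
exact: measurable_funM.
Qed.

Let g_int k : 0 < k -> mu.-integrable setT (EFin \o g k).
Proof.
move=> k0; pose s : R := Num.sqrt ((2 * k)^-1).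
have s2 : s ^+ 2 = (2 * k)^-1 by rewrite sqr_sqrtr// invr_ge0; lra.
have s0 : s != 0 by rewrite gt_eqF// sqrtr_gt0 invr_gt0; lra.
have := integrableZl measurableT (normal_peak s)^-1 (integrable_normal_pdf 0 s).
apply: eq_integrable => // y _ /=.
rewrite -EFinM (normal_pdfE 0 s0) mulrA mulVf ?mul1r; last by rewrite gt_eqF// normal_peak_gt0.
by congr (expR _)%:E; rewrite subr0 s2; field; rewrite gt_eqF.
Qed.

(** Half of the Gaussian absorbs the factor [y]. This gives the dominating function for
    differentiating under the integral sign. *)
Let yg_bound k y : 0 < k -> `|y| * g k y <= (1 + 2 * k^-1) * g (k / 2) y.
Proof.
move=> k0; rewrite /g (_ : - (k * y ^+ 2) = - (k / 2 * y ^+ 2) + - (k / 2 * y ^+ 2)); last by field.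
rewrite expRD mulrA ler_wpM2r ?expR_ge0// expRN ler_pdivrMr ?expR_gt0//.
have := expR_ge1Dx (k / 2 * y ^+ 2).
set E := expR _ => hE.
have yy : `|y| <= 1 + y ^+ 2 by rewrite -real_normK ?num_real//; have := normr_ge0 y; nra.
apply: (le_trans yy).
have -> : 1 + y ^+ 2 = 1 + 2 * k^-1 * (k / 2 * y ^+ 2) by field; rewrite gt_eqF.
have k1 : 0 < k^-1 by rewrite invr_gt0.
have : 0 <= k / 2 * y ^+ 2 by rewrite mulr_ge0 ?sqr_ge0//; lra.
by nra.
Qed.

Let cosg_int k a : 0 < k -> mu.-integrable setT (EFin \o (fun y => cos (a * y + c) * g k y)).
Proof.
move=> k0; apply: le_integrable (g_int k0) => //.
  apply/measurable_EFinP/measurable_funM => //; last exact: mg.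
  apply: measurableT_comp; first exact: measurable_cos.
  by apply: measurable_funD => //; exact: measurable_funM.
move=> y _; rewrite /= lee_fin normrM (ger0_norm (expR_ge0 _)).
by rewrite ler_piMl ?expR_ge0 ?cos_abs_le1.
Qed.

Let G k y := (1 + 2 * k^-1) * g (k / 2) y.

Let G_int k : 0 < k -> mu.-integrable setT (EFin \o G k).
Proof.
move=> k0; have := @g_int (k / 2) _.
move=> /(_ _)/(integrableZl measurableT (1 + 2 * k^-1)); apply; lra.
Qed.

Let ysg_int k a : 0 < k ->
  mu.-integrable setT (EFin \o (fun y => y * sin (a * y + c) * g k y)).
Proof.
move=> k0; apply: le_integrable (G_int k0) => //.
  apply/measurable_EFinP/measurable_funM => //; last exact: mg.
  apply: measurable_funM => //.
  apply: measurableT_comp; first exact: measurable_sin.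
  by apply: measurable_funD => //; exact: measurable_funM.
move=> y _; rewrite /= lee_fin [leRHS]ger0_norm; last first.
  by rewrite mulr_ge0 ?expR_ge0//; have : 0 < k^-1 by [rewrite invr_gt0]; lra.
rewrite !normrM (ger0_norm (expR_ge0 _)).
apply: le_trans (yg_bound y k0); rewrite ler_wpM2r ?expR_ge0//.
by rewrite ler_piMr// sin_abs_le1.
Qed.

Let J k a := \int[mu]_y (cos (a * y + c) * g k y).

Let J_derive k a : 0 < k ->
  is_derive a 1 (J k) (- \int[mu]_y (y * sin (a * y + c) * g k y)).
Proof.
move=> k0.
have dcos (x y : R) : is_derive x 1 (fun x => cos (x * y + c) * g k y) (- (y * sin (x * y + c) * g k y)).
  by apply: is_derive_eq; rewrite /GRing.scale/=; ring.
have p1 x y : partial1of2 (fun x y => cos (x * y + c) * g k y) x y = - (y * sin (x * y + c) * g k y).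
  by rewrite /partial1of2 derive1E; have := dcos x y => -[_ ->].
have H : h^-1 *: (J k (h + a) - J k a) @[h --> 0^'] -->
    \int[mu]_y (partial1of2 (fun x y => cos (x * y + c) * g k y) a y).
  apply: (@cvg_differentiation_under_integral R _ _ mu
    (fun x y => cos (x * y + c) * g k y) setT measurableT a (a - 1) (a + 1) _ _ _
    (G k) _ (G_int k0) _).
  - by rewrite /= in_itv/=; lra.
  - by move=> x _; exact: cosg_int.
  - by move=> x y _ _; have [] := dcos x y.
  - by move=> y; rewrite mulr_ge0 ?expR_ge0//; have : 0 < k^-1 by [rewrite invr_gt0]; lra.
  - move=> x y _ _; rewrite p1 normrN !normrM (ger0_norm (expR_ge0 _)).
    apply: le_trans (yg_bound y k0); rewrite ler_wpM2r ?expR_ge0//.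
    by rewrite ler_piMr// sin_abs_le1.
have E : \int[mu]_y (partial1of2 (fun x y => cos (x * y + c) * g k y) a y) =
   - \int[mu]_y (y * sin (a * y + c) * g k y).
  rewrite -mulN1r -RintegralZl//; last exact: ysg_int.
  by apply: eq_Rintegral => y _; rewrite p1 mulN1r.
rewrite E in H.
have Hd : h^-1 *: (J k (h *: (1 : R) + a) - J k a) @[h --> 0^'] --> - \int[mu]_y (y * sin (a * y + c) * g k y).
  by under eq_fun do rewrite /GRing.scale/= mulr1.
apply: DeriveDef.
  by apply/cvg_ex; eexists; exact: Hd.
exact: (cvg_lim _ Hd).
Qed.

(** The derivative in [y] of sin (a y + c) exp (- k y^2). That its integral vanishes is the
    integration by parts behind J' = - (a / (2 k)) J. *)
Let h k a y := a * (cos (a * y + c) * g k y) - (2 * k) * (y * sin (a * y + c) * g k y).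

Let h_int k a : 0 < k -> mu.-integrable setT (EFin \o h k a).
Proof.
move=> k0; rewrite /h.
have := integrableB measurableT (integrableZl measurableT a (cosg_int a k0))
  (integrableZl measurableT (2 * k) (ysg_int a k0)).
by apply: eq_integrable.
Qed.

Let h_primitive k a y : is_derive y 1 (fun y => sin (a * y + c) * g k y) (h k a y).
Proof. by apply: is_derive_eq; rewrite /GRing.scale/= /h /g; ring. Qed.

(** The fundamental theorem of calculus leaves two boundary values, and exp z >= 1 + z gives exp (-
    k m^2) <= 1 / (k m) for m >= 1. *)
Let h_seg k a (n : nat) : 0 < k ->
  `|\int[mu]_(y in `[- n.+1%:R, n.+1%:R]) h k a y| <= 2 * (k * n.+1%:R)^-1.
Proof.
move=> k0; pose F y := sin (a * y + c) * g k y.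
have n0 : 0 < n.+1%:R :> R by rewrite ltr0n.
have n1 : 1 <= n.+1%:R :> R by rewrite ler1n.
have dF y : derivable F y 1 by have [] := h_primitive k a y.
have cF y : {for y, continuous F} by apply/differentiable_continuous/derivable1_diffP.
have ch : continuous (h k a).
  move=> y; apply/differentiable_continuous/derivable1_diffP.
  by apply: ex_derive.
rewrite /Rintegral (@continuous_FTC2 _ _ F) //=.
- have gb : g k n.+1%:R <= (k * n.+1%:R)^-1.
    rewrite /g expRN lef_pV2 ?posrE ?expR_gt0 ?mulr_gt0//.
    have := expR_ge1Dx (k * n.+1%:R ^+ 2); apply: le_trans.
    have := mulr_ge0 (ltW k0) (ltW n0); rewrite expr2; nra.
  have gN : g k (- n.+1%:R) = g k n.+1%:R by rewrite /g sqrrN.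
  rewrite /F gN -mulrBl normrM (ger0_norm (expR_ge0 _)).
  rewrite ler_pM ?expR_ge0// (le_trans (ler_normB _ _))//.
  by rewrite -[2]/(1 + 1) lerD// sin_abs_le1.
- lra.
- exact: continuous_subspaceT.
- by split=> [y _||]; [exact: dF|apply: cvg_within_filter; exact: cF..].
- by move=> y _; rewrite derive1E; have [_ ->] := h_primitive k a y.
Qed.

Let h_zero k a : 0 < k -> \int[mu]_y h k a y = 0.
Proof.
move=> k0; have mh : measurable_fun setT (h k a).
  by have /integrableP[/measurable_EFinP] := h_int a k0.
pose f_ n := h k a \_ `[- n.+1%:R, n.+1%:R].
have [||||| _ _ H] := @dominated_convergence _ _ _ mu setT measurableT
  (fun n y => (f_ n y)%:E) (EFin \o h k a) (fun y => `|(h k a y)%:E|%E).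
- move=> n; apply/measurable_EFinP.
  by apply/(measurable_restrictT _ _).1 => //; exact: measurable_funTS.
- exact/measurable_EFinP.
- apply: aeW => y _; apply: cvg_EFin; first exact: nearW.
  apply: cvg_near_cst; exists (Num.truncn `|y|) => // n /= Nn.
  rewrite /f_ patchE mem_set//= in_itv/= -ler_norml.
  by rewrite (le_trans (ltW (truncnS_gt _)))// ler_nat ltnS.
- exact: integrable_abse (h_int a k0).
- apply: aeW => y n _; rewrite /f_ patchE/=; case: ifP => _ //.
  by rewrite normr0 lee_fin.
have {}H : \int[mu]_y f_ n y @[n --> \oo] --> \int[mu]_y h k a y.
  rewrite /Rintegral; apply: fine_cvg; rewrite fineK//.
  by apply: integrable_fin_num => //; exact: h_int.
apply/(cvg_unique _ H) => //; apply/cvgP_eps => e e0.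
exists (Num.truncn (2 / (k * e))) => n Nn; rewrite subr0 /f_ -Rintegral_mkcond.
rewrite (le_trans (h_seg a n k0))//.
rewrite ler_pdivrMr; last by rewrite mulr_gt0 ?ltr0n.
have : 2 / (k * e) <= n.+1%:R.
  by rewrite (le_trans (ltW (truncnS_gt _)))// ler_nat ltnS.
by rewrite ler_pdivrMr ?mulr_gt0//; nra.
Qed.

(** By the differential equation for J, the product J(a) exp (a^2 / (4 k)) has derivative zero. *)
Let J_val k a : 0 < k -> J k a = J k 0 * expR (- (a ^+ 2 / (4 * k))).
Proof.
move=> k0.
have E b : J k b * b = (2 * k) * \int[mu]_y (y * sin (b * y + c) * g k y).
  have := h_zero b k0; rewrite /h RintegralB//; last 2 first.
    by have := integrableZl measurableT b (cosg_int b k0); exact: eq_integrable.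
    by have := integrableZl measurableT (2 * k) (ysg_int b k0); exact: eq_integrable.
  rewrite !RintegralZl//; [|exact: ysg_int|exact: cosg_int].
  by move/eqP; rewrite subr_eq0 => /eqP <-; rewrite mulrC.
pose D b := J k b * expR (b ^+ 2 / (4 * k)).
have dD (b : R) : is_derive b 1 D 0.
  have dJ := J_derive b k0.
  rewrite /D; apply: is_derive_eq; rewrite /GRing.scale/=.
  have -> : \int[mu]_y (y * sin (b * y + c) * g k y) = J k b * b / (2 * k).
    by rewrite E mulrC mulKf// gt_eqF//; lra.
  by field; rewrite gt_eqF.
have := @is_derive_0_is_cst R D a 0 dD.
rewrite /D expr0n /= mul0r expR0 mulr1 => <-.
by rewrite -mulrA -expRD subrr expR0 mulr1.
Qed.

Let integral_normal_prob (s : R) (f : R -> R) : bmeas f ->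
  \int[normal_prob 0 s]_y f y = \int[mu]_y (f y * normal_pdf 0 s y).
Proof.
pose H f := bmeas f /\
  \int[normal_prob 0 s]_y f y = \int[mu]_y (f y * normal_pdf 0 s y).
have pi := integrable_normal_pdf 0 s.
have int f1 : bmeas f1 -> mu.-integrable setT (EFin \o (fun y => f1 y * normal_pdf 0 s y)).
  move=> [mf [M fM]]; have /(integrableZl measurableT `|M|) := pi.
  apply: le_integrable => //.
    apply/measurable_EFinP/measurable_funM => //; exact: measurable_normal_pdf.
  move=> y _; rewrite /= lee_fin !normrM normr_id ler_wpM2r//.
  by rewrite (le_trans (fM y))// ler_norm.
suff bH : bclass H.
  move=> bf; suff [] : H f by [].
  apply: (bclass_indic bH) => // A mA; split; first exact: bmeas_indic.
  rewrite Eexp_indic// /Rintegral; congr fine.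
  transitivity (\int[mu]_(y in A) (normal_pdf 0 s y)%:E)%E => //; rewrite [LHS]integral_mkcond.
  apply: eq_integral => y _; rewrite patchE indicE.
  by case: (_ \in _); rewrite ?mul1r ?mul0r.
split.
- move=> f1 f2 a b [b1 e1] [b2 e2]; split; first by apply: bmeasD; exact: bmeasZ.
  rewrite EexpD ?EexpZ//; [|exact: bmeasZ|exact: bmeasZ].
  rewrite e1 e2 -!RintegralZl//; try exact: int.
  rewrite -RintegralD//.
  + by apply: eq_Rintegral => y _; ring.
  + by have /(integrableZl measurableT a) := int _ b1; exact: eq_integrable.
  + by have /(integrableZl measurableT b) := int _ b2; exact: eq_integrable.
- move=> f_ f0 M Hf fM fc.
  have bf : bmeas f0.
    split; last first.
      by exists M => y; apply: cvg_abs_le (fc y) _ => n; exact: fM.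
    by apply: (measurable_fun_cvg (h := f_)) => [n|y _]; [have [[]] := Hf n|exact: fc].
  split=> //.
  have c1 := Eexp_cvg (P := normal_prob 0 s) (fun n => (Hf n).1.1) bf.1 fM (aeW _ fc).
  have [||||| _ _ c2] := @dominated_convergence _ _ _ mu setT measurableT
    (fun n y => (f_ n y * normal_pdf 0 s y)%:E) (fun y => (f0 y * normal_pdf 0 s y)%:E)
    (fun y => (`|M| * normal_pdf 0 s y)%:E).
  + by move=> n; have /integrableP[] := int _ (Hf n).1.
  + by have /integrableP[] := int _ bf.
  + apply: aeW => y _; apply: cvg_EFin; first exact: nearW.
    by apply: cvgM; [exact: fc|exact: cvg_cst].
  + by have /(integrableZl measurableT `|M|) := pi; exact: eq_integrable.
  + apply: aeW => y n _; rewrite /= lee_fin normrM (ger0_norm (normal_pdf_ge0 _ _ _)).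
    by rewrite ler_wpM2r ?normal_pdf_ge0// (le_trans (fM n y))// ler_norm.
  apply: (cvg_unique _ c1) => //.
  rewrite [X in X @ _](_ : _ = (fun n => \int[mu]_y (f_ n y * normal_pdf 0 s y))); last first.
    by apply/funext => n; rewrite (Hf n).2.
  rewrite /Rintegral; apply: fine_cvg; rewrite fineK//.
  by apply: integrable_fin_num => //; exact: int.
Qed.

Lemma normal_chf (s b : R) : 0 < s ->
  \int[normal_prob 0 s]_y cos (b * y + c) = expR (- (b ^+ 2 * s ^+ 2 / 2)) * cos c.
Proof.
move=> s0; pose k := (2 * s ^+ 2)^-1.
have s20 : 0 < s ^+ 2 by rewrite exprn_gt0.
have k0 : 0 < k by rewrite invr_gt0; lra.
have pdfE y : normal_pdf 0 s y = normal_peak s * g k y.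
  rewrite (normal_pdfE 0 (lt0r_neq0 s0)); congr (_ * expR _).
  by rewrite subr0 /k; field; rewrite gt_eqF.
have chf0 b' : \int[normal_prob 0 s]_y cos (b' * y + c) = normal_peak s * J k b'.
  rewrite integral_normal_prob; last first.
    by apply: bmeas_cos; apply: measurable_funD => //; exact: measurable_funM.
  rewrite -RintegralZl//; last exact: cosg_int.
  by apply: eq_Rintegral => y _; rewrite pdfE; ring.
(* Frequency 0 fixes the constant: there the integrand is [cos c] and the measure has mass 1, so the
   Gaussian integral itself is not evaluated. *)
rewrite chf0 J_val// mulrA -chf0.
under eq_Rintegral do rewrite mul0r add0r.
by rewrite Eexp_cst mulrC; congr (expR _ * _); rewrite /k; field; rewrite gt_eqF.
Qed.

End NormalChf.

Lemma bigcap_cons (I : eqType) (T : Type) (x : I) (s : seq I) (F : I -> set T) :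
  \bigcap_(i in [set` x :: s]) F i = F x `&` \bigcap_(i in [set` s]) F i.
Proof.
rewrite -bigcap_setU1; congr bigcap; apply/seteqP; split=> y /=.
  by rewrite inE => /predU1P[->|]; [left|right].
by rewrite inE => -[->|->]; rewrite ?eqxx ?orbT.
Qed.

(** * Independence and sums of independent Gaussian variables *)

Section Independence.
Context {R : realType} {d : measure_display} {Om : measurableType d}.
Variable P : probability Om R.

(** Keeping [z] as a constant known only through the identity on indicators lets the same extension
    serve for each factor of a product in turn. *)
Lemma Eexp_factor d' (T : measurableType d') (Z : Om -> R) (z : R) (Y : Om -> T) :
  bmeas Z -> measurable_fun setT Y ->
  (forall A, measurable A ->
    \int[P]_w (Z w * \1_(Y @^-1` A) w) = z * fine (P (Y @^-1` A))) ->
  forall F : T -> R, bmeas F ->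
    \int[P]_w (Z w * F (Y w)) = z * \int[P]_w F (Y w).
Proof.
move=> bZ mY ZA F bF.
have bc f : bmeas f -> bmeas (fun w => f (Y w)).
  by move=> [mf [M fM]]; split; [exact: measurableT_comp|exists M].
pose H f := bmeas f /\ \int[P]_w (Z w * f (Y w)) = z * \int[P]_w f (Y w).
suff [] : H F by [].
apply: (@bclass_indic R d' T H _ _ _ bF) => [|A mA]; last first.
  split; first exact: bmeas_indic.
  have mYA : measurable (Y @^-1` A) by rewrite -[X in measurable X]setTI; exact: mY.
  have -> : (fun w => \1_A (Y w)) = \1_(Y @^-1` A) :> (Om -> R).
    by apply/funext => w; rewrite !indicE; congr (_%:R); congr nat_of_bool;
       apply/idP/idP; rewrite !inE.
  by rewrite Eexp_indic// -ZA.
split=> [f g a b [bf ef] [bg eg]|f_ f M Hf fM fc].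
  split; first by apply: bmeasD; exact: bmeasZ.
  rewrite (_ : (fun w => _ * _) = (fun w => a * (Z w * f (Y w)) + b * (Z w * g (Y w)))); last first.
    by apply/funext => w; ring.
  rewrite !EexpD ?EexpZ//; try (by apply: bmeasZ; exact: bc); try exact: bc;
    try (by apply: bmeasM => //; exact: bc);
    try (by apply: bmeasZ; apply: bmeasM => //; exact: bc).
  by rewrite ef eg; ring.
have bf : bmeas f.
  split; last by exists M => y; apply: cvg_abs_le (fc y) _ => n; exact: fM.
  by apply: (measurable_fun_cvg (h := f_)) => [n|y _]; [have [[]] := Hf n|exact: fc].
split=> //; have [mZ [K ZK]] := bZ.
have c1 : \int[P]_w (Z w * f_ n (Y w)) @[n --> \oo] --> \int[P]_w (Z w * f (Y w)).
  apply: (Eexp_cvg (M := K * M)).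
  - by move=> n; apply: measurable_funM => //; apply: measurableT_comp => //; exact: (Hf n).1.1.
  - by apply: measurable_funM => //; apply: measurableT_comp => //; exact: bf.1.
  - by move=> n x; rewrite normrM ler_pM.
  - by apply: aeW => w; apply: cvgM; [exact: cvg_cst|exact: fc].
apply: (cvg_unique _ c1) => //.
rewrite [X in X @ _](_ : _ = (fun n => z * \int[P]_w f_ n (Y w))); last first.
  by apply/funext => n; rewrite (Hf n).2.
apply: cvgM; first exact: cvg_cst.
apply: (Eexp_cvg (M := M)) => //.
- by move=> n; apply: measurableT_comp => //; exact: (Hf n).1.1.
- by apply: measurableT_comp => //; exact: bf.1.
- by apply: aeW => w; exact: fc.
Qed.

Lemma independent2_mul d1 d2 (T1 : measurableType d1) (T2 : measurableType d2)
    (G1 G2 : set (set Om)) (Y1 : Om -> T1) (Y2 : Om -> T2) :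
  independent2 P G1 G2 ->
  measurable_fun setT Y1 -> measurable_fun setT Y2 ->
  (forall A, measurable A -> G1 (Y1 @^-1` A)) ->
  (forall A, measurable A -> G2 (Y2 @^-1` A)) ->
  forall (F1 : T1 -> R) (F2 : T2 -> R), bmeas F1 -> bmeas F2 ->
    \int[P]_w (F1 (Y1 w) * F2 (Y2 w)) = \int[P]_w F1 (Y1 w) * \int[P]_w F2 (Y2 w).
Proof.
move=> ind m1 m2 g1 g2 F1 F2 b1 b2.
have bc1 : bmeas (fun w => F1 (Y1 w)).
  by case: b1 => [mf [M fM]]; split; [exact: measurableT_comp|exists M].
have mp d' (T : measurableType d') (Y : Om -> T) A : measurable_fun setT Y ->
    measurable A -> measurable (Y @^-1` A).
  by move=> mY mA; rewrite -[X in measurable X]setTI; exact: mY.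
apply: Eexp_factor => // A mA.
rewrite mulrC -Eexp_indic; last exact: mp.
rewrite [LHS](_ : _ = \int[P]_w (\1_(Y2 @^-1` A) w * F1 (Y1 w))); last first.
  by apply: eq_Rintegral => w _; rewrite mulrC.
apply: Eexp_factor => //; first exact/bmeas_indic/mp.
move=> B mB; rewrite !Eexp_indic; try exact: mp.
rewrite (_ : (fun w => _ * _) = \1_(Y1 @^-1` B `&` Y2 @^-1` A)); last first.
  by apply/funext => w; rewrite indicI mulrC.
rewrite Eexp_indic; last by apply: measurableI; exact: mp.
have -> : P (Y1 @^-1` B `&` Y2 @^-1` A) = (P (Y1 @^-1` B) * P (Y2 @^-1` A))%E.
  by apply: ind; [exact: g1|exact: g2].
by rewrite fineM ?fin_num_measure// 1?mulrC//; exact: mp.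
Qed.

(** Centred Gaussian of variance [v], encoded by its characteristic function: the phases c = 0 and c
    = - pi / 2 give real and imaginary part. The degenerate case v = 0 is included. *)
Definition gauss (v : R) (Y : Om -> R) := measurable_fun setT Y /\
  forall b c, \int[P]_w cos (b * Y w + c) = expR (- (b ^+ 2 * v / 2)) * cos c.

Lemma gaussZ a v Y : gauss v Y -> gauss (a ^+ 2 * v) (fun w => a * Y w).
Proof.
move=> [mY gY]; split; first exact: measurable_funM.
move=> b c; have := gY (b * a) c.
under [in X in X -> _]eq_Rintegral do rewrite -mulrA.
by move->; congr (expR _ * _); field.
Qed.

Lemma gauss0 : gauss 0 (fun=> 0).
Proof.
split; first exact: measurable_cst.
by move=> b c; rewrite mulr0 add0r Eexp_cst mulr0 mul0r oppr0 expR0 mul1r.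
Qed.

(** In the addition formula the product of sines drops out, because E sin Y = 0. *)
Lemma gauss_indep2 d1 (T1 : measurableType d1) (G1 G2 : set (set Om))
    (X : Om -> T1) (F : T1 -> R) v (Y : Om -> R) :
  independent2 P G1 G2 -> measurable_fun setT X -> measurable_fun setT F ->
  (forall A, measurable A -> G1 (X @^-1` A)) ->
  (forall A, measurable A -> G2 (Y @^-1` A)) -> gauss v Y ->
  \int[P]_w cos (F (X w) + Y w) = expR (- (v / 2)) * \int[P]_w cos (F (X w)).
Proof.
move=> ind mX mF g1 g2 [mY gY].
have mFX : measurable_fun setT (fun w => F (X w)) by exact: measurableT_comp.
have Ec : \int[P]_w cos (Y w) = expR (- (v / 2)).
  have := gY 1 0; under eq_Rintegral do rewrite mul1r addr0.
  by rewrite cos0 mulr1 expr1n mul1r.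
have Es : \int[P]_w sin (Y w) = 0.
  have := gY 1 (- (pi / 2)); under eq_Rintegral do rewrite mul1r cosB cos_pihalf sin_pihalf mulr0 add0r mulr1.
  by rewrite cosN cos_pihalf mulr0.
under eq_Rintegral do rewrite cosD.
rewrite EexpB; [|by apply: bmeasM; exact: bmeas_cos|by apply: bmeasM; exact: bmeas_sin].
rewrite (independent2_mul ind mX mY g1 g2 (F1 := fun x => cos (F x)) (F2 := @cos R)); last 2 first.
  exact: bmeas_cos.
  by apply: (bmeas_cos (f := id)).
rewrite (independent2_mul ind mX mY g1 g2 (F1 := fun x => sin (F x)) (F2 := @sin R)); last 2 first.
  exact: bmeas_sin.
  by apply: (bmeas_sin (f := id)).
by rewrite Ec Es mulr0 subr0 mulrC.
Qed.

Section GaussSum.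
Variables (I : eqType) (G : I -> set (set Om)) (v : I -> R) (Y : I -> Om -> R).
Hypothesis ind : independent P G.
Hypothesis mG : forall i A, G i A -> measurable A.
Hypothesis GY : forall i A, measurable A -> G i (Y i @^-1` A).
Hypothesis gY : forall i, gauss (v i) (Y i).

(** [independent] is only a product rule for events, so the independence of a partial sum from the
    remaining indices is not at hand. Carrying the indicator of an event in the indices of [K],
    disjoint from those summed, makes the induction close. *)
Lemma gauss_sum_indic (J K : seq I) (E : I -> set Om) c : uniq (J ++ K) ->
  (forall i, i \in K -> G i (E i)) ->
  \int[P]_w (cos (\sum_(i <- J) Y i w + c) * \1_(\bigcap_(i in [set` K]) E i) w) =
  expR (- ((\sum_(i <- J) v i) / 2)) * cos c * fine (P (\bigcap_(i in [set` K]) E i)).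
Proof.
have mE (K' : seq I) E' : (forall i, i \in K' -> G i (E' i)) ->
    measurable (\bigcap_(i in [set` K']) E' i).
  elim: K' => [_|i K' IH' GE]; first by rewrite set_nil bigcap_set0.
  rewrite bigcap_cons; apply: measurableI.
    by apply: (mG (i := i)); apply: GE; rewrite mem_head.
  by apply: IH' => j jK; apply: GE; rewrite inE jK orbT.
have mS J' c' : measurable_fun setT (fun w => \sum_(i <- J') Y i w + c').
  by apply: measurable_funD => //; apply: measurable_sum => i; exact: (gY i).1.
elim: J K E c => [|x J IH] K E c.
  move=> uK GE; under eq_Rintegral do rewrite big_nil add0r.
  rewrite EexpZ; last exact/bmeas_indic/mE.
  rewrite Eexp_indic; last exact: mE.
  by rewrite big_nil mul0r oppr0 expR0 mul1r.
rewrite cat_cons => /= /andP[xJK uJK] GE.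
have xK : x \notin K by apply: contra xJK; rewrite mem_cat orbC => ->.
have uJxK : uniq (J ++ x :: K).
  have /perm_uniq -> : perm_eq (J ++ x :: K) (x :: J ++ K).
    by rewrite -cat1s perm_catCA.
  by rewrite /= xJK.
have F c' (f : R -> R) : bmeas f ->
    \int[P]_w (cos (\sum_(i <- J) Y i w + c') * \1_(\bigcap_(i in [set` K]) E i) w * f (Y x w))
    = expR (- ((\sum_(i <- J) v i) / 2)) * cos c' * fine (P (\bigcap_(i in [set` K]) E i))
      * \int[P]_w f (Y x w).
  move=> bf; apply: Eexp_factor => //.
  - by apply: bmeasM; [exact/bmeas_cos/mS|exact/bmeas_indic/mE].
  - exact: (gY x).1.
  (* The index [x] moves from the sum to the events; the induction hypothesis for [x :: K] then
     yields the factorisation on indicators. *)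
  move=> A mA; pose E' i := if i == x then Y x @^-1` A else E i.
  have GE' i : i \in x :: K -> G i (E' i).
    rewrite inE /E'; have [-> _|ix /= iK] := eqVneq i x; [exact: GY|exact: GE].
  have EE : \bigcap_(i in [set` K]) E' i = \bigcap_(i in [set` K]) E i.
    apply: eq_bigcapr => i /= iK; rewrite /E'.
    by case: eqVneq => // ix; rewrite -ix iK in xK.
  have EU : \bigcap_(i in [set` x :: K]) E' i =
      (Y x @^-1` A) `&` \bigcap_(i in [set` K]) E i.
    by rewrite bigcap_cons EE /E' eqxx.
  have := IH (x :: K) E' c' uJxK GE'.
  have uxK : uniq (x :: K) by move: uJxK; rewrite cat_uniq => /and3P[].
  have PxK : P (\bigcap_(i in [set` x :: K]) E' i) =
      (P (Y x @^-1` A) * P (\bigcap_(i in [set` K]) E i))%E.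
    rewrite ind// big_cons /E' eqxx -EE -ind//; first by case/andP: uxK.
    by move=> i iK; apply: GE'; rewrite inE iK orbT.
  rewrite PxK EU fineM ?fin_num_measure//; last 2 first.
    exact/(mG (i := x))/GY.
    exact: mE.
  rewrite mulrA [RHS]mulrAC => <-.
  by apply: eq_Rintegral => w _; rewrite indicI /=; ring.
under eq_Rintegral => w _.
  rewrite big_cons (_ : _ * _ =
    (cos (\sum_(i <- J) Y i w + c) * \1_(\bigcap_(i in [set` K]) E i) w * cos (Y x w))
    - (cos (\sum_(i <- J) Y i w + (c - pi / 2)) * \1_(\bigcap_(i in [set` K]) E i) w * sin (Y x w))); last first.
    rewrite addrA cosB cos_pihalf sin_pihalf -addrA cosD; ring.
  over.
have bI := bmeas_indic (mE K E GE).
have mYx := (gY x).1.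
rewrite EexpB; last 2 first.
- by apply: bmeasM; [apply: bmeasM => //; exact/bmeas_cos/mS|exact: bmeas_cos].
- by apply: bmeasM; [apply: bmeasM => //; exact/bmeas_cos/mS|exact: bmeas_sin].
rewrite !F; [|exact: (bmeas_sin (f := id))|exact: (bmeas_cos (f := id))].
have Ec : \int[P]_w cos (Y x w) = expR (- (v x / 2)).
  have := (gY x).2 1 0; under eq_Rintegral do rewrite mul1r addr0.
  by rewrite cos0 mulr1 expr1n mul1r.
have Es : \int[P]_w sin (Y x w) = 0.
  have := (gY x).2 1 (- (pi / 2)); under eq_Rintegral do rewrite mul1r cosB cos_pihalf sin_pihalf mulr0 add0r mulr1.
  by rewrite cosN cos_pihalf mulr0.
rewrite Ec Es mulr0 subr0 big_cons mulrDl opprD expRD; ring.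
Qed.

End GaussSum.

Lemma gauss_sum (I : eqType) (G : I -> set (set Om)) (v : I -> R) (Y : I -> Om -> R) :
  independent P G ->
  (forall i A, G i A -> measurable A) ->
  (forall i A, measurable A -> G i (Y i @^-1` A)) ->
  (forall i, gauss (v i) (Y i)) ->
  forall J : seq I, uniq J ->
  gauss (\sum_(i <- J) v i) (fun w => \sum_(i <- J) Y i w).
Proof.
move=> ind mG GY gY J uJ; split; first by apply: measurable_sum => i; exact: (gY i).1.
move=> b c; have := @gauss_sum_indic I G (fun i => b ^+ 2 * v i)
  (fun i w => b * Y i w) ind mG _ _ J [::] (fun=> setT) c _ _.
rewrite !set_nil !bigcap_set0 indicT.
under eq_Rintegral do rewrite /= mulr1 -mulr_sumr.
rewrite probability_setT mulr1 -mulr_sumr => -> //.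
- move=> i A mA; apply: (GY i ((fun y => b * y) @^-1` A)).
  by rewrite -[X in measurable X]setTI; apply: measurable_funM.
- by move=> i; exact: gaussZ.
- by rewrite cats0.
Qed.

Lemma sigma_of_sub {d'} {T : measurableType d'} {I : Type} (D : set I)
    (X : I -> Om -> T) (G : set (set Om)) : sigma_algebra setT G ->
  (forall i A, D i -> measurable A -> G (X i @^-1` A)) -> sigma_of D X `<=` G.
Proof.
move=> sG H; apply: smallest_sub => // A [i Di [B mB <-]].
by rewrite setTI; exact: H.
Qed.

Lemma sigma_of_measurable {d'} {T : measurableType d'} {I : Type} (D : set I)
    (X : I -> Om -> T) : (forall i, D i -> measurable_fun setT (X i)) ->
  forall A, sigma_of D X A -> measurable A.
Proof.
move=> mX; apply: sigma_of_sub; first exact: sigma_algebra_measurable.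
by move=> i A Di mA; rewrite -[X in measurable X]setTI; exact: mX.
Qed.

Lemma sigma_of_preimage {d'} {T : measurableType d'} {I : Type} (D : set I)
    (X : I -> Om -> T) i A : D i -> measurable A -> sigma_of D X (X i @^-1` A).
Proof.
move=> Di mA; apply: sub_sigma_algebra; exists i => //.
by exists A => //; rewrite setTI.
Qed.

(* A function of finitely many of the [X i] is [sigma_of D X]-measurable
   because it is measurable for that sigma-algebra on [Om]. *)
Lemma sigma_of_comb {I : Type} (D : set I) (X : I -> Om -> R) {K : Type}
    (s : seq K) (c : K -> R) (i j : K -> I) : (forall k, D (i k) /\ D (j k)) ->
  forall A, measurable A ->
  sigma_of D X ((fun w => \sum_(k <- s) c k * (X (i k) w - X (j k) w)) @^-1` A).
Proof.
move=> Dij A mA.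
pose T := g_sigma_algebraType
  (\bigcup_(i in D) preimage_set_system setT (X i) measurable).
have mX l : D l -> measurable_fun (setT : set T) (X l : T -> R).
  by move=> Dl _ B mB; rewrite setTI; exact: sigma_of_preimage.
have : measurable_fun (setT : set T)
    (fun w : T => \sum_(k <- s) c k * (X (i k) w - X (j k) w)).
  apply: measurable_sum => k; apply: measurable_funM => //.
  by apply: measurable_funB; apply: mX; have [] := Dij k.
by move=> /(_ measurableT A mA); rewrite setTI.
Qed.

Lemma brownian_gauss (W : R -> Om -> R) (r : nat -> R) (c : nat -> R) m :
  brownian P W -> 0 <= r 0%N -> {homo r : i j / (i <= j)%N >-> i <= j} ->
  gauss (\sum_(j <- iota 0 m) c j ^+ 2 * (r j.+1 - r j))
    (fun w => \sum_(j <- iota 0 m) c j * (W (r j.+1) w - W (r j) w)).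
Proof.
move=> bW r0 hr.
have rj j : 0 <= r j by rewrite (le_trans r0)// hr.
have mI j : measurable_fun setT (fun w => W (r j.+1) w - W (r j) w).
  by apply: measurable_funB; exact: (brownian_measurable bW).
apply: (gauss_sum (G := fun n : nat =>
  sigma_of [set: unit] (fun _ w => W (r n.+1) w - W (r n) w))).
- exact: (brownian_increments bW).
- by move=> j; apply: sigma_of_measurable.
- move=> j A mA; have := @sigma_of_preimage _ R unit setT
    (fun _ w => W (r j.+1) w - W (r j) w) tt ((fun y => c j * y) @^-1` A).
  apply => //; rewrite -[X in measurable X]setTI.
  by apply: measurable_funM.
- move=> j; apply: gaussZ.
  (* Times may repeat, while Brownian increments are described only for s < t; an empty increment is
     the degenerate Gaussian. *)
  have := hr _ _ (leqnSn j); rewrite le_eqVlt => /predU1P[<-|lt].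
    by rewrite subrr; under eq_fun do rewrite subrr; exact: gauss0.
  split=> // b c'; have := brownian_gaussian bW (rj j) lt.
  move=> hl; rewrite -(@Eexp_pushforward R _ _ _ _ P (normal_prob 0 (Num.sqrt (r j.+1 - r j)))
    _ (fun y => cos (b * y + c')) hl).
    by rewrite normal_chf ?sqrtr_gt0 ?subr_gt0// sqr_sqrtr// subr_ge0 ltW.
  by apply: bmeas_cos; apply: measurable_funD => //; exact: measurable_funM.
- exact: iota_uniq.
Qed.

Lemma brownian_family_gauss (B : int -> R -> Om -> R) (r : nat -> R)
    (c : int -> nat -> R) (J : seq int) m :
  brownian_family P B -> uniq J -> 0 <= r 0%N ->
  {homo r : i j / (i <= j)%N >-> i <= j} ->
  gauss (\sum_(x <- J) \sum_(j <- iota 0 m) c x j ^+ 2 * (r j.+1 - r j))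
    (fun w => \sum_(x <- J) \sum_(j <- iota 0 m)
       c x j * (B x (r j.+1) w - B x (r j) w)).
Proof.
move=> [bB iB] uJ r0 hr.
have rj j : 0 <= r j by rewrite (le_trans r0)// hr.
apply: (gauss_sum iB) => //.
- move=> x; apply: sigma_of_measurable => t; rewrite /= in_itv/= andbT.
  exact: (brownian_measurable (bB x)).
- by move=> x A mA; apply: sigma_of_comb => // k; rewrite /= !in_itv/= !andbT.
- by move=> x; exact: brownian_gauss.
Qed.

End Independence.

(** * The generator cut to a window and the Euler scheme *)

(* The integers [-M <= x < M], in the order in which [sumZ] sums them. *)
Definition win (M : nat) : seq int :=
  [seq Posz n | n <- iota 0 M] ++ [seq Negz n | n <- iota 0 M].

Lemma mem_win x M : (x \in win M) = (- M%:Z <= x < M%:Z).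
Proof.
rewrite mem_cat; case: x => n.
  rewrite mem_map; last by move=> ? ? [].
  rewrite mem_iota add0n [X in _ || X](_ : _ = false); first by rewrite orbF; lia.
  by apply/negbTE/negP => /mapP[].
rewrite [X in X || _](_ : _ = false); last by apply/negbTE/negP => /mapP[].
by rewrite mem_map; [rewrite mem_iota add0n /=; lia|move=> ? ? []].
Qed.

Lemma win_uniq M : uniq (win M).
Proof.
rewrite cat_uniq !map_inj_uniq ?iota_uniq//=; try by move=> ? ? [].
by rewrite andbT; apply/hasPn => _ /mapP[n _ ->]; apply/negP => /mapP[].
Qed.

Section Window.
Context {R : realType}.
Implicit Types (u v f g b : int -> R) (M : nat) (x : int).

Lemma win_recr M f :
  \sum_(x <- win M.+1) f x = \sum_(x <- win M) f x + (f M%:Z + f (Negz M)).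
Proof.
rewrite /win -addn1 iotaD !map_cat /= !big_cat /= !big_seq1 add0n; ring.
Qed.

Lemma win_series M f :
  \sum_(x <- win M) f x = series (fun n : nat => f (Posz n) + f (Negz n)) M.
Proof.
elim: M => [|M IH]; first by rewrite /series /= big_nil big_geq.
by rewrite win_recr IH /series/= big_nat_recr.
Qed.

Lemma win_shift M f :
  \sum_(x <- win M) f (x + 1) = \sum_(x <- win M) f x + f M%:Z - f (- M%:Z).
Proof.
elim: M => [|M IH]; first by rewrite !big_nil; ring.
rewrite !win_recr IH.
rewrite (_ : M%:Z + 1 = M.+1%:Z); last by lia.
rewrite (_ : Negz M + 1 = - M%:Z); last by lia.
rewrite (_ : Negz M = - M.+1%:Z); last by lia.
ring.
Qed.

Definition supp M u := forall x, x \notin win M -> u x = 0.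

Lemma supp_le M M' u : (M <= M')%N -> supp M u -> supp M' u.
Proof. by move=> MM su x xM; apply: su; move: xM; rewrite !mem_win; lia. Qed.

Lemma win_supp M M' u : (M <= M')%N -> supp M u ->
  \sum_(x <- win M') u x = \sum_(x <- win M) u x.
Proof.
move=> MM su; rewrite -(subnKC MM); elim: (M' - M)%N => [|k IH]; first by rewrite addn0.
rewrite addnS win_recr IH !su ?addr0//; rewrite mem_win; lia.
Qed.

Definition cond x : R := x%:~R ^+ 2 + 1.

(** Edges are indexed by their left endpoint. Cutting every edge that leaves the window reflects the
    walk, so the cut operator stays symmetric and conserves mass. *)
Definition condM M x : R := if (x \in win M) && (x + 1 \in win M) then cond x else 0.

Definition lap b u x : R := b x * (u (x + 1) - u x) - b (x - 1) * (u x - u (x - 1)).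

Lemma cond_gt0 x : 0 < cond x.
Proof. by rewrite /cond; have := sqr_ge0 (x%:~R : R); lra. Qed.

Lemma condM_ge0 M x : 0 <= condM M x.
Proof. by rewrite /condM; case: ifP => // _; exact/ltW/cond_gt0. Qed.

Lemma condM_le_cond M x : condM M x <= cond x.
Proof. by rewrite /condM; case: ifP => // _; exact/ltW/cond_gt0. Qed.

Lemma condM_le M x : condM M x <= M%:R ^+ 2 + 1.
Proof.
rewrite /condM; case: ifP => [/andP[]|_].
  rewrite mem_win => /andP[Mx xM] _; rewrite /cond lerD2r -[leLHS]real_normK ?num_real//.
  rewrite lerXn2r ?nnegrE// ?ler_norml.
  have -> : (M%:R : R) = (M%:Z)%:~R by [].
  by rewrite -mulrNz !ler_int; lia.
by have := sqr_ge0 (M%:R : R); lra.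
Qed.

Lemma condM_edge M x : (x < - M%:Z) || (M%:Z <= x + 1) -> condM M x = 0.
Proof. by rewrite /condM !mem_win => H; rewrite ifF//; lia. Qed.

Lemma supp_lapM M u : supp M u -> supp M (lap (condM M) u).
Proof.
move=> su x; rewrite mem_win => xM.
by rewrite /lap !condM_edge ?mul0r ?subrr//; lia.
Qed.

Lemma lapL b u v (c e : R) x :
  lap b (fun x => c * u x + e * v x) x = c * lap b u x + e * lap b v x.
Proof. by rewrite /lap; ring. Qed.

(* Summation by parts; the boundary terms vanish since [condM] does. *)
Lemma lapM_dirichlet M u g :
  \sum_(x <- win M) lap (condM M) u x * g x =
  - \sum_(x <- win M) condM M x * (u (x + 1) - u x) * (g (x + 1) - g x).
Proof.
have := win_shift M (fun x => condM M (x - 1) * (u x - u (x - 1)) * g x).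
rewrite !condM_edge; try lia.
rewrite !mul0r subr0 addr0 => E.
have -> : \sum_(x <- win M) lap (condM M) u x * g x =
  \sum_(x <- win M) condM M x * (u (x + 1) - u x) * g x -
  \sum_(x <- win M) condM M (x - 1) * (u x - u (x - 1)) * g x.
  by rewrite -sumrB; apply: eq_bigr => x _; rewrite /lap; ring.
rewrite -E -sumrB -sumrN; apply: eq_bigr => x _.
by rewrite (_ : x + 1 - 1 = x); [ring|lia].
Qed.

Lemma lapM_sym M u g :
  \sum_(x <- win M) lap (condM M) u x * g x =
  \sum_(x <- win M) u x * lap (condM M) g x.
Proof.
rewrite lapM_dirichlet; under [in RHS]eq_bigr do rewrite mulrC.
by rewrite lapM_dirichlet; congr (- _); apply: eq_bigr => x _; ring.
Qed.

Lemma win_single M f x0 : x0 \in win M ->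
  (forall x, x \in win M -> x != x0 -> f x = 0) -> \sum_(x <- win M) f x = f x0.
Proof.
move=> x0M f0; rewrite (bigD1_seq x0) ?win_uniq//= big_seq_cond big1 ?addr0//.
by move=> x /andP[]; exact: f0.
Qed.

(** Once the symmetric cut operator has been moved onto [g], the two operators differ only on the
    edges from M - 1 to M and from - M - 1 to - M. *)
Lemma lap_defect M u g : (0 < M)%N ->
  \sum_(x <- win M) u x * lap cond g x - \sum_(x <- win M) lap (condM M) u x * g x =
  u (M%:Z - 1) * cond (M%:Z - 1) * (g M%:Z - g (M%:Z - 1)) -
  u (- M%:Z) * cond (- M%:Z - 1) * (g (- M%:Z) - g (- M%:Z - 1)).
Proof.
move=> M0; rewrite lapM_sym -sumrB.
have -> : \sum_(x <- win M) (u x * lap cond g x - u x * lap (condM M) g x) =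
  \sum_(x <- win M) u x * (cond x - condM M x) * (g (x + 1) - g x) -
  \sum_(x <- win M) u x * (cond (x - 1) - condM M (x - 1)) * (g x - g (x - 1)).
  by rewrite -sumrB; apply: eq_bigr => x _; rewrite /lap; ring.
rewrite (win_single (x0 := M%:Z - 1)); last 2 first.
- by rewrite mem_win; lia.
- move=> x; rewrite mem_win => xM xn.
  by rewrite /condM !mem_win ifT ?subrr ?mulr0 ?mul0r//; lia.
rewrite (win_single (x0 := - M%:Z)); last 2 first.
- by rewrite mem_win; lia.
- move=> x; rewrite mem_win => xM xn.
  by rewrite /condM !mem_win ifT ?subrr ?mulr0 ?mul0r//; lia.
rewrite !condM_edge; try lia.
by rewrite (_ : M%:Z - 1 + 1 = M%:Z); [ring|lia].
Qed.

End Window.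

(** * Polynomial weights and a Lyapunov bound uniform in the window *)

Section Weights.
Context {R : realType}.
Implicit Types (u v f g b : int -> R) (M p : nat) (x : int).

Definition wt p x : R := (1 + x%:~R ^+ 2) ^+ p.

Lemma wt1 x : 1 <= 1 + x%:~R ^+ 2 :> R.
Proof. by have := sqr_ge0 (x%:~R : R); lra. Qed.

Lemma wt_ge1 p x : 1 <= wt p x.
Proof. by rewrite exprn_ege1// wt1. Qed.

Lemma wt_gt0 p x : 0 < wt p x.
Proof. exact: lt_le_trans (wt_ge1 p x). Qed.

Lemma wtS p x : wt p.+1 x = (1 + x%:~R ^+ 2) * wt p x.
Proof. by rewrite /wt exprS. Qed.

Lemma wtD p p' x : wt (p + p') x = wt p x * wt p' x.
Proof. by rewrite /wt exprD. Qed.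

Lemma wt_le p p' x : (p <= p')%N -> wt p x <= wt p' x.
Proof. by move=> pp; rewrite /wt ler_weXn2l// wt1. Qed.

Lemma wt_succ p x : wt p (x + 1) <= 3 ^+ p * wt p x.
Proof.
rewrite /wt -exprMn lerXn2r ?nnegrE ?mulr_ge0 ?(le_trans ler01 (wt1 _))//.
by rewrite rmorphD /=; move: (x%:~R : R) => y; have := sqr_ge0 (y - 1); have := sqr_ge0 y; nra.
Qed.

Lemma wt_pred p x : wt p (x - 1) <= 3 ^+ p * wt p x.
Proof.
rewrite /wt -exprMn lerXn2r ?nnegrE ?mulr_ge0 ?(le_trans ler01 (wt1 _))//.
by rewrite rmorphB /=; move: (x%:~R : R) => y; have := sqr_ge0 (y + 1); have := sqr_ge0 y; nra.
Qed.

Definition wnorm M p u : R := \sum_(x <- win M) wt p x * `|u x|.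

Lemma wnorm_ge0 M p u : 0 <= wnorm M p u.
Proof. by apply: sumr_ge0 => x _; rewrite mulr_ge0// ltW// wt_gt0. Qed.

Lemma wnorm_le M p p' u : (p <= p')%N -> wnorm M p u <= wnorm M p' u.
Proof. by move=> pp; apply: ler_sum => x _; rewrite ler_wpM2r// wt_le. Qed.

Lemma wnormD M p u v : wnorm M p (fun x => u x + v x) <= wnorm M p u + wnorm M p v.
Proof.
rewrite /wnorm -big_split/=; apply: ler_sum => x _.
by rewrite -mulrDr ler_wpM2l ?ler_normD// ltW// wt_gt0.
Qed.

Lemma wnorm_supp M M' p u : (M <= M')%N -> supp M u -> wnorm M' p u = wnorm M p u.
Proof.
by move=> MM su; apply: win_supp => // x xM; rewrite su// normr0 mulr0.
Qed.

Lemma wnorm_pt M p u x : x \in win M -> `|u x| <= wnorm M p u / wt p x.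
Proof.
move=> xM; rewrite ler_pdivlMr ?wt_gt0// mulrC /wnorm (bigD1_seq x) ?win_uniq//=.
by rewrite lerDl; apply: sumr_ge0 => y _; rewrite mulr_ge0// ltW// wt_gt0.
Qed.

Lemma wnorm_sum M p u g K : (forall x, x \in win M -> `|g x| <= K * wt p x) ->
  `|\sum_(x <- win M) u x * g x| <= K * wnorm M p u.
Proof.
move=> gK; rewrite (le_trans (ler_norm_sum _ _ _))// /wnorm mulr_sumr.
rewrite big_seq [leRHS]big_seq; apply: ler_sum => x xM.
rewrite normrM (_ : K * _ = (K * wt p x) * `|u x|); last ring.
by rewrite mulrC ler_wpM2r// gK.
Qed.

(** The gradient form, that is, the remainder in the product rule for [lap]. *)
Let G (b : int -> R) f g x := b x * (f (x + 1) - f x) * (g (x + 1) - g x) +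
  b (x - 1) * (f x - f (x - 1)) * (g x - g (x - 1)).

Let lap_mul b f g x : lap b (fun y => f y * g y) x =
  f x * lap b g x + g x * lap b f x + G b f g x.
Proof. by rewrite /lap /G; ring. Qed.

Let q x : R := 1 + x%:~R ^+ 2.

Let qD x : q (x + 1) - q x = 2 * x%:~R + 1.
Proof. by rewrite /q rmorphD/=; ring. Qed.

(** Degrees in x: 2 for the conductance, 1 for the increment of [q], 2p - 1 for that of [wt p]; they
    add up to the degree 2p + 2 of the right side. *)
Lemma grad_wt p : exists2 D : R, 0 <= D & forall x,
  cond x * `|q (x + 1) - q x| * `|wt p (x + 1) - wt p x| <= D * wt p.+1 x.
Proof.
elim: p => [|p [D D0 HD]].
  by exists 0 => // x; rewrite /wt !expr0 subrr normr0 mulr0 mul0r.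
exists (8 * 3 ^+ p + D) => [|x]; first by rewrite addr_ge0// mulr_ge0// exprn_ge0.
have q0 : 0 < q x by have := wt_gt0 1 x; rewrite /wt expr1.
rewrite (_ : wt p.+1 (x + 1) - wt p.+1 x = wt p (x + 1) * (q (x + 1) - q x)
  + q x * (wt p (x + 1) - wt p x)); last by rewrite !wtS /q; ring.
apply: (le_trans (y := cond x * `|q (x + 1) - q x| *
  (wt p (x + 1) * `|q (x + 1) - q x| + q x * `|wt p (x + 1) - wt p x|))).
  rewrite ler_wpM2l ?mulr_ge0 ?(ltW (cond_gt0 _))// (le_trans (ler_normD _ _))//.
  by rewrite !normrM (gtr0_norm (wt_gt0 _ _)) (gtr0_norm q0).
rewrite mulrDr (wtS p.+1) [leRHS]mulrDl; apply: lerD; last first.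
  rewrite [leRHS](_ : _ = q x * (D * wt p.+1 x)); last by rewrite /q; ring.
  rewrite [leLHS](_ : _ = q x * (cond x * `|q (x + 1) - q x| * `|wt p (x + 1) - wt p x|)); last ring.
  by rewrite ler_wpM2l ?(ltW q0)//; exact: HD.
have -> : cond x * `|q (x + 1) - q x| * (wt p (x + 1) * `|q (x + 1) - q x|) =
  wt p (x + 1) * (cond x * (q (x + 1) - q x) ^+ 2).
  by rewrite -(real_normK (num_real (q (x + 1) - q x))); ring.
have h1 := wt_succ p x; have wp := wt_gt0 p x; have wp1 := wt_gt0 p (x + 1).
have h2 : cond x * (q (x + 1) - q x) ^+ 2 <= 8 * (q x * q x).
  rewrite qD /cond /q; move: (x%:~R : R) => y.
  have -> : 8 * ((1 + y ^+ 2) * (1 + y ^+ 2)) = (y ^+ 2 + 1) * (8 * (1 + y ^+ 2)) by ring.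
  rewrite ler_wpM2l//; first by have := sqr_ge0 y; lra.
  by have := sqr_ge0 (2 * y - 1); nra.
rewrite !wtS -/(q x).
have -> : 8 * 3 ^+ p * (q x * (q x * wt p x)) = (3 ^+ p * wt p x) * (8 * (q x * q x)) by ring.
apply: ler_pM => //; first exact: ltW.
by rewrite mulr_ge0 ?sqr_ge0// ltW// cond_gt0.
Qed.

(** The estimate is one-sided on purpose: inside the window the cubic terms cancel, while at an
    endpoint only the inward edge is left, which makes the value very negative. *)
Let lapM_q M x : (0 < M)%N -> lap (condM M) q x <= 12 * q x.
Proof.
move=> M0; rewrite /lap qD.
have -> : q x - q (x - 1) = 2 * x%:~R - 1 by rewrite /q rmorphB/=; ring.
have c1 := condM_le_cond M (x - 1) (R := R); have c10 := condM_ge0 M (x - 1) (R := R).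
have c2 := condM_le_cond M x (R := R); have c20 := condM_ge0 M x (R := R).
have eqc y : (y \in win M) && (y + 1 \in win M) -> condM M y = cond y :> R.
  by rewrite /condM => ->.
have cE : cond (x - 1) = (x%:~R - 1) ^+ 2 + 1 :> R by rewrite /cond rmorphB.
have [x1|x0|x0] := ltgtP x 0.
- have x1' : x%:~R <= -1 :> R by rewrite -(mulrNz 1 1) ler_int; lia.
  have [ex|nx] := boolP ((x - 1 \in win M) && (x - 1 + 1 \in win M)).
    rewrite !eqc//; last by move: ex; rewrite !mem_win; lia.
    rewrite cE /cond /q; move: (x%:~R : R) x1' => y y1; nra.
  have -> : condM M (x - 1) = 0 :> R by rewrite /condM (negbTE nx).
  have h : 0 <= - (2 * x%:~R + 1 : R) by lra.
  by have := mulr_ge0 c20 h; rewrite /q; move: (x%:~R : R) => y; have := sqr_ge0 y; nra.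
- have x1' : 1 <= x%:~R :> R by rewrite (ler_int R 1); lia.
  have [ex|nx] := boolP ((x \in win M) && (x + 1 \in win M)).
    rewrite !eqc//; last by move: ex; rewrite !mem_win; lia.
    rewrite cE /cond /q; move: (x%:~R : R) x1' => y y1; nra.
  have -> : condM M x = 0 :> R by rewrite /condM (negbTE nx).
  have h : 0 <= (2 * x%:~R - 1 : R) by lra.
  by have := mulr_ge0 c10 h; rewrite /q; move: (x%:~R : R) => y; have := sqr_ge0 y; nra.
- move: c1 c2 c10 c20; rewrite cE /cond /q x0 /=.
  have -> : (0%:~R : R) = 0 by [].
  nra.
Qed.

(** Induction by the product rule for wt p.+1 = q * wt p, with [grad_wt] for the gradient term;
    since [condM] is at most [cond], the constant does not depend on M. *)
Lemma lapM_wt p : exists2 C : R, 0 <= C & forall M x, (0 < M)%N ->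
  lap (condM M) (wt p) x <= C * wt p x.
Proof.
elim: p => [|p [C C0 HC]].
  by exists 0 => // M x _; rewrite /lap /wt !expr0 !subrr !mulr0 subrr mul0r.
have [D D0 HD] := grad_wt p.
exists (C + 12 + D + D * 3 ^+ p.+1) => [|M x M0].
  by have := mulr_ge0 D0 (exprn_ge0 p.+1 (ler0n R 3)); lra.
rewrite (_ : wt p.+1 = (fun y => q y * wt p y)); last by apply/funext => y; rewrite wtS.
rewrite lap_mul; have q0 : 0 < q x by have := wt_gt0 1 x; rewrite /wt expr1.
have wp := wt_gt0 p x.
have h1 : q x * lap (condM M) (wt p) x <= C * (q x * wt p x).
  by rewrite mulrCA ler_wpM2l ?(ltW q0)//; exact: HC.
have h2 : wt p x * lap (condM M) q x <= 12 * (q x * wt p x).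
  rewrite [leRHS](_ : _ = wt p x * (12 * q x)); last ring.
  by rewrite ler_wpM2l ?(ltW wp)// lapM_q.
have hG y : condM M y * (q (y + 1) - q y) * (wt p (y + 1) - wt p y) <= D * wt p.+1 y.
  apply: le_trans (HD y); rewrite (le_trans (ler_norm _))// !normrM.
  by rewrite !ler_wpM2r// ger0_norm ?condM_ge0// condM_le_cond.
have h3 : G (condM M) q (wt p) x <= D * (q x * wt p x) + D * 3 ^+ p.+1 * (q x * wt p x).
  apply: lerD; first by have := hG x; rewrite wtS.
  have := hG (x - 1); rewrite (_ : x - 1 + 1 = x); last lia.
  move=> /le_trans; apply; rewrite -mulrA ler_wpM2l//.
  by have := wt_pred p.+1 x; rewrite [in leRHS]wtS.
lra.
Qed.

End Weights.

(** * Stability of the explicit Euler scheme in weighted l1 norms *)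

Section Euler.
Context {R : realType}.
Implicit Types (u v f g b : int -> R) (M p : nat) (x : int) (h : R).

Definition estep h M u x := u x + h * lap (condM M) u x.

Definition eul h M k u := iter k (estep h M) u.

(** Stability needs only one power of M^2 + 1, the size of the conductances. Two more make the
    second-order error h Q(L u, L u) in the energy identity of order 1 / (M^2 + 1). *)
Definition step_ok M h := [/\ (0 < M)%N, 0 <= h & h * (M%:R ^+ 2 + 1) ^+ 3 <= 1].

Lemma step_ok_stable M h : step_ok M h -> h * (2 * (M%:R ^+ 2 + 1)) <= 1.
Proof.
move=> [M0 h0 hM]; apply: le_trans hM; rewrite ler_wpM2l//.
have : 1 <= M%:R :> R by rewrite ler1n.
by move: (M%:R : R) => y y1; rewrite !exprS expr0; nra.
Qed.

Lemma supp_estep h M u : supp M u -> supp M (estep h M u).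
Proof. by move=> su x xM; rewrite /estep su// supp_lapM// mulr0 addr0. Qed.

Lemma supp_eul h M k u : supp M u -> supp M (eul h M k u).
Proof. by move=> su; elim: k => //= k; exact: supp_estep. Qed.

Let lap_abs M u x : `|lap (condM M) u x| <=
  lap (condM M) (fun x => `|u x|) x + 2 * (condM M x + condM M (x - 1)) * `|u x|.
Proof.
have c0 := condM_ge0 M x (R := R); have c1 := condM_ge0 M (x - 1) (R := R).
have -> : lap (condM M) u x =
  condM M x * u (x + 1) + condM M (x - 1) * u (x - 1)
  - (condM M x + condM M (x - 1)) * u x by rewrite /lap; ring.
rewrite (le_trans (ler_normB _ _))// (le_trans (lerD (ler_normD _ _) (lexx _)))//.
by rewrite !normrM (ger0_norm c0) (ger0_norm c1) (ger0_norm (addr_ge0 c0 c1)) /lap /=; lra.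
Qed.

(** By the step condition all coefficients of an Euler step are nonnegative, so absolute values can
    be taken inside. *)
Let estep_abs h M u x : step_ok M h ->
  `|estep h M u x| <= `|u x| + h * lap (condM M) (fun x => `|u x|) x.
Proof.
move=> ok; have hM := step_ok_stable ok; have [_ h0 _] := ok.
have c0 := condM_ge0 M x (R := R); have c1 := condM_ge0 M (x - 1) (R := R).
have c2 := condM_le M x (R := R); have c3 := condM_le M (x - 1) (R := R).
have k0 : 0 <= 1 - h * (condM M x + condM M (x - 1)).
  by rewrite subr_ge0 (le_trans _ hM)// ler_wpM2l//; lra.
have -> : estep h M u x = (1 - h * (condM M x + condM M (x - 1))) * u x
  + h * condM M x * u (x + 1) + h * condM M (x - 1) * u (x - 1).
  by rewrite /estep /lap; ring.
rewrite (le_trans (ler_normD _ _))// (le_trans (lerD (ler_normD _ _) (lexx _)))//.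
rewrite !normrM (ger0_norm k0) (ger0_norm c0) (ger0_norm c1) (ger0_norm h0) /lap.
by rewrite /=; lra.
Qed.

(** Symmetry moves the cut generator from |u| onto the weight, where the one-sided bound [lapM_wt]
    is enough. *)
Lemma estep_wnorm p : exists2 C : R, 0 <= C & forall h M u, step_ok M h ->
  wnorm M p (estep h M u) <= (1 + h * C) * wnorm M p u.
Proof.
have [C C0 HC] := @lapM_wt R p; exists C => // h M u ok.
have [M0 h0 _] := ok.
apply: (le_trans (y := \sum_(x <- win M) wt p x *
    (`|u x| + h * lap (condM M) (fun x => `|u x|) x))).
  by apply: ler_sum => x _; rewrite ler_wpM2l ?estep_abs// ltW// wt_gt0.
have -> : \sum_(x <- win M) wt p x * (`|u x| + h * lap (condM M) (fun x => `|u x|) x) =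
  wnorm M p u + h * \sum_(x <- win M) lap (condM M) (fun x => `|u x|) x * wt p x.
  by rewrite mulr_sumr -big_split/=; apply: eq_bigr => x _; ring.
rewrite mulrDl mul1r lerD2l -mulrA ler_wpM2l// lapM_sym /wnorm mulr_sumr.
apply: ler_sum => x _; rewrite mulrA mulrC ler_wpM2r//; exact: HC.
Qed.

Lemma eul_wnorm p : exists2 C : R, 0 <= C & forall h M k u, step_ok M h ->
  wnorm M p (eul h M k u) <= expR (C * (h * k%:R)) * wnorm M p u.
Proof.
have [C C0 HC] := estep_wnorm p; exists C => // h M k u ok.
have [_ h0 _] := ok.
elim: k => [|k IH]; first by rewrite mulr0 mulr0 expR0 mul1r.
rewrite /= (le_trans (HC _ _ _ ok))//.
rewrite -natr1 mulrDr mulr1 mulrDr expRD mulrAC mulrC.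
apply: ler_pM => //; first exact: wnorm_ge0.
- by rewrite addr_ge0// mulr_ge0.
- by rewrite mulrC expR_ge1Dx.
Qed.

(** A crude operator norm: the sum of [lap] applied to |u| vanishes by conservation of mass, so only
    the diagonal excess remains. *)
Lemma lapM_l1 M u : wnorm M 0 (lap (condM M) u) <= 4 * (M%:R ^+ 2 + 1) * wnorm M 0 u.
Proof.
have h0 : \sum_(x <- win M) lap (condM M) (fun x => `|u x|) x = 0.
  have := lapM_dirichlet M (fun x => `|u x|) (fun=> 1).
  under eq_bigr do rewrite mulr1.
  by move=> ->; rewrite big1 ?oppr0// => x _; rewrite subrr mulr0.
rewrite /wnorm mulr_sumr.
under eq_bigr do rewrite /wt expr0 mul1r.
under [leRHS]eq_bigr do rewrite /wt expr0 mul1r.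
rewrite (le_trans (ler_sum _ (fun x _ => lap_abs M u x)))// big_split/= h0 add0r.
apply: ler_sum => x _; rewrite ler_wpM2r//.
by have := condM_le M x (R := R); have := condM_le M (x - 1) (R := R); lra.
Qed.

End Euler.

(** * Resistances and the Green quadratic form *)

Section Potential.
Context {R : realType}.
Implicit Types (u v f g b : int -> R) (M p : nat) (x : int) (h : R).

(* The resistance coordinate: an antiderivative of [1 / cond]. *)
Definition res (x : int) : R := match x with
  | Posz n => 4 + \sum_(k < n) (cond (Posz k))^-1
  | Negz n => 4 - \sum_(k < n.+1) (cond (Negz k))^-1 end.

Lemma res_succ x : cond x * (res (x + 1) - res x) = 1.
Proof.
have c0 y := lt0r_neq0 (cond_gt0 y (R := R)).
case: x => [n|[|n]].
- rewrite (_ : Posz n + 1 = Posz n.+1); last lia.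
  by rewrite /res big_ord_recr/=; set S := \sum_(_ < _) _; field; exact: c0.
- rewrite (_ : Negz 0 + 1 = Posz 0); last lia.
  by rewrite /res big_ord0 big_ord_recr/= big_ord0; field; exact: c0.
- rewrite (_ : Negz n.+1 + 1 = Negz n); last lia.
  rewrite /res [in X in _ - X]big_ord_recr/=.
  by set S := \sum_(_ < _) _; field; exact: c0.
Qed.

Lemma res_mono x y : x <= y -> res x <= res y.
Proof.
move=> xy; have -> : y = x + `|y - x|%N by lia.
elim: `|y - x|%N => [|n IH]; first by rewrite addr0.
rewrite (le_trans IH)// (_ : x + n.+1 = x + n + 1); last lia.
rewrite -subr_ge0 -(pmulr_rge0 _ (cond_gt0 (x + n))) res_succ; lra.
Qed.

(** The induction proves the sharper bound 4 - 4 / (n + 1), because 1 / (n^2 + 1) <= 4 / (n + 1) - 4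
    / (n + 2). *)
Let res_bound (n : nat) (c : nat -> R) : (forall k, k%:R ^+ 2 + 1 <= c k) ->
  0 <= \sum_(k < n) (c k)^-1 <= 4.
Proof.
move=> hc; have c0 k : 0 < c k by apply: lt_le_trans (hc k); have := sqr_ge0 (k%:R : R); lra.
apply/andP; split; first by apply: sumr_ge0 => k _; rewrite invr_ge0 ltW.
apply: (@le_trans _ _ (4 - 4 / n.+1%:R)); last first.
  by rewrite gerBl// divr_ge0.
elim: n => [|n IH]; first by rewrite big_ord0 divr1 subrr.
rewrite big_ord_recr/= (le_trans (lerD IH (lexx _)))//.
have n1 : 0 < n.+1%:R :> R by rewrite ltr0n.
have n2 : 0 < n.+2%:R :> R by rewrite ltr0n.
have : (c n)^-1 <= (n%:R ^+ 2 + 1)^-1.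
  by rewrite lef_pV2 ?posrE//; have := sqr_ge0 (n%:R : R); lra.
suff : (n%:R ^+ 2 + 1)^-1 <= 4 / n.+1%:R - 4 / n.+2%:R :> R.
  by move: ((c n)^-1) ((n%:R ^+ 2 + 1)^-1) (4 / n.+1%:R) (4 / n.+2%:R) => *; lra.
have -> : 4 / n.+1%:R - 4 / n.+2%:R = 4 / (n.+1%:R * n.+2%:R) :> R.
  rewrite -[n.+2%:R]natr1; move: n1; move: (n.+1%:R : R) => a a0.
  by field; rewrite !gt_eqF//; lra.
rewrite ler_pdivlMr ?mulr_gt0// mulrC ler_pdivrMr; last by have := sqr_ge0 (n%:R : R); lra.
rewrite -[n.+2%:R]natr1 -natr1; move: (n%:R : R) => y; have := sqr_ge0 (2 * y - 1); nra.
Qed.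

(** The offset 4 in [res] equals the bound on each half-line sum. It makes the resistances
    nonnegative, so that they can serve as times of a Brownian motion. *)
Lemma res_ge0 x : 0 <= res x <= 8.
Proof.
case: x => n; rewrite /res.
  by have /= := @res_bound n (fun k => cond (Posz k)) (fun k => lexx _); lra.
have /= := @res_bound n.+1 (fun k => cond (Negz k)); set S := \sum_(_ < _) _.
move=> H; have : 0 <= S <= 4; last by lra.
apply: H => k; rewrite /cond lerD2r NegzE mulrNz sqrrN.
by rewrite lerXn2r ?nnegrE// ler_nat.
Qed.

(** The Green potential of [v]. As [res] is increasing, the kernel is the minimum of [res x] and
    [res y], the covariance of gamma; hence [Qf M u u] is the variance of <u, gamma>. *)
Definition pot M v x : R := \sum_(y <- win M) res (Order.min x y) * v y.

Definition Qf M u v : R := \sum_(x <- win M) u x * pot M v x.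

(** The flux through an edge is the mass of [v] to its right: zero at the right end of the window,
    the total mass at the left end. *)
Lemma pot_grad M v x : cond x * (pot M v (x + 1) - pot M v x) =
  \sum_(y <- win M) (if x < y then v y else 0).
Proof.
rewrite /pot -sumrB mulr_sumr; apply: eq_bigr => y _.
rewrite -mulrBl mulrA; case: ifP => xy.
  by rewrite !min_l; [rewrite res_succ mul1r|lia|lia].
by rewrite !min_r; [rewrite subrr mulr0 mul0r|lia|lia].
Qed.

Lemma lap_pot M v x : supp M v -> lap cond (pot M v) x = - v x.
Proof.
move=> sv; have E := pot_grad M v (x - 1); rewrite subrK in E.
rewrite /lap pot_grad E -sumrB.
have [xM|xM] := boolP (x \in win M).
  rewrite (win_single (x0 := x))//.
    by rewrite ltxx ltrBlDr ltrDl ltr01 sub0r.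
  move=> y yM yx; have [xy|xy] := ltP x y.
    by rewrite ifT ?subrr//; lia.
  by rewrite ifF ?subrr//; lia.
rewrite sv// oppr0 big_seq big1// => y yM.
have yx : y != x by apply: contraNneq xM => <-.
have [xy|xy] := ltP x y.
  by rewrite ifT ?subrr//; lia.
by rewrite ifF ?subrr//; lia.
Qed.

Lemma Qf_sym M u v : Qf M u v = Qf M v u.
Proof.
rewrite /Qf /pot; under eq_bigr do rewrite mulr_sumr.
rewrite exchange_big/=; apply: eq_bigr => x _; rewrite mulr_sumr.
by apply: eq_bigr => y _; rewrite minC; ring.
Qed.

Lemma QfL M u v w (a e : R) :
  Qf M (fun x => a * u x + e * v x) w = a * Qf M u w + e * Qf M v w.
Proof. by rewrite /Qf !mulr_sumr -big_split/=; apply: eq_bigr => y _; ring. Qed.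

Lemma pot_abs M v x : `|pot M v x| <= 8 * wnorm M 0 v.
Proof.
rewrite (le_trans (ler_norm_sum _ _ _))// /wnorm mulr_sumr.
apply: ler_sum => y _; rewrite normrM /wt expr0 mul1r ler_wpM2r//.
by have /andP[r0 r8] := res_ge0 (Order.min x y); rewrite ger0_norm.
Qed.

Lemma Qf_abs M u v : `|Qf M u v| <= 8 * wnorm M 0 v * wnorm M 0 u.
Proof.
by apply: wnorm_sum => x _; rewrite /wt expr0 mulr1 pot_abs.
Qed.

(** [lap_defect] applied to the potential of [v]. Its flux vanishes on the right, so the only
    correction sits at the left endpoint. *)
Lemma Qf_lap M u v : (0 < M)%N -> supp M u -> supp M v ->
  Qf M (lap (condM M) u) v =
  - (\sum_(x <- win M) u x * v x) + u (- M%:Z) * \sum_(x <- win M) v x.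
Proof.
move=> M0 su sv; have := lap_defect u (pot M v) M0.
have E1 := pot_grad M v (M%:Z - 1); rewrite subrK in E1.
have E2 := pot_grad M v (- M%:Z - 1); rewrite subrK in E2.
rewrite -!mulrA E1 E2.
rewrite [X in _ = _ * X - _]big_seq [X in _ = _ * X - _]big1 ?mulr0 ?sub0r; last first.
  by move=> x; rewrite mem_win => xM; rewrite ifF//; lia.
rewrite [X in _ = - (_ * X)](_ : _ = \sum_(x <- win M) v x); last first.
  by rewrite big_seq [RHS]big_seq; apply: eq_bigr => x; rewrite mem_win => xM; rewrite ifT//; lia.
under eq_bigr do rewrite lap_pot// mulrN.
rewrite sumrN /Qf; lra.
Qed.

End Potential.

(** * Discrete energy identity and symmetry of the scheme in the Green form *)

Section EulerEnergy.
Context {R : realType}.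
Implicit Types (u v f g b : int -> R) (M p : nat) (x : int) (h : R).

Let defect_bound M u v K K' : (0 < M)%N -> wnorm M 1 u <= K -> wnorm M 1 v <= K' ->
  `|u (- M%:Z) * \sum_(x <- win M) v x| <= K * K' / (M%:R ^+ 2 + 1).
Proof.
move=> M0 uK vK; rewrite normrM mulrAC.
have K0 : 0 <= K by apply: le_trans (wnorm_ge0 _ _ _) uK.
apply: ler_pM => //.
  have := @wnorm_pt R M 1 u (- M%:Z); rewrite mem_win => /(_ _) h.
  apply: le_trans (h _) _; first lia.
  rewrite /wt expr1 mulrNz sqrrN addrC ler_wpM2r//.
apply: le_trans vK; rewrite (le_trans (ler_norm_sum _ _ _))//.
by apply: ler_sum => x _; rewrite ler_peMl// wt_ge1.
Qed.

(** Discrete form of (1/2) d/dt Q(u, u) = - |u|^2. In 65 = 1 + 64 the first term is the boundary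
    correction of [Qf_lap], the second the quadratic term in h, controlled by the cube in
    [step_ok]. *)
Lemma estep_energy h M u K : step_ok M h -> supp M u -> wnorm M 1 u <= K ->
  `|2^-1 * Qf M (estep h M u) (estep h M u) + h * (\sum_(x <- win M) u x ^+ 2)
    - 2^-1 * Qf M u u| <= h * (65 * K ^+ 2 / (M%:R ^+ 2 + 1)).
Proof.
move=> ok su uK; have [M0 h0 hM] := ok.
set A := lap (condM M) u.
have -> : estep h M u = (fun x => 1 * u x + h * A x).
  by apply/funext => x; rewrite /estep mul1r.
rewrite QfL (Qf_sym M u) (Qf_sym M A) !QfL (Qf_sym M u A) Qf_lap//.
have -> : \sum_(x <- win M) u x * u x = \sum_(x <- win M) u x ^+ 2.
  by apply: eq_bigr => x _; rewrite expr2.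
set S := \sum_(x <- win M) u x ^+ 2; set e := _ * \sum_(x <- win M) u x.
have eb : `|e| <= K * K / (M%:R ^+ 2 + 1) by exact: defect_bound.
have Qb : `|Qf M A A| <= 8 * (4 * (M%:R ^+ 2 + 1) * K) ^+ 2.
  have Ab : wnorm M 0 A <= 4 * (M%:R ^+ 2 + 1) * K.
    rewrite (le_trans (lapM_l1 _ _))// ler_wpM2l//.
    by rewrite (le_trans _ uK)// wnorm_le.
  rewrite (le_trans (Qf_abs _ _ _))// -mulrA ler_wpM2l// expr2.
  by apply: ler_pM; rewrite ?wnorm_ge0.
rewrite [X in `|X|](_ : _ = h * (e + h / 2 * Qf M A A)); last by field.
rewrite normrM (ger0_norm h0) ler_wpM2l// (le_trans (ler_normD _ _))//.
rewrite [X in _ + X]normrM (@ger0_norm _ (h / 2)); last by rewrite divr_ge0.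
have y1 : 1 <= M%:R ^+ 2 + 1 :> R by have := sqr_ge0 (M%:R : R); lra.
move: y1 eb Qb hM; set y : R := M%:R ^+ 2 + 1 => y1 eb Qb hM.
have y0 : 0 < y by lra.
have hQ : h / 2 * `|Qf M A A| <= 64 * K ^+ 2 / y.
  apply: (le_trans (ler_wpM2l _ Qb)); first by rewrite divr_ge0.
  rewrite ler_pdivlMr//.
  have -> : h / 2 * (8 * (4 * y * K) ^+ 2) * y = 64 * K ^+ 2 * (h * y ^+ 3) by field.
  by rewrite ler_piMr// mulr_ge0 ?sqr_ge0.
apply: (le_trans (lerD eb hQ)).
by rewrite -expr2 -mulrDl; rewrite ler_wpM2r ?invr_ge0 ?(ltW y0)//; lra.
Qed.

Lemma eul_energy h M u K n : step_ok M h -> supp M u ->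
  (forall k, (k <= n)%N -> wnorm M 1 (eul h M k u) <= K) ->
  `|2^-1 * Qf M (eul h M n u) (eul h M n u)
    + h * (\sum_(k < n) \sum_(x <- win M) eul h M k u x ^+ 2)
    - 2^-1 * Qf M u u| <= h * n%:R * (65 * K ^+ 2 / (M%:R ^+ 2 + 1)).
Proof.
move=> ok su; elim: n => [|n IH] uK.
  by rewrite big_ord0 !mulr0 addr0 subrr normr0 mul0r.
have := IH (fun k kn => uK k (leqW kn)).
have := estep_energy ok (supp_eul h n su) (uK n (leqnSn n)).
rewrite big_ord_recr/= -[n.+1%:R]natr1.
set X := Qf M (estep _ _ _) _; set Y := Qf M (eul _ _ _ _) _; set Z := Qf M u u.
set S := \sum_(k < n) _; set s := \sum_(x <- win M) _; set E := 65 * _ / _.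
move=> h1 h2.
have -> : 2^-1 * X + h * (S + s) - 2^-1 * Z =
  (2^-1 * X + h * s - 2^-1 * Y) + (2^-1 * Y + h * S - 2^-1 * Z) by ring.
rewrite (le_trans (ler_normD _ _))// (le_trans (lerD h1 h2))//; lra.
Qed.

Lemma eul_iterSr h M k u : eul h M k.+1 u = eul h M k (estep h M u).
Proof. by rewrite /eul iterSr. Qed.

(** Up to boundary terms, Q(L u, w) = - <u, w> = Q(u, L w), so Euler steps can be moved from [u] to
    [v] one by one; each move costs two boundary terms. *)
Lemma eul_symmetric h M u v K K' n : step_ok M h -> supp M u -> supp M v ->
  (forall k, (k <= n)%N -> wnorm M 1 (eul h M k u) <= K) ->
  (forall k, (k <= n)%N -> wnorm M 1 (eul h M k v) <= K') ->
  `|Qf M (eul h M n u) v - Qf M u (eul h M n v)| <=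
  h * n%:R * (2 * K * K' / (M%:R ^+ 2 + 1)).
Proof.
move=> ok; have [M0 h0 hM] := ok.
elim: n u => [|n IH] u su sv uK vK.
  by rewrite subrr normr0 mulr0 mul0r.
rewrite eul_iterSr; set w := eul h M n v.
have sw : supp M w by exact: supp_eul.
have h1 : `|Qf M (eul h M n (estep h M u)) v - Qf M (estep h M u) w| <=
    h * n%:R * (2 * K * K' / (M%:R ^+ 2 + 1)).
  apply: IH => //; first exact: supp_estep.
    by move=> k kn; rewrite -eul_iterSr; exact: uK.
  by move=> k kn; apply: vK; exact: leqW.
have -> : Qf M u (eul h M n.+1 v) = Qf M u (estep h M w) by [].
have lin a b : Qf M (estep h M a) b = Qf M a b + h * Qf M (lap (condM M) a) b.
  rewrite (_ : estep h M a = (fun x => 1 * a x + h * lap (condM M) a x)).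
    by rewrite QfL mul1r.
  by apply/funext => x; rewrite /estep mul1r.
have h2 : `|Qf M (estep h M u) w - Qf M u (estep h M w)| <=
    h * (2 * K * K' / (M%:R ^+ 2 + 1)).
  rewrite (Qf_sym M u) !lin (Qf_sym M w u) !Qf_lap//.
  have e1 := defect_bound M0 (uK 0%N isT) (vK n (leqnSn n)).
  have e2 := defect_bound M0 (vK n (leqnSn n)) (uK 0%N isT).
  move: e1 e2; rewrite -/w /= (mulrC K') -!mulrA.
  set E := K * _; set a := u _ * _; set b := w _ * _ => e1 e2.
  have -> : \sum_(x <- win M) w x * u x = \sum_(x <- win M) u x * w x.
    by apply: eq_bigr => x _; rewrite mulrC.
  rewrite [X in `|X|](_ : _ = h * (a - b)); last ring.
  rewrite normrM (ger0_norm h0) ler_wpM2l// (le_trans (ler_normB _ _))//; lra.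
rewrite -[n.+1%:R]natr1.
have -> : Qf M (eul h M n (estep h M u)) v - Qf M u (estep h M w) =
  (Qf M (eul h M n (estep h M u)) v - Qf M (estep h M u) w) +
  (Qf M (estep h M u) w - Qf M u (estep h M w)) by ring.
rewrite (le_trans (ler_normD _ _))// (le_trans (lerD h1 h2))//; lra.
Qed.

End EulerEnergy.

(** * Tempered sequences *)

Section Tempered.
Context {R : realType}.
Implicit Types (u v f g : int -> R) (M N p : nat) (x : int).

Let sum_win M (a : int -> R) :
  (\sum_(x \in [set` win M]) (a x)%:E)%E = (\sum_(x <- win M) a x)%:E.
Proof. by rewrite -fsbig_seq ?win_uniq// sumEFin. Qed.

Lemma esum_win_le (a : int -> R) (C : R) : (forall x, 0 <= a x) ->
  (forall M, \sum_(x <- win M) a x <= C) ->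
  (\esum_(x in [set: int]) (a x)%:E <= C%:E)%E.
Proof.
move=> a0 aC; apply: ge_ereal_sup => _ [X [fX _] <-].
have [s Xs] := (finite_seqP X).1 fX.
have [M sM] : exists M, forall x, x \in s -> x \in win M.
  elim: s {Xs} => [|y s [M IH]]; first by exists 0%N.
  exists (maxn M (`|y|.+1)) => x; rewrite inE => /predU1P[->|/IH].
    by rewrite mem_win; lia.
  by rewrite !mem_win; lia.
apply: (@le_trans _ _ (\sum_(x \in [set` win M]) (a x)%:E)%E).
  apply: lee_fsum_nneg_subset => //; first exact/finite_seqP/ex_intro.
    by move=> x; rewrite !inE Xs => /sM.
  by move=> x _; rewrite lee_fin.
by rewrite sum_win lee_fin.
Qed.

Lemma win_le_esum (a : int -> R) (C : R) M :
  (\esum_(x in [set: int]) (a x)%:E <= C%:E)%E -> \sum_(x <- win M) a x <= C.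
Proof.
move=> aC; rewrite -lee_fin -sum_win; apply: le_trans aC; apply: esum_ge.
by exists [set` win M] => //; split=> //; apply/finite_seqP; exists (win M).
Qed.

Lemma exprzN_wt N x : (1 + x%:~R ^+ 2 : R) ^ (- N%:Z) = (wt N x)^-1.
Proof. by rewrite -exprnN. Qed.

Lemma sqnorm_pt N f (C : R) x : (sqnormH (- N%:Z) f <= C%:E)%E ->
  f x ^+ 2 <= C * wt N x.
Proof.
move=> fC; have := win_le_esum (`|x|.+1) fC.
rewrite (bigD1_seq x) ?win_uniq//=; last by rewrite mem_win; lia.
rewrite exprzN_wt -ler_pdivrMr ?wt_gt0// => /(le_trans _); apply.
rewrite mulrC lerDl sumr_ge0// => y _.
by rewrite exprzN_wt mulr_ge0 ?sqr_ge0// invr_ge0 ltW// wt_gt0.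
Qed.

Lemma inH_fin k f : inH k f -> exists2 C : R, 0 <= C & (sqnormH k f <= C%:E)%E.
Proof.
rewrite /inH => fk.
have f0 : (0 <= sqnormH k f)%E.
  by apply: esum_ge0 => x _; rewrite lee_fin mulr_ge0 ?sqr_ge0// exprz_ge0// (le_trans ler01)// wt1.
exists (fine (sqnormH k f)); first exact: fine_ge0.
by rewrite fineK// ge0_fin_numE.
Qed.

(** The terms are the increments of [res], so the sum telescopes. *)
Lemma inv_wt_sum M : \sum_(x <- win M) (wt 1 x : R)^-1 <= 8.
Proof.
have -> : \sum_(x <- win M) (wt 1 x : R)^-1 = \sum_(x <- win M) (res (x + 1) - res x).
  apply: eq_bigr => x _.
  rewrite -(mulKf (lt0r_neq0 (cond_gt0 x)) (_ - _)) res_succ mulr1.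
  by rewrite /wt expr1 /cond addrC.
rewrite sumrB win_shift.
have := @res_ge0 R M%:Z; have := @res_ge0 R (- M%:Z); lra.
Qed.

(** Squaring [f] costs 2N powers of 1 + x^2, and one more makes the sum converge. *)
Lemma bound_inH N K f : (forall x, `|f x| <= K * wt N x) ->
  inH (- (N + N).+1%:Z) f.
Proof.
move=> fK; apply: (@le_lt_trans _ _ (K ^+ 2 * 8)%:E); last exact: ltry.
apply: esum_win_le => [x|M].
  by rewrite mulr_ge0 ?sqr_ge0// exprzN_wt invr_ge0 ltW// wt_gt0.
apply: (@le_trans _ _ (\sum_(x <- win M) K ^+ 2 * (wt 1 x)^-1)); last first.
  by rewrite -mulr_sumr ler_wpM2l ?sqr_ge0// inv_wt_sum.
apply: ler_sum => x _; rewrite exprzN_wt mulrC.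
have -> : wt (N + N).+1 x = wt N x * wt N x * wt 1 x :> R by rewrite -addn1 !wtD.
have w0 := wt_gt0 N x (R := R); have w1 := wt_gt0 1 x (R := R).
rewrite ler_pdivrMr ?mulr_gt0// -real_normK ?num_real//.
apply: (@le_trans _ _ ((K * wt N x) ^+ 2)).
  by rewrite lerXn2r ?nnegrE// (le_trans _ (fK x)).
rewrite [leRHS](_ : _ = (K * wt N x) ^+ 2)//.
by field; rewrite gt_eqF.
Qed.

Lemma bound_tempered N K f : (forall x, `|f x| <= K * wt N x) -> tempered f.
Proof. by move=> /bound_inH H; exists (N + N).+1. Qed.

Lemma supp_schwartz M u : supp M u -> schwartz u.
Proof.
move=> su N; apply: (@le_lt_trans _ _ (\sum_(x <- win M) wt N x * u x ^+ 2)%:E); last exact: ltry.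
have h0 x : 0 <= wt N x * u x ^+ 2 by rewrite mulr_ge0 ?sqr_ge0// ltW// wt_gt0.
apply: esum_win_le => // M'.
apply: (@le_trans _ _ (\sum_(x <- win (maxn M M')) wt N x * u x ^+ 2)).
  rewrite -(subnKC (leq_maxr M M')); elim: (_ - _)%N => [|k IH]; first by rewrite addn0.
  by rewrite (le_trans IH)// addnS win_recr lerDl addr_ge0.
by rewrite (win_supp (leq_maxl M M'))// => x xM; rewrite su// expr0n mulr0.
Qed.

Lemma schwartz_summable u f : schwartz u -> tempered f ->
  exists C : R, forall M, \sum_(x <- win M) `|u x * f x| <= C.
Proof.
move=> us [N /inH_fin[C C0 fC]]; have [D D0 uD] := inH_fin (us N).
exists (C + D) => M.
apply: (@le_trans _ _ (\sum_(x <- win M) (wt N x)^-1 * f x ^+ 2 + \sum_(x <- win M) wt N x * u x ^+ 2)).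
  rewrite -big_split/=; apply: ler_sum => x _; rewrite normrM.
  have w0 := wt_gt0 N x (R := R).
  rewrite -(real_normK (num_real (f x))) -(real_normK (num_real (u x))).
  set a := `|u x|; set b := `|f x|.
  have a0 : 0 <= a := normr_ge0 _; have b0 : 0 <= b := normr_ge0 _.
  rewrite -(ler_pM2l w0) mulrDr mulVKf ?gt_eqF//.
  by have := sqr_ge0 (wt N x * a - b); have := mulr_ge0 (ltW w0) (mulr_ge0 a0 b0); nra.
apply: lerD.
  have := win_le_esum M fC; apply: le_trans.
  by apply: ler_sum => x _; rewrite exprzN_wt.
exact: win_le_esum uD.
Qed.

Lemma pairing_cvg u f : schwartz u -> tempered f ->
  \sum_(x <- win M) u x * f x @[M --> \oo] --> pairing u f.
Proof.
move=> us ft; have [C HC] := schwartz_summable us ft.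
rewrite (_ : (fun M => _) = series (fun n : nat => u (Posz n) * f (Posz n) + u (Negz n) * f (Negz n))); last first.
  by apply/funext => M; rewrite (win_series M (fun x => u x * f x)).
apply: normed_cvg; apply: nondecreasing_is_cvgn.
  by apply: nondecreasing_series => n *; exact: normr_ge0.
exists C => _ [M _ <-]; rewrite (le_trans _ (HC M))// (win_series M (fun x => `|u x * f x|)).
by rewrite /series /=; apply: ler_sum => n _; exact: ler_normD.
Qed.

Lemma pairing_supp M u f : supp M u -> pairing u f = \sum_(x <- win M) u x * f x.
Proof.
move=> su; rewrite /pairing /sumZ; apply: cvg_lim => //.
rewrite -(_ : (fun M' => \sum_(x <- win M') u x * f x) = series _); last first.
  by apply/funext => M'; rewrite (win_series M' (fun x => u x * f x)).
apply: cvg_near_cst; exists M => // M' /= MM.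
by apply: win_supp => // x xM; rewrite su// mul0r.
Qed.

Lemma schwartzL u v (a b : R) : schwartz u -> schwartz v ->
  schwartz (fun x => a * u x + b * v x).
Proof.
move=> us vs N; have [C C0 uC] := inH_fin (us N); have [D D0 vD] := inH_fin (vs N).
apply: (@le_lt_trans _ _ (2 * a ^+ 2 * C + 2 * b ^+ 2 * D)%:E); last exact: ltry.
have w0 x := ltW (wt_gt0 N x (R := R)).
apply: esum_win_le => [x|M]; first by rewrite mulr_ge0 ?sqr_ge0//; exact: w0.
apply: (@le_trans _ _ (2 * a ^+ 2 * (\sum_(x <- win M) wt N x * u x ^+ 2) +
    2 * b ^+ 2 * (\sum_(x <- win M) wt N x * v x ^+ 2))); last first.
  have := win_le_esum M uC; have := win_le_esum M vD => h1 h2.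
  by apply: lerD; rewrite ler_wpM2l// mulr_ge0 ?sqr_ge0.
rewrite !mulr_sumr -big_split/=; apply: ler_sum => x _.
rewrite [leRHS](_ : _ = wt N x * (2 * (a * u x) ^+ 2 + 2 * (b * v x) ^+ 2)); last ring.
rewrite ler_wpM2l ?w0//; have := sqr_ge0 (a * u x - b * v x); nra.
Qed.

Definition delta (x y : int) : R := (y == x)%:R.

Lemma supp_delta x : supp `|x|.+1 (delta x).
Proof.
move=> y; rewrite mem_win /delta => yM.
by case: eqVneq yM => // ->; lia.
Qed.

Lemma pairing_delta x f : pairing (delta x) f = f x.
Proof.
rewrite (pairing_supp f (@supp_delta x)) (win_single (x0 := x)).
- by rewrite /delta eqxx mul1r.
- by rewrite mem_win; lia.
- by move=> y _ /negbTE yx; rewrite /delta yx mul0r.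
Qed.

Definition trunc M u x : R := if x \in win M then u x else 0.

Lemma supp_trunc M u : supp M (trunc M u).
Proof. by move=> x /negbTE xM; rewrite /trunc xM. Qed.

Lemma pairing_trunc u f : schwartz u -> tempered f ->
  pairing (trunc M u) f @[M --> \oo] --> pairing u f.
Proof.
move=> us ft; rewrite (_ : (fun M => _) = fun M => \sum_(x <- win M) u x * f x).
  exact: pairing_cvg.
apply/funext => M; rewrite (pairing_supp f (@supp_trunc M u)).
by rewrite big_seq [RHS]big_seq; apply: eq_bigr => x xM; rewrite /trunc xM.
Qed.

End Tempered.

Section SprimeMeasurable.
Context {R : realType}.
Implicit Types (f : Sprime R) (u : int -> R).

Lemma measurable_pairing u : schwartz u ->
  measurable_fun setT (fun f : Sprime R => pairing u f).
Proof.
move=> us _ A mA; rewrite setTI; apply: sub_sigma_algebra.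
by exists u => //; exists A => //; rewrite setTI.
Qed.

Lemma measurable_eval x : measurable_fun setT (fun f : Sprime R => f x).
Proof.
have := @measurable_pairing (delta x) (supp_schwartz (@supp_delta R x)).
by under eq_fun do rewrite pairing_delta.
Qed.

(** Coordinates suffice, since every pairing is the limit of its finite window sums. *)
Lemma measurable_Sprime d (T : measurableType d) (X : T -> Sprime R) :
  (forall x, measurable_fun setT (fun w => X w x)) -> measurable_fun setT X.
Proof.
move=> mX; have E : @measurable _ (Sprime R) = <<s @cylinders R >> by [].
apply: (measurability _ E).
move=> _ [_ [u us [A mA <-]] <-]; rewrite !setTI.
have : measurable_fun setT (fun w => pairing u (X w)).
  apply: (measurable_fun_cvg (h := fun M w => \sum_(x <- win M) u x * X w x)).
    by move=> M; apply: measurable_sum => x; exact: measurable_funM.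
  by move=> w _; apply: pairing_cvg => //; exact: Sprime_tempered.
by move=> /(_ measurableT A mA); rewrite setTI.
Qed.

(** Truncating the test function extends the hypothesis from finite support to all of S; pairings
    with S are stable under linear combinations, so [bclass_trig] applies. This is how laws on S'
    are identified from here on. *)
Lemma Sprime_class (H : (Sprime R -> R) -> Prop) : bclass H ->
  (forall M u c, supp M u -> H (fun f => cos (pairing u f + c))) ->
  forall F, bmeas F -> H F.
Proof.
move=> bH Hc.
have Hs u c : schwartz u -> H (fun f => cos (pairing u f + c)).
  move=> us.
  apply: (bclass_lim bH (f_ := fun M f => cos (pairing (trunc M u) f + c)) (M := 1)).
  - by move=> M; apply: (Hc M); exact: supp_trunc.
  - by move=> M f; exact: cos_abs_le1.
  - move=> f; apply: (cvg_comp (fun M => pairing (trunc M u) f + c) (@cos R)).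
      by apply: cvgD; [apply: pairing_trunc => //; exact: Sprime_tempered|exact: cvg_cst].
    exact: continuous_cos.
pose L := [set l : Sprime R -> R | exists2 u, schwartz u & l = (fun f => pairing u f)].
apply: (@bclass_trig R _ _ H L) => //.
- move=> _ _ a b [u us ->] [v vs ->]; exists (fun x => a * u x + b * v x).
    exact: schwartzL.
  apply/funext => f.
  have tf := @Sprime_tempered R f.
  have c1 := pairing_cvg (schwartzL a b us vs) tf.
  have c2 : \sum_(x <- win M) (a * u x + b * v x) * f x @[M --> \oo] -->
      a * pairing u f + b * pairing v f.
    rewrite (_ : (fun M => _) = (fun M => a * (\sum_(x <- win M) u x * f x) + b * (\sum_(x <- win M) v x * f x))).
      by apply: cvgD; apply: cvgM; try exact: cvg_cst; exact: pairing_cvg.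
    by apply/funext => M; rewrite !mulr_sumr -big_split/=; apply: eq_bigr => x _; ring.
  exact: (cvg_unique _ c2 c1).
- by move=> _ c [u us ->]; exact: Hs.
- exists (fun=> 0); first exact: (@supp_schwartz R 0).
  by apply/funext => f; rewrite (@pairing_supp R 0)// big_nil.
- rewrite [LHS](_ : _ = <<s @cylinders R >>)//; congr <<s _ >>.
  apply/seteqP; split=> A.
    by move=> [u us [B mB <-]]; exists (fun f => pairing u f); [exists u|exists B].
  by move=> [_ [u us ->] [B mB <-]]; exists u => //; exists B.
Qed.

End SprimeMeasurable.

(** * Paths of the solutions *)

Section HalfLine.
Context {R : realType}.
Local Notation mu := (@lebesgue_measure R).
Implicit Types (g : R -> R).

Definition cont0 g := {within `[0, +oo[, continuous g}.

Lemma cont0P g : cont0 g <-> (forall t e : R, 0 <= t -> 0 < e ->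
  exists2 r : R, 0 < r & forall s : R, 0 <= s -> `|t - s| < r -> `|g t - g s| <= e).
Proof.
rewrite /cont0; split.
- move=> /subspace_continuousP cg t e t0 e0.
  have t0' : `[0, +oo[%classic t by rewrite /= in_itv/= t0.
  have /cvgrPdist_le/(_ e e0) := cg t t0'.
  move=> /nbhs_ballP[r /= r0 H]; exists r => // s s0 st.
  by apply: (H s) => //; rewrite /= in_itv/= s0.
- move=> H; apply/subspace_continuousP => t; rewrite /= in_itv/= andbT => t0.
  apply/cvgrPdist_le => e e0; have [r r0 Hr] := H t e t0 e0.
  apply/nbhs_ballP; exists r => //= s st; rewrite /= in_itv/= andbT => s0.
  exact: Hr.
Qed.

(** Compactness of [0, T] in a form that yields both uniform continuity and a uniform bound from
    local ones. *)
Let cover (T : R) (P : nat -> R -> Prop) :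
  (forall t : R, 0 <= t -> exists2 r : R, 0 < r & exists N, forall (s : R) n, 0 <= s -> `|t - s| < r ->
     (N <= n)%N -> P n s) ->
  exists n, forall s : R, 0 <= s <= T -> P n s.
Proof.
move=> H; have /compact_near_coveringP/near_covering_withinP K := @segment_compact R 0 T.
have [|N _ HN] := K nat \oo (fun n s => P n s) _ _.
  move=> t; rewrite /= in_itv/= => /andP[t0 _].
  have [r r0 [N HN]] := H t t0.
  exists (ball t r, [set n | (N <= n)%N]).
    by split=> /=; [exact: nbhsx_ballx|exists N].
  move=> [s n] [/= st Nn]; rewrite in_itv/= => /andP[s0 _].
  exact: HN.
by exists N => s sT; apply: (HN N (leqnn N)); rewrite /= in_itv.
Qed.

Lemma cont0_unif g (T e : R) : cont0 g -> 0 < e -> exists N : nat, forall a b : R,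
  0 <= a <= T -> 0 <= b <= T -> `|a - b| <= N.+1%:R^-1 -> `|g a - g b| <= e.
Proof.
move=> /cont0P cg e0.
have [|N HN] := @cover T (fun n a => forall b, 0 <= b <= T ->
    `|a - b| <= n.+1%:R^-1 -> `|g a - g b| <= e).
  move=> t t0; have [r r0 Hr] := cg t (e / 2) t0 (divr_gt0 e0 (ltr0Sn R 1)).
  exists (r / 2); first by rewrite divr_gt0.
  exists (Num.truncn (2 / r)) => s n s0 st Nn b /andP[b0 _] sb.
  have nr : n.+1%:R^-1 < r / 2.
    rewrite -(invf_div 2 r) ltf_pV2 ?posrE ?ltr0n ?divr_gt0//.
    by rewrite (lt_le_trans (truncnS_gt _))// ler_nat ltnS.
  have h1 := Hr s s0 (lt_trans st _); have h2 := Hr b b0 _.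
  have -> : g s - g b = (g t - g b) - (g t - g s) by ring.
  rewrite (le_trans (ler_normB _ _))// [leRHS]splitr lerD//.
    apply: h2; rewrite (_ : t - b = (t - s) + (s - b)); last ring.
    rewrite (le_lt_trans (ler_normD _ _))// [ltRHS]splitr ltrD//.
    exact: le_lt_trans sb nr.
  by apply: h1; rewrite ltr_pdivrMr// ltr_pMr// ltr1n.
by exists N => a b aT bT; exact: HN.
Qed.

Lemma local_bound (B : R -> nat -> Prop) (T : R) :
  (forall t n m, (n <= m)%N -> B t n -> B t m) ->
  (forall t : R, 0 <= t -> exists2 r : R, 0 < r & exists n, forall s : R, 0 <= s -> `|t - s| < r -> B s n) ->
  exists n, forall s : R, 0 <= s <= T -> B s n.
Proof.
move=> Bm H; apply: (@cover T (fun n s => B s n)) => t t0.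
have [r r0 [N HN]] := H t t0; exists r => //; exists N => s n s0 st Nn.
by apply: Bm Nn _; exact: HN.
Qed.

Lemma cont0_within g (a b : R) : 0 <= a -> cont0 g -> {within `[a, b], continuous g}.
Proof.
move=> a0; apply: continuous_subspaceW => x; rewrite /= !in_itv/= andbT => /andP[ax _].
exact: le_trans ax.
Qed.

Lemma cont0_integrable g (a b : R) : 0 <= a -> cont0 g ->
  mu.-integrable `[a, b] (EFin \o g).
Proof.
move=> a0 cg; apply: continuous_compact_integrable; first exact: segment_compact.
exact: cont0_within.
Qed.

Lemma cont0_int_incr g (a b c e : R) : cont0 g -> 0 <= a -> a <= b ->
  (forall s : R, a <= s <= b -> `|g s - c| <= e) ->
  `|\int[mu]_(s in `[0, b]) g s - \int[mu]_(s in `[0, a]) g s - (b - a) * c|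
   <= (b - a) * e.
Proof.
move=> cg a0 ab gce.
have ib : mu.-integrable `]a, b] (EFin \o g).
  apply: integrableS (cont0_integrable b a0 cg) => //.
  by apply: subset_itvr; rewrite bnd_simp.
rewrite Rintegral_itvB; [|exact: cont0_integrable|by rewrite bnd_simp|by rewrite bnd_simp].
have mab : fine (mu `]a, b]) = b - a.
  rewrite lebesgue_measure_itv/= lte_fin; case: ltP => // ba.
  by have -> : a = b; [apply/eqP; rewrite eq_le ab|rewrite subrr].
have ic : mu.-integrable `]a, b] (EFin \o (fun=> c)).
  apply: (@integrableS _ _ _ mu `[a, b]) => //.
    by apply: subset_itvr; rewrite bnd_simp.
  apply: continuous_compact_integrable; first exact: segment_compact.
  by move=> x; exact: cvg_cst.
have -> : (b - a) * c = \int[mu]_(s in `]a, b]) c by rewrite Rintegral_cst// mab mulrC.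
rewrite -RintegralB// (le_trans (le_normr_Rintegral _ _))//.
  by have := integrableB _ ib ic; exact.
have -> : (b - a) * e = \int[mu]_(s in `]a, b]) e by rewrite Rintegral_cst// mab mulrC.
apply: le_Rintegral => //.
- by have := integrable_norm (integrableB _ ib ic); exact.
- apply: (@integrableS _ _ _ mu `[a, b]) => //.
    by apply: subset_itvr; rewrite bnd_simp.
  apply: continuous_compact_integrable; first exact: segment_compact.
  by move=> x; exact: cvg_cst.
- move=> s; rewrite /= in_itv/= => /andP[as_ sb]; apply: gce; rewrite sb andbT; exact: ltW.
Qed.

End HalfLine.

(** * Duality between paths and the backward Euler scheme *)

Section Paths.
Context {R : realType}.
Local Notation mu := (@lebesgue_measure R).
Implicit Types (u v f g : int -> R) (M N p : nat) (x : int) (h s t : R).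

(* [phi] solves the equation driven by the noise [xi]. *)
Record path (phi : R -> int -> R) (xi : int -> R -> R) : Prop := {
  path_cont : forall x, cont0 (fun t => phi t x);
  path_bound : forall T : R, exists N (K : R), 0 <= K /\
    forall t x, 0 <= t <= T -> `|phi t x| <= K * wt N x;
  path_eq : forall t x, 0 <= t -> phi t x = phi 0 x
    + (\int[mu]_(s in `[0, t]) lap cond (phi s) x) + xi x t }.

Arguments path_cont {phi xi} _ x.
Arguments path_bound {phi xi} _ T.
Arguments path_eq {phi xi} _ {t} x _.

Lemma cont0D (g1 g2 : R -> R) (a b : R) : cont0 g1 -> cont0 g2 ->
  cont0 (fun t => a * g1 t + b * g2 t).
Proof.
move=> c1 c2 t; apply: (@cvgD _ R^o); apply: cvgM; try exact: cvg_cst.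
  exact: c1.
exact: c2.
Qed.

Arguments cont0D {g1 g2} a b _ _.

Lemma path_lap_cont phi xi x : path phi xi -> cont0 (fun t => lap cond (phi t) x).
Proof.
move=> Hp; have c1 := path_cont Hp (x + 1); have c2 := path_cont Hp x.
have c3 := path_cont Hp (x - 1).
have := cont0D (cond x) (cond (x - 1)) (cont0D 1 (-1) c1 c2) (cont0D (-1) 1 c2 c3).
by congr cont0; apply/funext => t; rewrite /lap; ring.
Qed.

Arguments path_lap_cont {phi xi} x _.

Lemma pathB phi1 phi2 xi : path phi1 xi -> path phi2 xi ->
  path (fun t x => phi1 t x - phi2 t x) (fun=> cst 0).
Proof.
move=> p1 p2; split.
- move=> x; have := cont0D 1 (-1) (path_cont p1 x) (path_cont p2 x).
  by congr cont0; apply/funext => t; ring.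
- move=> T; have [N1 [K1 [K10 H1]]] := path_bound p1 T.
  have [N2 [K2 [K20 H2]]] := path_bound p2 T.
  exists (maxn N1 N2), (K1 + K2); split; first exact: addr_ge0.
  move=> t x tT; rewrite (le_trans (ler_normB _ _))// mulrDl lerD//.
    by rewrite (le_trans (H1 t x tT))// ler_wpM2l// wt_le// leq_maxl.
  by rewrite (le_trans (H2 t x tT))// ler_wpM2l// wt_le// leq_maxr.
- move=> t x t0; rewrite (path_eq p1 x t0) (path_eq p2 x t0) addr0.
  have -> : \int[mu]_(s in `[0, t]) lap cond (fun x => phi1 s x - phi2 s x) x =
     \int[mu]_(s in `[0, t]) lap cond (phi1 s) x - \int[mu]_(s in `[0, t]) lap cond (phi2 s) x.
    rewrite -RintegralB//; try by apply: cont0_integrable => //; apply: path_lap_cont; eassumption.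
    by apply: eq_Rintegral => s _; rewrite /lap; ring.
  ring.
Qed.

Lemma path_incr phi xi (a b c e : R) x : path phi xi -> 0 <= a -> a <= b ->
  (forall s, a <= s <= b -> `|lap cond (phi s) x - c| <= e) ->
  `|phi b x - phi a x - (xi x b - xi x a) - (b - a) * c| <= (b - a) * e.
Proof.
move=> Hp a0 ab ce.
rewrite (path_eq Hp x (le_trans a0 ab)) (path_eq Hp x a0).
have := cont0_int_incr (path_lap_cont x Hp) a0 ab ce.
by congr (`|_| <= _); ring.
Qed.

Lemma lap_wt_bound N (K : R) f x : 0 <= K -> (forall y, `|f y| <= K * wt N y) ->
  `|lap cond f x| <= 8 * 3 ^+ N * K * wt N.+1 x.
Proof.
move=> K0 fK; have w0 := wt_gt0 N x (R := R).
have h1 : `|f (x + 1)| <= 3 ^+ N * K * wt N x.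
  by rewrite (le_trans (fK _))// -mulrA mulrCA ler_wpM2l// wt_succ.
have h2 : `|f (x - 1)| <= 3 ^+ N * K * wt N x.
  by rewrite (le_trans (fK _))// -mulrA mulrCA ler_wpM2l// wt_pred.
have h3 : `|f x| <= 3 ^+ N * K * wt N x.
  rewrite (le_trans (fK _))// ler_wpM2r ?(ltW w0)// ler_peMl// exprn_ege1//; lra.
have c1 : cond x = wt 1 x :> R by rewrite /cond /wt expr1 addrC.
have c2 : cond (x - 1) <= 3 * cond x :> R.
  have := wt_pred 1 x (R := R); rewrite expr1 /cond /wt !expr1.
  by rewrite ![_ + 1]addrC.
have cx0 := cond_gt0 x (R := R); have cx1 := cond_gt0 (x - 1) (R := R).
rewrite wtS -[X in X * wt N x]expr1 -/(wt 1 x) -c1.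
rewrite (le_trans (ler_normB _ _))// !normrM (gtr0_norm cx0) (gtr0_norm cx1).
set B := 3 ^+ N * K * wt N x in h1 h2 h3 *.
rewrite [leRHS](_ : _ = cond x * (B + B) + 3 * cond x * (B + B)); last by rewrite /B; ring.
apply: lerD; apply: ler_pM => //; try exact: ltW.
  by rewrite (le_trans (ler_normB _ _))// lerD.
by rewrite (le_trans (ler_normB _ _))// lerD.
Qed.

(** Discrete stochastic convolution: the increment over step k is tested against [u] evolved
    backwards through the n - k - 1 later steps. *)
Definition noise M h s n u (xi : int -> R -> R) : R := \sum_(k < n)
  \sum_(x <- win M) eul h M (n - k.+1) u x * (xi x (s + k.+1%:R * h) - xi x (s + k%:R * h)).

(** The failure of duality caused by the window; by [lap_defect] it lives on the two boundary
    edges. *)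
Definition defect M u f : R :=
  \sum_(x <- win M) u x * lap cond f x - \sum_(x <- win M) lap (condM M) u x * f x.

Definition defects M h s n u (phi : R -> int -> R) : R :=
  \sum_(k < n) h * defect M (eul h M (n - k.+1) u) (phi (s + k%:R * h)).

Lemma noiseS M h s n u xi : noise M h s n.+1 u xi = noise M h s n (estep h M u) xi +
  \sum_(x <- win M) u x * (xi x (s + n.+1%:R * h) - xi x (s + n%:R * h)).
Proof.
rewrite /noise big_ord_recr/= subnn; congr (_ + _); apply: eq_bigr => k _.
by apply: eq_bigr => x _; rewrite subSn ?ltn_ord// eul_iterSr.
Qed.

Lemma defectsS M h s n u phi : defects M h s n.+1 u phi =
  defects M h s n (estep h M u) phi + h * defect M u (phi (s + n%:R * h)).
Proof.
rewrite /defects big_ord_recr/= subnn; congr (_ + _); apply: eq_bigr => k _.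
by rewrite subSn ?ltn_ord// eul_iterSr.
Qed.

(** The last forward step of the path is traded for the first backward step of [u], the error being
    the oscillation of L phi within one step. This is left as a hypothesis because a noiseless path
    gives a rate in h and a noisy one only a modulus of continuity. *)
Lemma euler_duality phi xi M h s n u p (e K : R) : path phi xi -> 0 <= h -> 0 <= s ->
  0 <= e ->
  (forall k a x, (k < n)%N -> x \in win M ->
    s + k%:R * h <= a <= s + k.+1%:R * h ->
    `|lap cond (phi a) x - lap cond (phi (s + k%:R * h)) x| <= e * wt p x) ->
  (forall j, (j <= n)%N -> wnorm M p (eul h M j u) <= K) ->
  `|\sum_(x <- win M) u x * phi (s + n%:R * h) x
    - \sum_(x <- win M) eul h M n u x * phi s x
    - noise M h s n u xi - defects M h s n u phi| <= n%:R * h * (e * K).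
Proof.
move=> Hp h0 s0 e0; elim: n u => [|n IH] u He Hw.
  by rewrite /noise /defects !big_ord0 mul0r addr0 !subr0 subrr normr0 mul0r.
have h1 : `|\sum_(x <- win M) estep h M u x * phi (s + n%:R * h) x
    - \sum_(x <- win M) eul h M n (estep h M u) x * phi s x
    - noise M h s n (estep h M u) xi - defects M h s n (estep h M u) phi| <= n%:R * h * (e * K).
  apply: IH => [k r x kn|j jn]; first exact/He/leqW.
  by rewrite -eul_iterSr; exact: Hw.
rewrite noiseS defectsS eul_iterSr.
set a := s + n%:R * h in h1 *; set b := s + n.+1%:R * h.
have bE : b - a = h by rewrite /a /b -natr1; ring.
have ab : a <= b by rewrite -subr_ge0 bE.
have a0 : 0 <= a by rewrite addr_ge0// mulr_ge0.
have h2 : `|\sum_(x <- win M) u x * (phi b x - phi a x - (xi x b - xi x a) - h * lap cond (phi a) x)|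
    <= h * (e * K).
  apply: (@le_trans _ _ (h * e * wnorm M p u)); last first.
    by rewrite -mulrA ler_wpM2l// ler_wpM2l//; exact: (Hw 0%N).
  apply: (@le_trans _ _ (\sum_(x <- win M) `|u x| * (h * (e * wt p x)))).
    rewrite (le_trans (ler_norm_sum _ _ _))// big_seq [leRHS]big_seq.
    apply: ler_sum => x xM; rewrite normrM ler_wpM2l//.
    have := @path_incr _ _ _ _ (lap cond (phi a) x) (e * wt p x) x Hp a0 ab.
    by rewrite bE; apply => r rab; exact: He.
  rewrite /wnorm mulr_sumr; apply: ler_sum => x _; lra.
rewrite -[n.+1%:R]natr1 mulrDl mul1r mulrDl.
apply: le_trans (lerD h1 h2); apply: le_trans (ler_normD _ _).
rewrite le_eqVlt; apply/orP; left; apply/eqP; congr (`|_|).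
have -> : \sum_(x <- win M) u x * (phi b x - phi a x - (xi x b - xi x a) - h * lap cond (phi a) x)
  = \sum_(x <- win M) u x * phi b x - \sum_(x <- win M) u x * phi a x
    - \sum_(x <- win M) u x * (xi x b - xi x a) - h * \sum_(x <- win M) u x * lap cond (phi a) x.
  by rewrite mulr_sumr -!sumrB; apply: eq_bigr => x _; ring.
have -> : \sum_(x <- win M) estep h M u x * phi a x =
  \sum_(x <- win M) u x * phi a x + h * \sum_(x <- win M) lap (condM M) u x * phi a x.
  by rewrite mulr_sumr -big_split/=; apply: eq_bigr => x _; rewrite /estep; ring.
by rewrite /defect; ring.
Qed.

(** At the boundary the weight N + 2 beats the growth of [f] (N powers of M^2) and of the
    conductance (one power); of the decay that remains only 1 / M is kept. *)
Lemma defect_le M u f N (K W : R) : (0 < M)%N -> 0 <= K ->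
  (forall x, `|f x| <= K * wt N x) -> wnorm M N.+2 u <= W ->
  `|defect M u f| <= 10 * 3 ^+ N * K * W / M%:R.
Proof.
move=> M0 K0 fK uW; rewrite /defect lap_defect//.
have W0 : 0 <= W by exact: le_trans (wnorm_ge0 _ _ _) uW.
have M0' : 0 < M%:R :> R by rewrite ltr0n.
have t1 : 1 <= 3 ^+ N :> R by rewrite exprn_ege1//; lra.
have upt x : x \in win M -> `|u x| <= W / wt N.+2 x.
  move=> xM; rewrite (le_trans (wnorm_pt N.+2 u xM))// ler_wpM2r// invr_ge0 ltW//.
  exact: wt_gt0.
have c1 x : cond x = wt 1 x :> R by rewrite /cond /wt expr1 addrC.
have key x (cz : R) (g : R) : x \in win M -> 0 <= cz -> cz * M%:R <= 2 * (wt 1 x * wt 1 x) * (5 / 4) ->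
  `|g| <= 2 * 3 ^+ N * K * wt N x -> `|u x * cz * g| <= 5 * 3 ^+ N * K * W / M%:R.
  move=> xM cz0 czM gK; rewrite !normrM (ger0_norm cz0) ler_pdivlMr//.
  have wx := wt_gt0 N x (R := R); have w1 := wt_gt0 1 x (R := R).
  have ux := upt x xM; rewrite -addn2 wtD -[2%N]addn1 wtD ler_pdivlMr ?mulr_gt0// in ux.
  apply: (@le_trans _ _ (`|u x| * (2 * (wt 1 x * wt 1 x) * (5 / 4)) * (2 * 3 ^+ N * K * wt N x))).
    rewrite mulrAC; apply: ler_pM => //; first by rewrite !mulr_ge0// ltW.
    by rewrite -[leLHS]mulrA ler_wpM2l.
  rewrite [leLHS](_ : _ = 5 * 3 ^+ N * K * (`|u x| * (wt N x * (wt 1 x * wt 1 x)))); last by field.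
  by rewrite ler_wpM2l// mulr_ge0// mulr_ge0// exprn_ge0.
have m1 : 1 <= M%:R :> R by rewrite ler1n.
have mE : (M%:Z%:~R : R) = M%:R by [].
apply: (le_trans (ler_normB _ _)).
rewrite (_ : 10 * 3 ^+ N * K * W / M%:R = 5 * 3 ^+ N * K * W / M%:R + 5 * 3 ^+ N * K * W / M%:R); last first.
  by field; rewrite gt_eqF.
apply: lerD; apply: key.
- by rewrite mem_win; lia.
- exact/ltW/cond_gt0.
- rewrite c1 /wt expr1 rmorphB /= mE; move: (M%:R : R) m1 => y y1.
  set w := 1 + (y - 1) ^+ 2.
  have : y <= 2 * w by rewrite /w; have := sqr_ge0 (4 * y - 5); nra.
  have : 1 <= w by rewrite /w; have := sqr_ge0 (y - 1); lra.
  nra.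
- have f1 := fK M%:Z; have f2 := fK (M%:Z - 1).
  have := wt_succ N (M%:Z - 1) (R := R); rewrite subrK => f3.
  have w0 := wt_gt0 N (M%:Z - 1) (R := R).
  rewrite (le_trans (ler_normB _ _))//.
  set w := wt N (M%:Z - 1) in f2 f3 w0 *.
  have : K * wt N M%:Z <= K * (3 ^+ N * w) by rewrite ler_wpM2l.
  have : K * w <= K * (3 ^+ N * w) by rewrite ler_wpM2l// ler_peMl// ltW.
  lra.
- by rewrite mem_win; lia.
- exact/ltW/cond_gt0.
- rewrite /cond /wt expr1 rmorphB /= !mulrNz !mE; move: (M%:R : R) m1 => y y1.
  have -> : (- y - 1) ^+ 2 + 1 = y ^+ 2 + 2 * y + 2 by ring.
  have -> : 1 + (- y) ^+ 2 = 1 + y ^+ 2 by ring.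
  have : y ^+ 2 + 2 * y + 2 <= 5 / 2 * (1 + y ^+ 2) by nra.
  have : y <= 1 + y ^+ 2 by nra.
  nra.
- have f1 := fK (- M%:Z); have f2 := fK (- M%:Z - 1).
  have f3 := wt_pred N (- M%:Z) (R := R).
  have w0 := wt_gt0 N (- M%:Z) (R := R).
  rewrite (le_trans (ler_normB _ _))//.
  set w := wt N (- M%:Z) in f1 f3 w0 *.
  have : K * wt N (- M%:Z - 1) <= K * (3 ^+ N * w) by rewrite ler_wpM2l.
  have : K * w <= K * (3 ^+ N * w) by rewrite ler_wpM2l// ler_peMl// ltW.
  lra.
Qed.

Lemma defects_le M h s n u phi N (K W T : R) : (0 < M)%N -> 0 <= K -> 0 <= h -> 0 <= s ->
  s + n%:R * h <= T ->
  (forall t x, 0 <= t <= T -> `|phi t x| <= K * wt N x) ->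
  (forall j, (j <= n)%N -> wnorm M N.+2 (eul h M j u) <= W) ->
  `|defects M h s n u phi| <= n%:R * h * (10 * 3 ^+ N * K * W / M%:R).
Proof.
move=> M0 K0 h0 s0 sT pK uW; rewrite (le_trans (ler_norm_sum _ _ _))//.
apply: (@le_trans _ _ (\sum_(k < n) h * (10 * 3 ^+ N * K * W / M%:R))); last first.
  by rewrite sumr_const card_ord -[_ *+ n]mulr_natl mulrA lexx.
apply: ler_sum => k _; rewrite normrM (ger0_norm h0) ler_wpM2l//.
apply: defect_le => // [x|]; last by apply: uW; exact: leq_subr.
apply: pK; rewrite addr_ge0 ?mulr_ge0//= (le_trans _ sT)// lerD2l ler_wpM2r//.
by rewrite ler_nat ltnW.
Qed.

(* For a noiseless path the time discretization error is of order [h],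
   uniformly in the starting point. *)
Lemma det_bound phi T : path phi (fun=> cst 0) -> exists N (C : R), 0 <= C /\
  forall M h s n u (W : R), step_ok M h -> 0 <= s -> s + n%:R * h <= T -> supp M u ->
  (forall j, (j <= n)%N -> wnorm M N.+2 (eul h M j u) <= W) ->
  `|\sum_(x <- win M) u x * phi (s + n%:R * h) x
    - \sum_(x <- win M) eul h M n u x * phi s x| <= C * W / M%:R.
Proof.
move=> Hp; have [N [K [K0 HK]]] := path_bound Hp T.
(* [lap_wt_bound] used twice: once to see that phi is Lipschitz in time with weight N + 1, once more
   for L phi with weight N + 2. *)
pose L := 8 * 3 ^+ N.+1 * (8 * 3 ^+ N * K).
have L0 : 0 <= L by rewrite !mulr_ge0 ?exprn_ge0.
exists N, (`|T| * (L + 10 * 3 ^+ N * K)); split.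
  by rewrite mulr_ge0// addr_ge0// !mulr_ge0// exprn_ge0.
move=> M h s n u W ok s0 sT su uW; have [M0 h0 hM] := ok.
have M0' : 0 < M%:R :> R by rewrite ltr0n.
have W0 : 0 <= W by apply: le_trans (wnorm_ge0 _ _ _) (uW 0%N isT).
have hM1 : h <= M%:R^-1.
  rewrite -[leRHS]mul1r ler_pdivlMr// (le_trans _ hM)// ler_wpM2l//.
  have : 1 <= M%:R :> R by rewrite ler1n.
  by move: (M%:R : R) => y y1; rewrite !exprS expr0; nra.
have kT k a : (k < n)%N -> s + k%:R * h <= a <= s + k.+1%:R * h -> 0 <= a <= T.
  move=> kn /andP[a1 a2]; rewrite (le_trans _ a1) ?addr_ge0 ?mulr_ge0//=.
  by rewrite (le_trans a2)// (le_trans _ sT)// lerD2l ler_wpM2r// ler_nat.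
have Lk k : (k < n)%N -> forall a y, s + k%:R * h <= a <= s + k.+1%:R * h ->
    `|phi a y - phi (s + k%:R * h) y| <= h * (8 * 3 ^+ N * K) * wt N.+1 y.
  move=> kn a y aa; have /andP[a1 a2] := aa.
  have b0 : 0 <= s + k%:R * h by rewrite addr_ge0 ?mulr_ge0.
  have := @path_incr _ _ _ _ 0 (8 * 3 ^+ N * K * wt N.+1 y) y Hp b0 a1.
  rewrite /cst /= subrr subr0 mulr0 subr0 => H; apply: le_trans (H _) _.
    move=> r /andP[r1 r2]; rewrite subr0; apply: lap_wt_bound => // z; apply: HK.
    by apply: (kT k) => //; rewrite r1 (le_trans r2).
  rewrite [leRHS](_ : _ = h * (8 * 3 ^+ N * K * wt N.+1 y)); last ring.
  have w0 := wt_gt0 N.+1 y (R := R).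
  rewrite ler_wpM2r//; last by move: a2; rewrite -natr1; lra.
  by rewrite mulr_ge0 ?(ltW w0)// !mulr_ge0// exprn_ge0.
have h1 := @euler_duality phi (fun=> cst 0) M h s n u N.+2 (h * L) W Hp h0 s0
  (mulr_ge0 h0 L0) _ uW.
have h2 := @defects_le M h s n u phi N K W T M0 K0 h0 s0 sT HK uW.
have nh : 0 <= n%:R * h <= `|T|.
  rewrite mulr_ge0//= (le_trans _ (ler_norm T))// (le_trans _ sT)// lerDr//.
have nz : noise M h s n u (fun=> cst 0) = 0.
  by apply: big1 => k _; apply: big1 => x _; rewrite /cst/= subrr mulr0.
rewrite nz subr0 in h1.
have {}h1 := h1 _.
apply: le_trans (_ : n%:R * h * (h * L * W) + n%:R * h * (10 * 3 ^+ N * K * W / M%:R) <= _).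
  apply: le_trans (lerD (h1 _) h2).
    by rewrite -{1}[X in `|X|](subrK (defects M h s n u phi)) ler_normD.
  move=> k a x kn xM ka.
  have := @lap_wt_bound N.+1 (h * (8 * 3 ^+ N * K)) (fun y => phi a y - phi (s + k%:R * h) y) x.
  rewrite (_ : lap cond _ x = lap cond (phi a) x - lap cond (phi (s + k%:R * h)) x); last by rewrite /lap; ring.
  move=> H; apply: le_trans (H _ _) _.
  - by rewrite !mulr_ge0 ?exprn_ge0.
  - by move=> y; exact: Lk.
  - by rewrite /L; lra.
have /andP[nh0 nhT] := nh.
set E := 10 * 3 ^+ N * K.
have E0 : 0 <= E by rewrite !mulr_ge0 ?exprn_ge0.
have m0 : 0 <= (M%:R^-1 : R) by rewrite invr_ge0.
rewrite [leLHS](_ : _ = n%:R * h * ((h * L + M%:R^-1 * E) * W)); last ring.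
rewrite [leRHS](_ : _ = `|T| * ((M%:R^-1 * L + M%:R^-1 * E) * W)); last ring.
apply: ler_pM => //; first by rewrite mulr_ge0// addr_ge0// mulr_ge0.
by rewrite ler_wpM2r// lerD2r ler_wpM2r.
Qed.

End Paths.

Arguments path_cont {R phi xi} _ x.
Arguments path_bound {R phi xi} _ T.
Arguments path_eq {R phi xi} _ {t} x _.
Arguments path_lap_cont {R phi xi} x _.

(** * Solutions of the SDE as paths *)

Section SolutionPath.
Context {R : realType}.
Local Notation mu := (@lebesgue_measure R).
Implicit Types (u v f g : int -> R) (M N p n : nat) (x : int) (h s t : R).

Lemma drift_lap f x : drift (@conductance R) f x = lap cond f x.
Proof.
rewrite /drift (_ : [set y : int | `|x - y| = 1] = [set` [:: x + 1; x - 1]]); last first.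
  by apply/seteqP; split=> y /=; rewrite !inE; lia.
rewrite -fsbig_seq; last by rewrite /= inE andbT; lia.
rewrite big_cons big_seq1 /conductance eqxx /lap /cond.
have -> : (x - 1 == x + 1) = false by lia.
rewrite subrK eqxx /=; move: (f (x + 1)) (f (x - 1)) ((x - 1)%:~R : R) => a b c.
transitivity ((x%:~R ^+ 2 + 1) * (a - f x) + (c ^+ 2 + 1) * (b - f x)) => //.
by ring.
Qed.

(** Since the weight is at least 1, the factor 1 + C dominates without a square root. *)
Let inH_abs N f (C : R) x : (sqnormH (- N%:Z) f <= C%:E)%E -> 0 <= C ->
  `|f x| <= (1 + C) * wt N x.
Proof.
move=> fC C0; have := sqnorm_pt x fC; rewrite -real_normK ?num_real//.
have := wt_ge1 N x (R := R); set w := wt N x; set y := `|f x|.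
move=> w1 yC; rewrite leNgt; apply/negP => yw.
have y1 : 1 <= y by nra.
have : (1 + C) * w <= y ^+ 2 by nra.
nra.
Qed.

Lemma continuousH_cont0 N (phi : R -> int -> R) x :
  continuousH (- N%:Z) phi -> cont0 (fun t => phi t x).
Proof.
move=> [_ Hc]; apply/cont0P => t e t0 e0.
have w0 := wt_gt0 N x (R := R).
pose d := e ^+ 2 / wt N x.
have d0 : 0 < d by rewrite divr_gt0// exprn_gt0.
have := Hc t t0 [set y | (y < d%:E)%E] _.
move=> /(_ _)[].
  apply: (@open_nbhs_nbhs _ 0%E); split; first exact: open_ereal_lt_ereal.
  by rewrite /= lte_fin.
move=> r /= r0 Hr; exists r => // s s0 st.
have := Hr s st; rewrite /= in_itv/= s0 => /(_ isT) /ltW /(sqnorm_pt x).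
rewrite /d divfK ?gt_eqF// => h1.
rewrite distrC -(ler_pXn2r (n := 2))// ?nnegrE ?(ltW e0)//.
by rewrite real_normK ?num_real.
Qed.

Lemma continuousH_bound N (phi : R -> int -> R) (T : R) :
  continuousH (- N%:Z) phi -> exists N (K : R), 0 <= K /\
  forall t x, 0 <= t <= T -> `|phi t x| <= K * wt N x.
Proof.
move=> [Hf Hc].
have [|t0 t00|n Hn] := @local_bound R (fun t n => forall x, `|phi t x| <= n%:R * wt N x) T.
- move=> t n m nm H x; rewrite (le_trans (H x))// ler_wpM2r ?ler_nat//.
  exact/ltW/wt_gt0.
- have [C C0 fC] := inH_fin (Hf t0 t00).
  have := Hc t0 t00 [set y | (y < 1%:E)%E] _.
  move=> /(_ _)[].
    apply: (@open_nbhs_nbhs _ 0%E); split; first exact: open_ereal_lt_ereal.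
    by rewrite /= lte_fin.
  move=> r /= r0 Hr; exists r => //.
  (* 1 + C bounds the value at [t0], and 1 + 1 the difference, whose squared norm is less than 1. *)
  exists (Num.truncn (1 + C + (1 + 1))).+1 => s s0 st x.
  have := Hr s st; rewrite /= in_itv/= s0 => /(_ isT) /ltW h1.
  have h2 := inH_abs x h1 ler01; have h3 := inH_abs x fC C0.
  rewrite -(subrK (phi t0 x) (phi s x)) (le_trans (ler_normD _ _))//.
  rewrite (le_trans (lerD h2 h3))// -mulrDl addrC ler_wpM2r ?(ltW (wt_gt0 _ _))//.
  by rewrite ltW// truncnS_gt.
- by exists N, n%:R; split=> // t x tT; exact: Hn.
Qed.

Lemma solution_path d (Om : measurableType d) (P : probability Om R)
    (B : int -> R -> Om -> R) phi0 phi :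
  solution P (@conductance R) B phi0 phi ->
  {ae P, forall w, path (fun t => phi t w) (fun x t => Num.sqrt 2 * B x t w)
    /\ phi 0 w = phi0 w}.
Proof.
move=> [_ [N1 [mN1 N10 H1]] [N2 [mN2 N20 H2]] [N3 [mN3 N30 H3]]].
exists (N1 `|` N2 `|` N3); split.
- by do 2 apply: measurableU => //.
- by rewrite !null_set_setU//; exact: measurableU.
move=> w nw; apply: contrapT => nN; apply: nw.
have /contrapT[N cH] : ~ ~ exists N : nat, continuousH (- Posz N) (fun t => phi t w : int -> R).
  by move=> h; apply: nN; left; left; exact: H1.
have /contrapT st : ~ ~ (phi 0 w = phi0 w).
  by move=> h; apply: nN; left; right; exact: H2.
have /contrapT eq : ~ ~ forall (t : R) (x : int), 0 <= t ->
    phi t w x = phi0 w x + (\int[mu]_(s in `[0, t]) drift (@conductance R) (phi s w) x)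
      + Num.sqrt 2 * B x t w.
  by move=> h; apply: nN; right; exact: H3.
split=> //; split.
- by move=> x; exact: continuousH_cont0 cH.
- by move=> T; exact: continuousH_bound cH.
- move=> t x t0; rewrite eq// st; congr (_ + _ + _).
  by apply: eq_Rintegral => s _; exact: drift_lap.
Qed.

Lemma step_ok_large M (T tau : R) n : (0 < M)%N -> 0 <= tau <= T ->
  T * (M%:R ^+ 2 + 1) ^+ 3 <= n%:R -> (0 < n)%N -> step_ok M (tau / n%:R).
Proof.
move=> M0 /andP[tau0 tauT] Tn n0; split=> //; first by rewrite divr_ge0.
rewrite mulrAC ler_pdivrMr ?ltr0n// mul1r (le_trans _ Tn)// ler_wpM2r//.
Qed.

Definition nmin (T : R) M : nat := (Num.truncn (T * (M%:R ^+ 2 + 1) ^+ 3)).+1.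

Lemma step_ok_nmin M (T tau : R) n : (0 < M)%N -> 0 <= tau <= T ->
  (nmin T M <= n)%N -> step_ok M (tau / n%:R).
Proof.
move=> M0 tauT Mn; apply: step_ok_large tauT _ _ => //.
  by rewrite (le_trans (ltW (truncnS_gt _)))// ler_nat.
exact: leq_trans Mn.
Qed.

(** For a noisy path only uniform continuity is available, on finitely many sites. The mesh
    therefore depends on the path and on the window. *)
Lemma path_osc phi xi M (T e : R) : path phi xi -> 0 < e -> exists N : nat,
  forall x (a b : R), x \in win M -> 0 <= a <= T -> 0 <= b <= T -> `|a - b| <= N.+1%:R^-1 ->
  `|lap cond (phi a) x - lap cond (phi b) x| <= e.
Proof.
move=> Hp e0; elim: (win M) => [|y s [N HN]]; first by exists 0%N.
have [N' HN'] := cont0_unif T (path_lap_cont y Hp) e0.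
exists (maxn N N') => x a b; rewrite inE => xs aT bT ab.
have m1 : `|a - b| <= N.+1%:R^-1.
  by rewrite (le_trans ab)// lef_pV2 ?posrE ?ltr0n// ler_nat ltnS leq_maxl.
have m2 : `|a - b| <= N'.+1%:R^-1.
  by rewrite (le_trans ab)// lef_pV2 ?posrE ?ltr0n// ler_nat ltnS leq_maxr.
by move: xs => /predU1P[->|xs]; [exact: HN'|exact: HN].
Qed.

End SolutionPath.

(** * Backward evolution of two test functions *)

Section TwoPhase.
Context {R : realType}.
Variables (s t : R) (M0 : nat) (u v : int -> R).
Hypotheses (s0 : 0 <= s) (st : s <= t) (su : supp M0 u) (sv : supp M0 v).
Implicit Types (M N p n : nat) (x : int).

(* Backward evolution of [u] from [t] to [s], then of the sum with [v] to [0]. *)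
Definition ph1 M n := eul ((t - s) / n%:R) M n u.
Definition phm M n x := ph1 M n x + v x.
Definition ph2 M n := eul (s / n%:R) M n (phm M n).

Definition noise2 M n (xi : int -> R -> R) :=
  noise M ((t - s) / n%:R) s n u xi + noise M (s / n%:R) 0 n (phm M n) xi.

Definition defects2 M n (phi : R -> int -> R) :=
  defects M ((t - s) / n%:R) s n u phi + defects M (s / n%:R) 0 n (phm M n) phi.

(** Half the variance of the noise terms, because of the factor sqrt 2 in the SDE. It is also
    exactly the dissipation in [eul_energy]. *)
Definition var2 M n : R :=
  (t - s) / n%:R * (\sum_(k < n) \sum_(x <- win M) eul ((t - s) / n%:R) M k u x ^+ 2) +
  s / n%:R * (\sum_(k < n) \sum_(x <- win M) eul (s / n%:R) M k (phm M n) x ^+ 2).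

Definition fine_grid M n := [/\ (0 < M)%N, (M0 <= M)%N & (nmin t M <= n)%N].

Let t0 : 0 <= t. Proof. exact: le_trans st. Qed.

Let ok1 M n : fine_grid M n -> step_ok M ((t - s) / n%:R).
Proof. by move=> [h1 h2 h3]; apply: step_ok_nmin h3 => //; rewrite subr_ge0 st gerBl. Qed.

Let ok2 M n : fine_grid M n -> step_ok M (s / n%:R).
Proof. by move=> [h1 h2 h3]; apply: step_ok_nmin h3 => //; rewrite s0. Qed.

Let n_gt0 M n : fine_grid M n -> 0 < n%:R :> R.
Proof. by move=> [h1 h2 h3]; rewrite ltr0n (leq_trans _ h3). Qed.

Let supp_u M n : fine_grid M n -> supp M u.
Proof. by move=> [h1 h2 h3]; exact: supp_le su. Qed.

Let supp_v M n : fine_grid M n -> supp M v.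
Proof. by move=> [h1 h2 h3]; exact: supp_le sv. Qed.

Let supp_m M n : fine_grid M n -> supp M (phm M n).
Proof.
move=> g x xM; rewrite /phm /ph1 (supp_eul _ _ (supp_u g))//.
by rewrite (supp_v g)// addr0.
Qed.

Lemma phase_wnorm p : exists2 W : R, 0 <= W & forall M n, fine_grid M n ->
  forall j, (j <= n)%N -> wnorm M p (eul ((t - s) / n%:R) M j u) <= W /\
    wnorm M p (eul (s / n%:R) M j (phm M n)) <= W.
Proof.
have [C C0 HC] := @eul_wnorm R p.
pose E := expR (C * t); have E1 : 1 <= E by rewrite -expR0 ler_expR mulr_ge0.
have E0 : 0 <= E by apply: le_trans E1.
pose a := wnorm M0 p u; pose b := wnorm M0 p v.
have a0 : 0 <= a := wnorm_ge0 _ _ _; have b0 : 0 <= b := wnorm_ge0 _ _ _.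
have step M n w j (tau : R) : step_ok M (tau / n%:R) -> (j <= n)%N -> 0 < n%:R :> R ->
    tau <= t -> wnorm M p (eul (tau / n%:R) M j w) <= E * wnorm M p w.
  move=> ok jn n0 taut; rewrite (le_trans (HC _ _ _ _ ok))// ler_wpM2r ?wnorm_ge0//.
  rewrite ler_expR ler_wpM2l//; have [_ h0 _] := ok.
  apply: (le_trans (ler_wpM2l h0 (_ : j%:R <= n%:R))); first by rewrite ler_nat.
  by rewrite divfK// gt_eqF.
exists (E * (E * a + b)); first by rewrite mulr_ge0// addr_ge0// mulr_ge0.
move=> M n g j jn; have n0 := n_gt0 g; have [_ MM _] := g.
have h1 i : (i <= n)%N -> wnorm M p (eul ((t - s) / n%:R) M i u) <= E * a.
  move=> ni; rewrite (le_trans (step _ _ _ _ _ (ok1 g) ni n0 _))//; first by rewrite gerBl.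
  by rewrite (wnorm_supp p MM su).
split.
  rewrite (le_trans (h1 j jn))// mulrDr (le_trans (y := E * (E * a)))//.
    by rewrite ler_peMl// mulr_ge0.
  by rewrite lerDl mulr_ge0.
rewrite (le_trans (step _ _ _ _ _ (ok2 g) jn n0 _))// ler_wpM2l//.
rewrite (le_trans (wnormD _ _ _ _))// lerD//; first exact: h1.
by rewrite (wnorm_supp p MM sv).
Qed.

Let eT1 M n : fine_grid M n -> s + n%:R * ((t - s) / n%:R) = t.
Proof. by move=> /n_gt0 n0; field; rewrite gt_eqF. Qed.

Let eT2 M n : fine_grid M n -> 0 + n%:R * (s / n%:R) = s.
Proof. by move=> /n_gt0 n0; field; rewrite gt_eqF. Qed.

Lemma phase_det D : path D (fun=> cst 0) -> exists C : R, forall M n, fine_grid M n ->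
  `|\sum_(x <- win M0) u x * D t x + \sum_(x <- win M0) v x * D s x
    - \sum_(x <- win M) ph2 M n x * D 0 x| <= C / M%:R.
Proof.
move=> HD; have [N [C [C0 HC]]] := det_bound t HD.
have [W W0 HW] := phase_wnorm N.+2.
exists (C * W + C * W) => M n g; have [_ MM _] := g.
have h1 := HC M _ s n u W (ok1 g) s0 _ (supp_u g) (fun j jn => (HW M n g j jn).1).
have h2 := HC M _ 0 n (phm M n) W (ok2 g) (lexx 0) _ (supp_m g) (fun j jn => (HW M n g j jn).2).
rewrite (eT1 g) lexx in h1; rewrite (eT2 g) in h2.
have {}h1 := h1 isT; have {}h2 := h2 st.
rewrite -(win_supp MM (u := fun x => u x * D t x)); last by move=> x xM; rewrite su// mul0r.
rewrite -(win_supp MM (u := fun x => v x * D s x)); last by move=> x xM; rewrite sv// mul0r.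
have E : \sum_(x <- win M) phm M n x * D s x =
  \sum_(x <- win M) ph1 M n x * D s x + \sum_(x <- win M) v x * D s x.
  by rewrite -big_split/=; apply: eq_bigr => x _; rewrite /phm mulrDl.
rewrite E in h2.
rewrite mulrDl; apply: le_trans (lerD h1 h2); apply: le_trans (ler_normD _ _).
rewrite le_eqVlt; apply/orP; left; apply/eqP; congr (`|_|).
by rewrite -/(ph1 M n) -/(ph2 M n); ring.
Qed.

Lemma phase_defects phi xi : path phi xi -> exists C : R, forall M n, fine_grid M n ->
  `|defects2 M n phi| <= C / M%:R.
Proof.
move=> Hp; have [N [K [K0 HK]]] := path_bound Hp t.
have [W W0 HW] := phase_wnorm N.+2.
exists (t * (10 * 3 ^+ N * K * W)) => M n g; have [M_0 MM _] := g.
have n0 := n_gt0 g.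
have [_ h10 _] := ok1 g; have [_ h20 _] := ok2 g.
have h1 := @defects_le _ M _ s n u phi N K W t M_0 K0 h10 s0 _ HK (fun j jn => (HW M n g j jn).1).
have h2 := @defects_le _ M _ 0 n (phm M n) phi N K W t M_0 K0 h20 (lexx 0) _ HK (fun j jn => (HW M n g j jn).2).
rewrite (eT1 g) lexx in h1; rewrite (eT2 g) in h2.
have {}h1 := h1 isT; have {}h2 := h2 st.
have e1 : n%:R * ((t - s) / n%:R) = t - s by field; rewrite gt_eqF.
have e2 : n%:R * (s / n%:R) = s by field; rewrite gt_eqF.
rewrite e1 in h1; rewrite e2 in h2.
rewrite (le_trans (ler_normD _ _))// (le_trans (lerD h1 h2))//.
by rewrite -mulrDl subrK -[leRHS]mulrA lexx.
Qed.

(** Limit in n at a fixed window. The defects stay in the expression, as they become small only when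
    M grows. *)
Lemma phase_residual phi xi M : path phi xi -> (0 < M)%N -> (M0 <= M)%N ->
  \sum_(x <- win M) ph2 M n x * phi 0 x + noise2 M n xi + defects2 M n phi
    @[n --> \oo] --> \sum_(x <- win M0) u x * phi t x + \sum_(x <- win M0) v x * phi s x.
Proof.
move=> Hp M_0 MM; have [W W0 HW] := phase_wnorm 0.
have [t0' s0' st'] : [/\ 0 <= t, 0 <= s & s <= t] by [].
apply/cvgP_eps => e e0; pose d := e / ((t + 1) * (W + 1)).
have t1 : 0 < t + 1 by lra.
have W1 : 0 < W + 1 by lra.
have d0 : 0 < d by rewrite divr_gt0// mulr_gt0.
have [N HN] := path_osc M t Hp d0.
exists (maxn (nmin t M) (Num.truncn (t * N.+1%:R)).+1) => n nn.
have g : fine_grid M n by split=> //; apply: leq_trans nn; exact: leq_maxl.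
have n0 := n_gt0 g.
have hN tau : tau <= t -> tau / n%:R <= N.+1%:R^-1.
  move=> taut; rewrite ler_pdivrMr// mulrC ler_pdivlMr ?ltr0n//.
  apply: (le_trans (y := t * N.+1%:R)); first by rewrite ler_wpM2r.
  rewrite (le_trans (ltW (truncnS_gt _)))// ler_nat.
  by apply: leq_trans nn; exact: leq_maxr.
have [_ h10 _] := ok1 g; have [_ h20 _] := ok2 g.
have e1 : n%:R * ((t - s) / n%:R) = t - s by field; rewrite gt_eqF.
have e2 : n%:R * (s / n%:R) = s by field; rewrite gt_eqF.
have osc a0 tau : 0 <= a0 -> 0 <= tau / n%:R -> a0 + n%:R * (tau / n%:R) <= t -> tau <= t ->
  forall k a x, (k < n)%N -> x \in win M ->
  a0 + k%:R * (tau / n%:R) <= a <= a0 + k.+1%:R * (tau / n%:R) ->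
  `|lap cond (phi a) x - lap cond (phi (a0 + k%:R * (tau / n%:R))) x| <= d * wt 0 x.
  move=> a00 h0 aT taut k a x kn xM /andP[ka ak].
  have b0 : 0 <= a0 + k%:R * (tau / n%:R) by rewrite addr_ge0// mulr_ge0.
  have aT' : a <= t.
    by rewrite (le_trans ak)// (le_trans _ aT)// lerD2l ler_wpM2r// ler_nat.
  rewrite /wt expr0 mulr1; apply: HN => //.
  - by rewrite (le_trans b0 ka).
  - by rewrite b0 (le_trans ka).
  - rewrite ger0_norm ?subr_ge0//; have := hN tau taut.
    move: ak; rewrite -[k.+1%:R]natr1; move: (N.+1%:R^-1) (tau / n%:R) => i j; lra.
have h1 := @euler_duality _ phi xi M _ s n u 0 d W Hp h10 s0 (ltW d0) _ (fun j jn => (HW M n g j jn).1).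
have h2 := @euler_duality _ phi xi M _ 0 n (phm M n) 0 d W Hp h20 (lexx 0) (ltW d0) _ (fun j jn => (HW M n g j jn).2).
have {}h1 := h1 (osc s (t - s) s0 h10 _ _).
have {}h2 := h2 (osc 0 s (lexx 0) h20 _ _).
rewrite (eT1 g) lexx e1 in h1; rewrite (eT2 g) e2 in h2.
have {}h1 := h1 isT _; have {}h2 := h2 st st.
have {}h1 : `|\sum_(x <- win M) u x * phi t x - \sum_(x <- win M) ph1 M n x * phi s x -
   noise M ((t - s) / n%:R) s n u xi - defects M ((t - s) / n%:R) s n u phi| <= (t - s) * (d * W).
  by apply: h1; lra.
rewrite -/(ph2 M n) in h2.
rewrite -(win_supp MM (u := fun x => u x * phi t x)); last by move=> x xM; rewrite su// mul0r.
rewrite -(win_supp MM (u := fun x => v x * phi s x)); last by move=> x xM; rewrite sv// mul0r.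
have E : \sum_(x <- win M) phm M n x * phi s x =
  \sum_(x <- win M) ph1 M n x * phi s x + \sum_(x <- win M) v x * phi s x.
  by rewrite -big_split/=; apply: eq_bigr => x _; rewrite /phm mulrDl.
rewrite E in h2.
apply: (@le_trans _ _ ((t - s) * (d * W) + s * (d * W))); last first.
  rewrite -mulrDl subrK /d.
  rewrite (_ : t * _ = e * (t * W / ((t + 1) * (W + 1)))); last by ring.
  rewrite ler_piMr ?(ltW e0)// ler_pdivrMr ?mulr_gt0// mul1r.
  by apply: ler_pM => //; lra.
apply: le_trans (lerD h1 h2); apply: le_trans (ler_normD _ _).
rewrite -normrN le_eqVlt; apply/orP; left; apply/eqP; congr (`|_|).
by rewrite /noise2 /defects2; ring.
Qed.

Lemma Qf_supp M (a b : int -> R) : (M0 <= M)%N -> supp M0 a -> supp M0 b -> Qf M a b = Qf M0 a b.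
Proof.
move=> MM sa sb; rewrite /Qf (win_supp MM); last by move=> x xM; rewrite sa// mul0r.
apply: eq_bigr => x _; congr (_ * _); rewrite /pot (win_supp MM)// => y yM.
by rewrite sb// mulr0.
Qed.

Let m_inv (a : R) M : (0 < M)%N -> 0 <= a -> a / (M%:R ^+ 2 + 1) <= a / M%:R.
Proof.
move=> M_0 a0; have m1 : 1 <= M%:R :> R by rewrite ler1n.
rewrite ler_wpM2l// lef_pV2 ?posrE//; last lra.
  by move: (M%:R : R) m1 => y y1; nra.
Qed.

(** The energy identities of both phases are added. Between them [v] is added to the evolved [u],
    which contributes Q(v, v) / 2 and the cross term. *)
Lemma phase_energy : exists C : R, forall M n, fine_grid M n ->
  `|2^-1 * Qf M (ph2 M n) (ph2 M n) + var2 M n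
    - (2^-1 * Qf M0 u u + 2^-1 * Qf M0 v v + Qf M (ph1 M n) v)| <= C / M%:R.
Proof.
have [W W0 HW] := phase_wnorm 1.
exists (t * (65 * W ^+ 2)) => M n g; have [M_0 MM _] := g.
have n0 := n_gt0 g.
have h1 := @eul_energy _ _ M u W n (ok1 g) (supp_u g) (fun j jn => (HW M n g j jn).1).
have h2 := @eul_energy _ _ M (phm M n) W n (ok2 g) (supp_m g) (fun j jn => (HW M n g j jn).2).
have e1 : (t - s) / n%:R * n%:R = t - s by field; rewrite gt_eqF.
have e2 : s / n%:R * n%:R = s by field; rewrite gt_eqF.
rewrite e1 in h1; rewrite e2 in h2.
have E : Qf M (phm M n) (phm M n) = Qf M (ph1 M n) (ph1 M n) + 2 * Qf M (ph1 M n) v + Qf M v v.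
  rewrite (_ : phm M n = (fun x => 1 * ph1 M n x + 1 * v x)); last first.
    by apply/funext => x; rewrite /phm; ring.
  by rewrite QfL (Qf_sym M (ph1 M n)) (Qf_sym M v) !QfL (Qf_sym M v); ring.
rewrite E in h2; rewrite -(Qf_supp MM su su) -(Qf_supp MM sv sv).
apply: (le_trans (y := (t - s) * (65 * W ^+ 2 / (M%:R ^+ 2 + 1)) + s * (65 * W ^+ 2 / (M%:R ^+ 2 + 1)))).
  apply: le_trans (lerD h1 h2); apply: le_trans (ler_normD _ _).
  rewrite le_eqVlt; apply/orP; left; apply/eqP; congr (`|_|).
  rewrite -/(ph1 M n) -/(ph2 M n) /var2; field.
  by rewrite gt_eqF.
rewrite -mulrDl subrK -[leRHS]mulrA ler_wpM2l//; apply: m_inv => //.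
by rewrite mulr_ge0// sqr_ge0.
Qed.

(** Applied later to the path starting from the potential of [v], this gives the limit of the cross
    term. *)
Lemma phase1_det D : path D (fun=> cst 0) -> exists C : R, forall M n, fine_grid M n ->
  `|\sum_(x <- win M0) u x * D (t - s) x - \sum_(x <- win M) ph1 M n x * D 0 x| <= C / M%:R.
Proof.
move=> HD; have [N [C [C0 HC]]] := det_bound t HD.
have [W W0 HW] := phase_wnorm N.+2.
exists (C * W) => M n g; have [_ MM _] := g.
have n0 := n_gt0 g.
have e1 : 0 + n%:R * ((t - s) / n%:R) = t - s by field; rewrite gt_eqF.
have := HC M _ 0 n u W (ok1 g) (lexx 0) _ (supp_u g) (fun j jn => (HW M n g j jn).1).
rewrite e1 gerBl s0 => /(_ isT).
by rewrite (win_supp MM (u := fun x => u x * D (t - s) x))// => x xM; rewrite su// mul0r.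
Qed.

End TwoPhase.

Lemma phase1_sym {R : realType} (s t : R) (M0 : nat) (u v : int -> R) :
  0 <= s -> s <= t -> supp M0 u -> supp M0 v ->
  exists C : R, forall M n, fine_grid t M0 M n ->
  `|Qf M (ph1 s t u M n) v - Qf M (ph1 s t v M n) u| <= C / M%:R.
Proof.
move=> s0 st su sv.
have [W W0 HW] := phase_wnorm s0 st su sv 1.
have [W' W'0 HW'] := phase_wnorm s0 st sv su 1.
exists (t * (2 * W * W')) => M n g; have [M_0 MM nn] := g.
have n0 : 0 < n%:R :> R by rewrite ltr0n (leq_trans _ nn).
have ok : step_ok M ((t - s) / n%:R).
  by apply: step_ok_nmin nn => //; rewrite subr_ge0 st gerBl.
have := eul_symmetric ok (supp_le MM su) (supp_le MM sv)
  (fun j jn => (HW M n g j jn).1) (fun j jn => (HW' M n g j jn).1).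
rewrite (Qf_sym M u) => H; apply: le_trans H _.
rewrite divfK ?gt_eqF// -[leRHS]mulrA.
have E0 : 0 <= 2 * W * W' by rewrite !mulr_ge0.
have y0 : 0 <= (M%:R ^+ 2 + 1 : R)^-1 by rewrite invr_ge0 addr_ge0// sqr_ge0.
have m1 : 1 <= M%:R :> R by rewrite ler1n.
apply: ler_pM; [by rewrite subr_ge0|by rewrite mulr_ge0|by rewrite gerBl|].
rewrite ler_wpM2l// lef_pV2 ?posrE//; last lra.
  by move: (M%:R : R) m1 => y y1; nra.
Qed.

Lemma sum_iota_split (V : nmodType) n (F : nat -> V) :
  \sum_(j <- iota 0 (n + n)) F j = \sum_(k < n) F k + \sum_(k < n) F (n + k)%N.
Proof.
have E (G : nat -> V) : \sum_(j <- iota 0 n) G j = \sum_(k < n) G k.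
  by rewrite -(big_mkord xpredT) /index_iota subn0.
by rewrite iotaD big_cat/= E -[X in iota X n]addn0 iotaDl big_map E.
Qed.

(** * Gaussian law of the discretized noise *)

Section NoiseLaw.
Context {R : realType} {d : measure_display} {Om : measurableType d}.
Variable P : probability Om R.
Variables (B : int -> R -> Om -> R).
Hypothesis hB : brownian_family P B.
Variables (s t : R) (u v : int -> R) (M0 : nat).
Hypotheses (s0 : 0 <= s) (st : s <= t).

Definition bnoise M n w := noise2 s t u v M n (fun x r => Num.sqrt 2 * B x r w).

(** The grids of [0, s] and [s, t] are joined into one monotone sequence of 2n steps, so that all
    increments are treated as independent at once. *)
Let grid n j : R := if (j <= n)%N then j%:R * (s / n%:R) else s + (j - n)%:R * ((t - s) / n%:R).

Let coef M n x j : R := Num.sqrt 2 * (if (j < n)%N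
  then eul (s / n%:R) M (n - j.+1) (phm s t u v M n) x
  else eul ((t - s) / n%:R) M (n - (j - n).+1) u x).

Let gridl n k : (k <= n)%N -> grid n k = k%:R * (s / n%:R).
Proof. by rewrite /grid => ->. Qed.

Let gridr n k : (0 < n)%N -> grid n (n + k) = s + k%:R * ((t - s) / n%:R).
Proof.
move=> n0; rewrite /grid; case: k => [|k].
  by rewrite addn0 leqnn mul0r addr0 mulrC divfK// pnatr_eq0 -lt0n.
by rewrite ifF ?addKn//; lia.
Qed.

Let coefl M n x k : (k < n)%N ->
  coef M n x k = Num.sqrt 2 * eul (s / n%:R) M (n - k.+1) (phm s t u v M n) x.
Proof. by rewrite /coef => ->. Qed.

Let coefr M n x k :
  coef M n x (n + k) = Num.sqrt 2 * eul ((t - s) / n%:R) M (n - k.+1) u x.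
Proof. by rewrite /coef ifF ?addKn//; lia. Qed.

Let grid_mono n : (0 < n)%N -> {homo grid n : i j / (i <= j)%N >-> i <= j}.
Proof.
move=> n0; apply: homo_leq => [//|x y z|i]; first exact: le_trans.
have [ni|ni] := ltnP i n.
  rewrite !gridl ?(ltnW ni)//; rewrite ler_wpM2r ?divr_ge0// ler_nat//.
by rewrite -(subnKC ni) -addnS !gridr// lerD2l ler_wpM2r ?ler_nat// divr_ge0// subr_ge0.
Qed.

Let noiseE M n w : (0 < n)%N -> bnoise M n w =
  \sum_(x <- win M) \sum_(j <- iota 0 (n + n))
    coef M n x j * (B x (grid n j.+1) w - B x (grid n j) w).
Proof.
move=> n0; rewrite /bnoise /noise2 /noise addrC ![\sum_(k < n) \sum_(x <- _) _]exchange_big/=.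
rewrite -big_split/=; apply: eq_bigr => x _.
rewrite sum_iota_split; congr (_ + _); apply: eq_bigr => k _.
  by rewrite coefl// !gridl ?(ltnW (ltn_ord k))// !add0r; ring.
by rewrite coefr -addnS !gridr//; ring.
Qed.

Lemma bnoise_gauss M n : (0 < n)%N -> gauss P (2 * var2 s t u v M n) (bnoise M n).
Proof.
move=> n0.
have -> : bnoise M n = (fun w => \sum_(x <- win M) \sum_(j <- iota 0 (n + n))
    coef M n x j * (B x (grid n j.+1) w - B x (grid n j) w)).
  by apply/funext => w; exact: noiseE.
have := brownian_family_gauss (coef M n) (n + n) hB (win_uniq M) _ (grid_mono n0).
rewrite gridl// mul0r lexx => /(_ isT).
congr gauss.
have n1 : n%:R != 0 :> R by rewrite pnatr_eq0 -lt0n.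
have rv (F : nat -> R) : \sum_(k < n) F (n - k.+1)%N = \sum_(k < n) F k.
  by rewrite [RHS](reindex_inj rev_ord_inj).
have sq a : (Num.sqrt 2 * a) ^+ 2 = 2 * a ^+ 2 :> R by rewrite exprMn sqr_sqrtr.
have -> : \sum_(x <- win M) \sum_(j <- iota 0 (n + n)) coef M n x j ^+ 2 * (grid n j.+1 - grid n j) =
  \sum_(x <- win M) (2 * (s / n%:R) * (\sum_(k < n) eul (s / n%:R) M k (phm s t u v M n) x ^+ 2)
   + 2 * ((t - s) / n%:R) * (\sum_(k < n) eul ((t - s) / n%:R) M k u x ^+ 2)).
  apply: eq_bigr => x _; rewrite sum_iota_split; congr (_ + _).
    rewrite -(rv (fun k => eul (s / n%:R) M k (phm s t u v M n) x ^+ 2)) mulr_sumr.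
    apply: eq_bigr => k _; rewrite coefl// !gridl ?(ltnW (ltn_ord k))// sq -natr1; ring.
  rewrite -(rv (fun k => eul ((t - s) / n%:R) M k u x ^+ 2)) mulr_sumr.
  by apply: eq_bigr => k _; rewrite coefr -addnS !gridr// sq -natr1; ring.
rewrite big_split/= -!mulr_sumr /var2 ![\sum_(x <- _) \sum_(k < n) _]exchange_big/=; ring.
Qed.

Lemma bnoise_sigma M n : (0 < n)%N -> forall A, measurable A ->
  sigma_of ([set: int] `*` `[0, +oo[) (fun p => B p.1 p.2) (bnoise M n @^-1` A).
Proof.
move=> n0 A mA.
have g0 j : 0 <= grid n j.
  apply: le_trans (grid_mono n0 (leq0n j)); rewrite gridl// mul0r lexx//.
have -> : bnoise M n = (fun w => \sum_(p <- [seq (x, j) | x <- win M, j <- iota 0 (n + n)])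
    coef M n p.1 p.2 * (B p.1 (grid n p.2.+1) w - B p.1 (grid n p.2) w)).
  by apply/funext => w; rewrite noiseE// big_allpairs.
apply: (@sigma_of_comb R d Om _ ([set: int] `*` `[0, +oo[) (fun p => B p.1 p.2) (int * nat)
  _ (fun p => coef M n p.1 p.2) (fun p => (p.1, grid n p.2.+1)) (fun p => (p.1, grid n p.2))) => //.
by move=> p; split; split => //=; rewrite in_itv/= g0.
Qed.

End NoiseLaw.

(** * Passage to the limit in the duality formula *)

Section MainLimit.
Context {R : realType} {d : measure_display} {Om : measurableType d}.
Variable P : probability Om R.
Variables (B : int -> R -> Om -> R) (phi0 : Om -> Sprime R) (phi : R -> Om -> Sprime R).
Hypothesis hB : brownian_family P B.
Hypothesis mphi0 : measurable_fun setT phi0.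
Hypothesis ind : independent2 P (sigma_of [set: unit] (fun=> phi0))
  (sigma_of ([set: int] `*` `[0, +oo[) (fun p => B p.1 p.2)).
Hypothesis hphi : solution P (@conductance R) B phi0 phi.
Variables (s t : R) (M0 : nat) (u v : int -> R).
Hypotheses (s0 : 0 <= s) (st : s <= t) (su : supp M0 u) (sv : supp M0 v).

Lemma solution_measurable r x : 0 <= r -> measurable_fun setT (fun w => phi r w x).
Proof.
move=> r0; apply: (measurableT_comp (measurable_eval x)).
by move=> _ A mA; rewrite setTI; have [] := solution_adapted hphi r0 mA.
Qed.

Lemma main_limit (c : R) : exists nn : nat -> nat,
  (forall k, fine_grid t M0 (k + M0.+1) (nn k)) /\
  expR (- var2 s t u v (k + M0.+1) (nn k)) *
    \int[P]_w cos (\sum_(x <- win (k + M0.+1)) ph2 s t u v (k + M0.+1) (nn k) x * phi0 w x + c)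
  @[k --> \oo] -->
  \int[P]_w cos (\sum_(x <- win M0) u x * phi t w x + \sum_(x <- win M0) v x * phi s w x + c).
Proof.
have t0 : 0 <= t := le_trans s0 st.
pose A M n w := \sum_(x <- win M) ph2 s t u v M n x * phi0 w x + bnoise B s t u v M n w.
pose D M n w := defects2 s t u v M n (fun r => phi r w).
pose X w := \sum_(x <- win M0) u x * phi t w x + \sum_(x <- win M0) v x * phi s w x.
have mx0 x : measurable_fun setT (fun w => phi0 w x).
  exact: (measurableT_comp (measurable_eval x)).
have mX : measurable_fun setT X.
  by apply: measurable_funD; apply: measurable_sum => x; apply: measurable_funM => //;
     apply: solution_measurable.
have mA M n : (0 < n)%N -> measurable_fun setT (A M n).
  move=> n0; apply: measurable_funD; last by have [] := bnoise_gauss hB u v s0 st M n0.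
  by apply: measurable_sum => x; exact: measurable_funM.
have mlap r x : 0 <= r -> measurable_fun setT (fun w => lap cond (phi r w) x).
  move=> r0; rewrite /lap; apply: measurable_funB; apply: measurable_funM => //;
    by apply: measurable_funB; apply: solution_measurable.
have mdef h a M n w : 0 <= h -> 0 <= a -> measurable_fun setT (fun om => defects M h a n w (fun r => phi r om)).
  move=> h0 a0; rewrite /defects; under eq_fun do rewrite -(big_mkord xpredT (fun k => h * defect M (eul h M (n - k.+1) w) (phi (a + k%:R * h) _))).
  apply: measurable_sum => k; apply: measurable_funM => //.
  have r0 : 0 <= a + k%:R * h by rewrite addr_ge0// mulr_ge0.
  by apply: measurable_funB; apply: measurable_sum => x; apply: measurable_funM => //;
    [exact: mlap|exact: solution_measurable].
have mD M n : measurable_fun setT (D M n).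
  by apply: measurable_funD; apply: mdef => //; rewrite divr_ge0// subr_ge0.
have good := solution_path hphi.
(* The grid is chosen after the window. Dominated convergence turns the pathwise limit in n into one
   of expectations, and the tolerance 1/(k+1) defines the diagonal sequence. *)
have step1 k : exists n, fine_grid t M0 (k + M0.+1) n /\
    `|\int[P]_w cos (A (k + M0.+1)%N n w + D (k + M0.+1)%N n w + c) - \int[P]_w cos (X w + c)| <= k.+1%:R^-1.
  have M_0 : (0 < k + M0.+1)%N by lia.
  have MM : (M0 <= k + M0.+1)%N by lia.
  have := @Eexp_cvg R d Om P (fun n w => cos (A (k + M0.+1)%N n.+1 w + D (k + M0.+1)%N n.+1 w + c))
    (fun w => cos (X w + c)) 1 _ _ _ _.
  move=> /(_ _ _ _ _)/cvgP_eps/(_ k.+1%:R^-1 _)[].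
  - move=> n; apply: measurableT_comp; first exact: measurable_cos.
    by apply: measurable_funD => //; apply: measurable_funD => //; exact: mA.
  - by apply: measurableT_comp; [exact: measurable_cos|exact: measurable_funD].
  - by move=> n w; exact: cos_abs_le1.
  - case: good => N [mN N0 HN]; exists N; split=> //; apply: subset_trans HN => w /=.
    apply: contra_not => -[pw ew].
    have := phase_residual s0 st su sv pw M_0 MM.
    rewrite -(cvg_shiftn 1) => h.
    apply: (cvg_comp (fun n => A (k + M0.+1)%N n.+1 w + D (k + M0.+1)%N n.+1 w + c) (@cos R)); last first.
      exact: continuous_cos.
    apply: cvgD; last exact: cvg_cst.
    by move: h; rewrite /= ew; under eq_fun do rewrite addn1.
  - by rewrite invr_gt0.
  - move=> N HN; exists (maxn N (nmin t (k + M0.+1))).+1; split.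
      by split=> //; lia.
    by apply: HN; exact: leq_maxl.
have [nn Hnn] := choice step1.
exists nn; split=> [k|]; first by have [] := Hnn k.
have nn0 k : (0 < nn k)%N by have [[_ _ +] _] := Hnn k; exact: leq_trans.
(* Integrating out the Gaussian noise, independent of the initial value, produces the factor exp (-
   var2). *)
have E k : expR (- var2 s t u v (k + M0.+1) (nn k)) *
    \int[P]_w cos (\sum_(x <- win (k + M0.+1)) ph2 s t u v (k + M0.+1) (nn k) x * phi0 w x + c)
    = \int[P]_w cos (A (k + M0.+1)%N (nn k) w + c).
  have gb := bnoise_gauss hB u v s0 st (k + M0.+1) (nn0 k).
  have sb C : measurable C -> sigma_of ([set: int] `*` `[0, +oo[) (fun p => B p.1 p.2)
      (bnoise B s t u v (k + M0.+1) (nn k) @^-1` C).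
    exact: bnoise_sigma.
  pose F (f : Sprime R) := \sum_(x <- win (k + M0.+1)) ph2 s t u v (k + M0.+1) (nn k) x * f x + c.
  have mF : measurable_fun setT F.
    apply: measurable_funD => //; apply: measurable_sum => x; apply: measurable_funM => //.
    exact: measurable_eval.
  have := gauss_indep2 (F := F) ind mphi0 mF _ sb gb.
  rewrite (_ : 2 * _ / 2 = var2 s t u v (k + M0.+1) (nn k)); last by field.
  move=> <-; last by move=> C mC; apply: (sigma_of_preimage (X := fun=> phi0) (i := tt)).
  by apply: eq_Rintegral => w _; congr cos; rewrite /A /F; ring.
rewrite (_ : (fun k => _) = (fun k => \int[P]_w cos (A (k + M0.+1)%N (nn k) w + c))); last exact/funext.
pose a k := \int[P]_w cos (A (k + M0.+1)%N (nn k) w + D (k + M0.+1)%N (nn k) w + c).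
pose b k := \int[P]_w (cos (A (k + M0.+1)%N (nn k) w + c) - cos (A (k + M0.+1)%N (nn k) w + D (k + M0.+1)%N (nn k) w + c)).
have bm1 k : bmeas (fun w => cos (A (k + M0.+1)%N (nn k) w + c)).
  by apply: bmeas_cos; apply: measurable_funD => //; exact: mA.
have bm2 k : bmeas (fun w => cos (A (k + M0.+1)%N (nn k) w + D (k + M0.+1)%N (nn k) w + c)).
  by apply: bmeas_cos; apply: measurable_funD => //; apply: measurable_funD => //; exact: mA.
rewrite (_ : (fun k => _) = (fun k => a k + b k)); last first.
  by apply/funext => k; rewrite /a /b EexpB//; ring.
(* Split into the diagonal approximation and the effect of dropping the defects, which tend to 0
   almost surely at rate 1/M. *)
rewrite -[X in _ --> X]addr0; apply: cvgD.
  apply/cvgP_eps => e e0; exists (Num.truncn e^-1) => k ek.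
  rewrite (le_trans (Hnn k).2)// invf_ple ?posrE ?ltr0n//.
  by rewrite (le_trans (ltW (truncnS_gt _)))// ler_nat ltnS.
rewrite /b -(Eexp_cst P 0); apply: (Eexp_cvg (M := 2)).
- by move=> k; have [] := bmeasB (bm1 k) (bm2 k).
- exact: measurable_cst.
- move=> k w; rewrite (le_trans (ler_normB _ _))// -[2]/(1 + 1).
  by rewrite lerD// cos_abs_le1.
- case: good => N [mN N0 HN]; exists N; split=> //; apply: subset_trans HN => w /=.
  apply: contra_not => -[pw ew].
  have [C HC] := phase_defects s0 st su sv pw.
  apply/cvgP_eps => e e0; exists (Num.truncn (C / e)) => k ek.
  rewrite subr0 (le_trans (cos_dist _ _))//.
  rewrite (_ : _ + c - _ = - D (k + M0.+1)%N (nn k) w); last ring.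
  rewrite normrN (le_trans (HC _ _ (Hnn k).1))// ler_pdivrMr; last by rewrite ltr0n; lia.
  rewrite mulrC -ler_pdivrMr// (le_trans (ltW (truncnS_gt _)))// ler_nat.
  by rewrite (leq_ltn_trans ek)// addnS ltnS leq_addr.
Qed.

End MainLimit.

(** * The oscillating modes and the invariant laws *)

Section Oscillation.
Context {R : realType}.
Local Notation mu := (@lebesgue_measure R).

(* Values and fluxes [cond x * (f (x + 1) - f x)] of the solution of
   [L f = i f] with [f 0 = f (-1) = 1], real and imaginary parts. *)
Fixpoint osc_right (n : nat) : (R * R) * (R * R) :=
  if n is k.+1 then
    let: ((a, b), (j, l)) := osc_right k in
    let j' := j - b in let l' := l + a in
    ((a + j' / cond k%:Z, b + l' / cond k%:Z), (j', l'))
  else ((1, 0), (0, 0)).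

Fixpoint osc_left (n : nat) : (R * R) * (R * R) :=
  if n is k.+1 then
    let: ((a, b), (j, l)) := osc_left k in
    let j' := j + b in let l' := l - a in
    ((a - j' / cond (Negz k.+1), b - l' / cond (Negz k.+1)), (j', l'))
  else ((1, 0), (0, 0)).

Definition osc (x : int) : R * R :=
  match x with Posz n => (osc_right n).1 | Negz n => (osc_left n).1 end.

Definition osc1 x := (osc x).1.
Definition osc2 x := (osc x).2.

(** Flux through the edge from x to x + 1. [osc_right n] stores the flux of the edge entering n from
    the left, hence the shift by one on that side only. *)
Let flux (x : int) : R * R :=
  match x with Posz n => (osc_right n.+1).2 | Negz n => (osc_left n).2 end.

Let fluxE x : cond x * (osc1 (x + 1) - osc1 x) = (flux x).1 /\
  cond x * (osc2 (x + 1) - osc2 x) = (flux x).2.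
Proof.
have c0 y := lt0r_neq0 (cond_gt0 y (R := R)).
rewrite /osc1 /osc2; case: x => [n|[|n]].
- rewrite (_ : Posz n + 1 = Posz n.+1); last lia.
  by rewrite /=; case: (osc_right n) => -[a b] [j l] /=; split; field; exact: c0.
- rewrite (_ : Negz 0 + 1 = Posz 0); last lia.
  by rewrite /= !subrr !mulr0.
- rewrite (_ : Negz n.+1 + 1 = Negz n); last lia.
  by rewrite /=; case: (osc_left n) => -[a b] [j l] /=; split; field; exact: c0.
Qed.

Lemma lap_osc x : lap cond osc1 x = - osc2 x /\ lap cond osc2 x = osc1 x.
Proof.
rewrite /lap; have [e1 e2] := fluxE x; have [] := fluxE (x - 1); rewrite subrK => e3 e4.
rewrite e1 e2 e3 e4 {e1 e2 e3 e4} /osc1 /osc2; case: x => [[|n]|n].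
- by rewrite (_ : Posz 0 - 1 = Negz 0)//=; split; ring.
- rewrite (_ : Posz n.+1 - 1 = Posz n); last lia.
  have E m : osc_right m.+1 = let: ((a, b), (j, l)) := osc_right m in
    ((a + (j - b) / cond m%:Z, b + (l + a) / cond m%:Z), (j - b, l + a)) by [].
  rewrite /flux /osc (E n.+1).
  by case: (osc_right n.+1) => -[a b] [j l] /=; split; ring.
- rewrite (_ : Negz n - 1 = Negz n.+1); last lia.
  by rewrite /flux /osc /=; case: (osc_left n) => -[a b] [j l] /=; split; ring.
Qed.

Let div_bound (c j g : R) : 0 < c -> `|j| <= c * g -> `|j / c| <= g.
Proof.
by move=> c0 jg; rewrite normrM normfV (gtr0_norm c0) ler_pdivrMr// mulrC.
Qed.

(** The bound on the flux is the conductance y^2 + 1 times the increment 2y + 1 of y^2, so the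
    bounds on values and fluxes reproduce each other. *)
Let bound_right n : let y : R := n%:R in
  `|(osc_right n).1.1| <= 1 + y ^+ 2 /\ `|(osc_right n).1.2| <= 1 + y ^+ 2 /\
  `|(osc_right n.+1).2.1| <= (y ^+ 2 + 1) * (2 * y + 1) /\
  `|(osc_right n.+1).2.2| <= (y ^+ 2 + 1) * (2 * y + 1).
Proof.
elim: n => [|n] /=.
  by rewrite !subr0 !add0r normr0 normr1; rewrite expr0n /=; split; [|split; [|split]]; lra.
case: (osc_right n) => -[a b] [j l] /=.
set y : R := n%:R; have y0 : 0 <= y by exact: ler0n.
have cE : cond n%:Z = y ^+ 2 + 1 :> R by [].
have c0 : 0 < y ^+ 2 + 1 by have := sqr_ge0 y; lra.
rewrite -[n.+1%:R]natr1 -/y cE.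
move=> [ha [hb [hj hl]]].
have ja := div_bound c0 hj; have lb := div_bound c0 hl.
have ha' : `|a + (j - b) / (y ^+ 2 + 1)| <= 1 + (y + 1) ^+ 2.
  by rewrite (le_trans (ler_normD _ _))// (le_trans (lerD ha ja))//; lra.
have hb' : `|b + (l + a) / (y ^+ 2 + 1)| <= 1 + (y + 1) ^+ 2.
  by rewrite (le_trans (ler_normD _ _))// (le_trans (lerD hb lb))//; lra.
split=> //; split=> //; split.
  by rewrite (le_trans (ler_normB _ _))// (le_trans (lerD hj hb'))//; nra.
by rewrite (le_trans (ler_normD _ _))// (le_trans (lerD hl ha'))//; nra.
Qed.

Let bound_left n : let y : R := n.+1%:R in
  `|(osc_left n).1.1| <= 1 + y ^+ 2 /\ `|(osc_left n).1.2| <= 1 + y ^+ 2 /\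
  `|(osc_left n).2.1| <= (y ^+ 2 + 1) * (2 * y - 1) /\
  `|(osc_left n).2.2| <= (y ^+ 2 + 1) * (2 * y - 1).
Proof.
elim: n => [|n] /=.
  by rewrite normr0 normr1; split; [|split; [|split]]; lra.
case: (osc_left n) => -[a b] [j l] /=.
set y : R := n.+1%:R; have y1 : 1 <= y by rewrite ler1n.
have cE : cond (Negz n.+1) = (y + 1) ^+ 2 + 1 :> R.
  by rewrite /cond NegzE mulrNz sqrrN -[n.+2%:~R]/(n.+2%:R) -natr1.
have c0 : 0 < (y + 1) ^+ 2 + 1 by have := sqr_ge0 (y + 1); lra.
rewrite -[n.+2%:R]natr1 -/y cE.
move=> [ha [hb [hj hl]]].
have hj' : `|j + b| <= ((y + 1) ^+ 2 + 1) * (2 * (y + 1) - 1).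
  by rewrite (le_trans (ler_normD _ _))// (le_trans (lerD hj hb))//; nra.
have hl' : `|l - a| <= ((y + 1) ^+ 2 + 1) * (2 * (y + 1) - 1).
  by rewrite (le_trans (ler_normB _ _))// (le_trans (lerD hl ha))//; nra.
have ja := div_bound c0 hj'; have lb := div_bound c0 hl'.
split; [|split=> //].
  by rewrite (le_trans (ler_normB _ _))// (le_trans (lerD ha ja))//; lra.
by rewrite (le_trans (ler_normB _ _))// (le_trans (lerD hb lb))//; lra.
Qed.

Lemma osc_bound x : `|osc1 x| <= wt 1 x /\ `|osc2 x| <= wt 1 x.
Proof.
rewrite /osc1 /osc2 /wt expr1; case: x => n /=.
  by have [h1 [h2 _]] := bound_right n.
rewrite NegzE mulrNz sqrrN -[n.+1%:~R]/(n.+1%:R).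
by have [h1 [h2 _]] := bound_left n.
Qed.

(** The real part of (a - i b) exp(i t) (f1 + i f2): the noiseless evolution of a f1 + b f2. *)
Definition rotate (a b t : R) (x : int) : R :=
  (a * cos t + b * sin t) * osc1 x + (b * cos t - a * sin t) * osc2 x.

Let lap_rotate a b t x : lap cond (rotate a b t) x = rotate b (- a) t x.
Proof. by rewrite /rotate lapL; have [-> ->] := lap_osc x; ring. Qed.

Let rotate_derive a b x (t : R) : is_derive t 1 (fun t => rotate a b t x) (rotate b (- a) t x).
Proof. by rewrite /rotate; apply: is_derive_eq; rewrite /GRing.scale/=; ring. Qed.

Let rotate_cont a b x : continuous (fun t => rotate a b t x).
Proof.
move=> t; apply/differentiable_continuous/derivable1_diffP.
by have [] := rotate_derive a b x t.
Qed.

Lemma rotate_path a b : path (rotate a b) (fun=> cst 0).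
Proof.
have dr x (t : R) : is_derive t 1 (fun t => rotate a b t x) (lap cond (rotate a b t) x).
  by rewrite lap_rotate; exact: rotate_derive.
have cr x : continuous (fun t => rotate a b t x) by exact: rotate_cont.
have cl x : continuous (fun t => lap cond (rotate a b t) x).
  by under eq_fun do rewrite lap_rotate; exact: rotate_cont.
split.
- by move=> x; apply: continuous_subspaceT; exact: cr.
- move=> T; exists 1%N, (2 * (`|a| + `|b|)); split; first by rewrite mulr_ge0// addr_ge0.
  move=> t x _; have [h1 h2] := osc_bound x.
  rewrite /rotate (le_trans (ler_normD _ _))// !normrM.
  have c1 : `|a * cos t + b * sin t| <= `|a| + `|b|.
    by rewrite (le_trans (ler_normD _ _))// !normrM lerD// ler_piMr// ?cos_abs_le1 ?sin_abs_le1.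
  have c2 : `|b * cos t - a * sin t| <= `|a| + `|b|.
    by rewrite (le_trans (ler_normB _ _))// !normrM addrC lerD// ler_piMr// ?cos_abs_le1 ?sin_abs_le1.
  rewrite mulr_natl mulrnAl mulr2n lerD//; exact: ler_pM.
- move=> t x; rewrite le_eqVlt addr0 => /predU1P[<-|t0].
    by rewrite set_itv1 Rintegral_set1 addr0.
  rewrite /Rintegral (@continuous_FTC2 _ _ (fun t => rotate a b t x)) //=.
  + by rewrite [RHS]addrC subrK.
  + exact: continuous_subspaceT.
  + split=> [y _||]; [by have [] := dr x y|apply: cvg_within_filter; exact: cr..].
  + by move=> y _; rewrite derive1E; have [_ ->] := dr x y.
Qed.

End Oscillation.

Lemma win_sum_nat (R : realType) M (F : int -> R) :
  \sum_(x <- win M) F x = \sum_(i < M + M) F (i%:Z - M%:Z).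
Proof.
rewrite -(big_mkord xpredT (fun i => F (i%:Z - M%:Z))) /index_iota subn0.
rewrite -[RHS](big_map (fun i : nat => i%:Z - M%:Z) xpredT F); apply: perm_big.
apply: uniq_perm; first exact: win_uniq.
  by rewrite map_inj_uniq ?iota_uniq// => i j /=; lia.
move=> x; rewrite mem_win; apply/idP/mapP => [xM|]; last by case=> i; rewrite mem_iota => iM ->; lia.
by exists (absz ((x : int) + M%:Z)); [rewrite mem_iota; lia|lia].
Qed.

(* The law of [alpha f1 + beta (xi1 f1 + xi2 f2) + gamma]. *)
Definition osc_law {R : realType} (alpha beta : R) (nu : probability (Sprime R) R) : Prop :=
  forall M u c, supp M u ->
  \int[nu]_f cos (pairing u f + c) =
  expR (- ((Qf M u u + beta ^+ 2 * ((\sum_(x <- win M) u x * osc1 x) ^+ 2 +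
    (\sum_(x <- win M) u x * osc2 x) ^+ 2)) / 2)) *
  cos (alpha * (\sum_(x <- win M) u x * osc1 x) + c).

(** * Construction of the initial laws *)

Section StationaryLaws.
Context {R : realType} {d : measure_display} {Om : measurableType d}.
Variable P : probability Om R.
Variables (B : int -> R -> Om -> R).
Hypothesis hB : brownian_family P B.

(** Summation by parts: the increment over step k receives the sum of the [a i] with i >= k, which
    makes the summands independent. *)
Lemma gauss_min (W : R -> Om -> R) (r a : nat -> R) m : brownian P W -> 0 <= r 0%N ->
  {homo r : i j / (i <= j)%N >-> i <= j} ->
  gauss P (\sum_(i < m) \sum_(j < m) a i * a j * (r (minn i j).+1 - r 0%N))
    (fun w => \sum_(i < m) a i * (W (r i.+1) w - W (r 0%N) w)).
Proof.
move=> bW r0 hr.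
pose A k := \sum_(i < m) a i * (k <= i)%N%:R.
have tel (V : R -> R) i : (i < m)%N ->
    V (r i.+1) - V (r 0%N) = \sum_(k < m) (k <= i)%N%:R * (V (r k.+1) - V (r k)).
  move=> im; rewrite -(telescope_sumr (fun k => V (r k)) (leq0n i.+1)).
  rewrite (big_nat_widen _ _ m)//= big_mkord big_mkcond/=.
  by apply: eq_bigr => k _; rewrite ltnS; case: ifP => _; rewrite ?mul1r ?mul0r.
have := brownian_gauss A m bW r0 hr.
congr gauss.
  rewrite -[iota 0 m]/(iota 0 m) -{1}(subn0 m) -/(index_iota 0 m) big_mkord.
  transitivity (\sum_(k < m) \sum_(i < m) \sum_(j < m)
    a i * a j * ((k <= minn i j)%N%:R * (r k.+1 - r k))).
    apply: eq_bigr => k _; rewrite expr2 /A mulr_suml mulr_suml; apply: eq_bigr => i _.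
    rewrite mulr_sumr mulr_suml; apply: eq_bigr => j _.
    by rewrite leq_min; case: (k <= i)%N; case: (k <= j)%N => /=; ring.
  rewrite exchange_big/=; apply: eq_bigr => i _; rewrite exchange_big/=.
  apply: eq_bigr => j _; rewrite -mulr_sumr; congr (_ * _).
  rewrite (tel id (minn i j))//; by rewrite (leq_ltn_trans (geq_minl _ _)).
apply/funext => w; rewrite -{1}(subn0 m) -/(index_iota 0 m) big_mkord.
transitivity (\sum_(k < m) \sum_(i < m) a i * ((k <= i)%N%:R * (W (r k.+1) w - W (r k) w))).
  by apply: eq_bigr => k _; rewrite /A mulr_suml; apply: eq_bigr => i _; ring.
rewrite exchange_big/=; apply: eq_bigr => i _; rewrite -mulr_sumr; congr (_ * _).
by rewrite (tel (fun q => W q w) i).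
Qed.

(** The field gamma on the Brownian motion of index 0. Its starting value is subtracted because it
    is zero only almost surely. *)
Let gam w x := B 0 (res x) w - B 0 0 w.

Let gam_gauss M u : gauss P (Qf M u u) (fun w => \sum_(x <- win M) u x * gam w x).
Proof.
(* [gauss_min] measures increments from [r 0], so time 0 is put before the increasing resistances of
   the window. *)
pose r (j : nat) : R := if j is k.+1 then res (k%:Z - M%:Z) else 0.
have hr : {homo r : i j / (i <= j)%N >-> i <= j}.
  apply: homo_leq => [//|x y z|[|i]]; first exact: le_trans.
    by rewrite /r; have /andP[] := @res_ge0 R (0 - M%:Z).
  by rewrite /r; apply: res_mono; lia.
have := gauss_min (fun i => u (i%:Z - M%:Z)) (M + M) (hB.1 0) (lexx 0 : 0 <= r 0%N) hr.
congr gauss; last by apply/funext => w; rewrite win_sum_nat.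
rewrite /Qf win_sum_nat; apply: eq_bigr => i _; rewrite /pot win_sum_nat mulr_sumr.
apply: eq_bigr => j _; rewrite /= subr0 (_ : Order.min _ _ = (minn i j)%:Z - M%:Z); last lia.
by ring.
Qed.

(** The event on which gamma is bounded, hence tempered. It has full measure because the resistances
    stay in [0, 8] and almost every path is continuous there; off it gamma is replaced by 0 so that
    every sample lies in S'. *)
Let Om0 := [set w | exists K : nat, forall x, `|gam w x| <= K%:R].

Let mgam x : measurable_fun setT (fun w => gam w x).
Proof.
apply: measurable_funB; apply: (brownian_measurable (hB.1 0)) => //.
by have /andP[] := @res_ge0 R x.
Qed.

Let mOm0 : measurable Om0.
Proof.
have -> : Om0 = \bigcup_(K in [set: nat]) \bigcap_(n in [set: nat])
    ([set w | `|gam w (Posz n)| <= K%:R] `&` [set w | `|gam w (Negz n)| <= K%:R]).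
  apply/seteqP; split=> [w [K HK]|w [K _ HK]].
    by exists K => // n _; split; exact: HK.
  by exists K; case=> n; have [] := HK n I.
have ml x (K : nat) : measurable [set w | `|gam w x| <= K%:R].
  rewrite -[X in measurable X]setTI; apply: measurable_fun_le => //.
  by apply: measurableT_comp => //; exact: mgam.
by apply: bigcup_measurable => K _; apply: bigcap_measurableType => n _; exact: measurableI.
Qed.

Let Om0_ae : {ae P, forall w, Om0 w}.
Proof.
have [N [mN N0 HN]] := brownian_continuous (hB.1 0).
exists N; split=> //; apply: subset_trans HN => w /=; apply: contra_not => cw.
have [n Hn] : exists n, forall s, 0 <= s <= 8 -> `|B 0 s w| <= n%:R.
  apply: local_bound => [t n m nm H|t t0]; first by rewrite (le_trans H)// ler_nat.
  have /cont0P/(_ t 1 t0 ltr01)[r r0 Hr] := cw.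
  exists r => //; exists (Num.truncn (1 + `|B 0 t w|)).+1 => s s0 st.
  rewrite (le_trans _ (ltW (truncnS_gt _)))//.
  rewrite -[B 0 s w](subrK (B 0 t w)) (le_trans (ler_normD _ _))// lerD2r distrC.
  exact: Hr.
exists (n + n)%N => x; rewrite natrD (le_trans (ler_normB _ _))// lerD//; apply: Hn.
  exact: res_ge0.
by rewrite lexx /=; lra.
Qed.

Variables (alpha beta : R).

Let noise_part w x :=
  (B 1 1 w - B 1 0 w) * osc1 x + (B 2 1 w - B 2 0 w) * osc2 x.

Let eta_fun w x : R :=
  alpha * osc1 x + beta * noise_part w x + (if w \in Om0 then gam w x else 0).

Let eta_tempered w : tempered (eta_fun w).
Proof.
have [K HK] : exists K : nat, forall x, `|if w \in Om0 then gam w x else 0| <= K%:R.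
  have [/set_mem[K HK]|nw] := boolP (w \in Om0); first by exists K.
  by exists 0%N => x; rewrite normr0.
apply: (@bound_tempered R 1 (`|alpha| + `|beta| * (`|B 1 1 w - B 1 0 w| + `|B 2 1 w - B 2 0 w|) + K%:R)).
move=> x; have [h1 h2] := osc_bound x (R := R); have w1 := wt_ge1 1 x (R := R).
rewrite /eta_fun (le_trans (ler_normD _ _))// mulrDl; apply: lerD; last first.
  by rewrite (le_trans (HK x))// ler_peMr.
rewrite (le_trans (ler_normD _ _))// mulrDl; apply: lerD; first by rewrite normrM ler_wpM2l.
rewrite normrM -[leRHS]mulrA ler_wpM2l// /noise_part (le_trans (ler_normD _ _))// [leRHS]mulrDl.
by apply: lerD; rewrite normrM ler_wpM2l.
Qed.

Let eta w : Sprime R := MkSprime (eta_tempered w).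

Let meta : measurable_fun setT eta.
Proof.
apply: measurable_Sprime => x; rewrite /= /eta_fun.
have mB y r : 0 <= r -> measurable_fun setT (B y r) by exact: (brownian_measurable (hB.1 y)).
apply: measurable_funD.
  apply: measurable_funD => //; apply: measurable_funM => //.
  by apply: measurable_funD; apply: measurable_funM => //; apply: measurable_funB; exact: mB.
rewrite (_ : (fun w => _) = (fun w => \1_Om0 w * gam w x)).
  by apply: measurable_funM => //; exact: measurable_indic mOm0.
by apply/funext => w; rewrite indicE; case: (_ \in _); rewrite ?mul1r ?mul0r.
Qed.

Let eta_gauss M u :
  let a1 := \sum_(x <- win M) u x * osc1 x in
  let a2 := \sum_(x <- win M) u x * osc2 x in
  gauss P (Qf M u u + beta ^+ 2 * (a1 ^+ 2 + a2 ^+ 2))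
    (fun w => \sum_(x <- win M) u x * gam w x +
      beta * ((B 1 1 w - B 1 0 w) * a1 + (B 2 1 w - B 2 0 w) * a2)).
Proof.
move=> a1 a2.
have inc y : gauss P 1 (fun w => B y 1 w - B y 0 w).
  split.
    by apply: measurable_funB; apply: (brownian_measurable (hB.1 y)).
  move=> b c; have := brownian_gaussian (hB.1 y) (lexx 0) ltr01; rewrite subr0 => hl.
  rewrite -(@Eexp_pushforward R _ _ _ _ P (normal_prob 0 (Num.sqrt 1)) _ (fun y => cos (b * y + c)) hl).
    by rewrite normal_chf ?sqrtr_gt0// sqr_sqrtr.
  by apply: bmeas_cos; apply: measurable_funD => //; exact: measurable_funM.
(* The Brownian motions of index 0, 1, 2 supply gamma, xi1 and xi2; the remaining indices get the
   degenerate Gaussian. *)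
pose v (y : int) : R := match y with Posz 0 => Qf M u u
  | Posz 1 => (beta * a1) ^+ 2 * 1 | Posz 2 => (beta * a2) ^+ 2 * 1 | _ => 0 end.
pose Y (y : int) (w : Om) : R := match y with
  | Posz 0 => \sum_(x <- win M) u x * gam w x
  | Posz 1 => beta * a1 * (B 1 1 w - B 1 0 w)
  | Posz 2 => beta * a2 * (B 2 1 w - B 2 0 w) | _ => 0 end.
have := @gauss_sum R d Om P int (fun x => sigma_of `[0, +oo[ (B x)) v Y hB.2 _ _ _ [:: Posz 0; Posz 1; Posz 2] isT.
rewrite !big_cons big_nil /v addr0 !mulr1 => H.
have {}H := H _ _ _.
have E : Qf M u u + ((beta * a1) ^+ 2 + (beta * a2) ^+ 2) = Qf M u u + beta ^+ 2 * (a1 ^+ 2 + a2 ^+ 2) by ring.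
rewrite E in H.
have {}H := H _ _ _.
rewrite (_ : (fun w => _) = (fun w => \sum_(i <- [:: Posz 0; Posz 1; Posz 2]) Y i w)).
  apply: H.
  - move=> x; apply: sigma_of_measurable => r; rewrite /= in_itv/= andbT.
    exact: (brownian_measurable (hB.1 x)).
  - have one y (a : R) A : measurable A -> sigma_of `[0, +oo[ (B y) ((fun w => a * (B y 1 w - B y 0 w)) @^-1` A).
      move=> mA.
      rewrite (_ : (fun w => _) = (fun w => \sum_(k <- [:: tt]) a * (B y 1 w - B y 0 w))); last first.
        by apply/funext => w; rewrite big_seq1.
      apply: (@sigma_of_comb R d Om R `[0, +oo[ (B y) unit [:: tt]
        (fun=> a) (fun=> 1) (fun=> 0)) => // _.
      by rewrite /= !in_itv/= !andbT; split.
    have cst y A : sigma_of `[0, +oo[ (B y) ((fun=> 0 : R) @^-1` A).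
      have [A0|nA0] := pselect (A 0).
        rewrite (_ : _ @^-1` A = setT); first exact: (@measurableT _ (g_sigma_algebraType _)).
        by apply/seteqP; split.
      rewrite (_ : _ @^-1` A = set0); first exact: (@measurable0 _ (g_sigma_algebraType _)).
      by apply/seteqP; split.
    case=> [[|[|[|n]]]|n] A mA //=.
    + apply: (@sigma_of_comb R d Om R `[0, +oo[ (B 0) int (win M) u (fun x => res x) (fun=> 0)) => // x.
      by rewrite /= !in_itv/= !andbT; split=> //; have /andP[] := @res_ge0 R x.
    + exact: one.
    + exact: one.
  - case=> [[|[|[|n]]]|n].
    + exact: gam_gauss.
    + by have := gaussZ (beta * a1) (inc 1); rewrite mulr1.
    + by have := gaussZ (beta * a2) (inc 2); rewrite mulr1.
    + exact: gauss0.
    + exact: gauss0.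
by apply/funext => w; rewrite !big_cons big_nil /Y; ring.
Qed.

Lemma stationary_law : exists nu : probability (Sprime R) R, osc_law alpha beta nu.
Proof.
pose X : {mfun Om >-> Sprime R} := mfun_Sub (mem_set meta).
exists (distribution P X) => M u c su.
have hl : has_law P eta (distribution P X) by split.
have mp : measurable_fun setT (fun f : Sprime R => pairing u f + c).
  apply: measurable_funD => //; apply: measurable_pairing.
  exact: supp_schwartz su.
rewrite (Eexp_pushforward hl); last exact: bmeas_cos.
have [mY gY] := eta_gauss M u.
set a1 := \sum_(x <- win M) u x * osc1 x; set a2 := \sum_(x <- win M) u x * osc2 x.
have := gY 1 (alpha * a1 + c); rewrite expr1n mul1r => <-.
apply: Eexp_ae_eq.
- apply: measurableT_comp; first exact: measurable_cos.
  exact: (measurableT_comp mp).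
- apply: measurableT_comp; first exact: measurable_cos.
  by apply: measurable_funD => //; apply: measurable_funM.
- case: Om0_ae => N [mN N0 HN]; exists N; split=> //; apply: subset_trans HN => w /=.
  apply: contra_not => wO; congr cos; rewrite mul1r (pairing_supp _ su) /= /eta_fun mem_set//.
  transitivity (alpha * a1 + beta * ((B 1 1 w - B 1 0 w) * a1 + (B 2 1 w - B 2 0 w) * a2)
    + \sum_(x <- win M) u x * gam w x + c); last by rewrite -/a1 -/a2; ring.
  congr (_ + c); rewrite /a1 /a2 !mulr_sumr -!big_split/= mulr_sumr -!big_split/=.
  by apply: eq_bigr => x _; rewrite /noise_part; ring.
Qed.

End StationaryLaws.

(** * Laws at two times *)

Lemma cvg_inv_bound (R : realType) (b : nat -> R) (a C : R) (M0 : nat) :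
  (forall k, `|b k - a| <= C / (k + M0.+1)%:R) -> b k @[k --> \oo] --> a.
Proof.
move=> H; apply/cvgP_eps => e e0; exists (Num.truncn (C / e)) => k ek.
rewrite (le_trans (H k))// ler_pdivrMr; last by rewrite ltr0n addnS.
rewrite mulrC -ler_pdivrMr// (le_trans (ltW (truncnS_gt _)))// ler_nat.
by rewrite (leq_ltn_trans ek)// addnS ltnS leq_addr.
Qed.

Lemma cvg_eqfun (R : realType) (f g : nat -> R) (l : R) :
  f =1 g -> f k @[k --> \oo] --> l -> g k @[k --> \oo] --> l.
Proof. by move=> /funext ->. Qed.

Section Kernel.
Context {R : realType}.
Hypothesis det : forall f : Sprime R, exists D, path D (fun=> cst 0) /\ D 0 = f.
Variables (s t : R) (u v : int -> R) (M0 : nat).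
Hypotheses (s0 : 0 <= s) (st : s <= t) (su : supp M0 u) (sv : supp M0 v).
Variable nu0 : probability (Sprime R) R.
Hypothesis nu0P : forall M w c, supp M w ->
  \int[nu0]_f cos (pairing w f + c) = expR (- (Qf M w w / 2)) * cos c.

Definition fine_seq (nn : nat -> nat) := forall k, fine_grid t M0 (k + M0.+1) (nn k).

Let W2 nn k := ph2 s t u v (k + M0.+1) (nn k).
Let Q2 nn k := Qf (k + M0.+1) (W2 nn k) (W2 nn k).

Let supp_W2 nn k : supp (k + M0.+1) (W2 nn k).
Proof.
have h : (M0 <= k + M0.+1)%N by lia.
apply: supp_eul => x xM; rewrite /phm /ph1 (supp_eul _ _ (supp_le h su))//.
by rewrite (supp_le h sv)// addr0.
Qed.

Let nn0 k := nmin t (k + M0.+1).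

Let fine_nn0 : fine_seq nn0.
Proof. by move=> k; split; rewrite ?leqnn//; lia. Qed.

(* [ell f = <u, S_t f> + <v, S_s f>] for the noiseless flow [S], and [g] is
   [<u, S_(t-s) G v>], with [G] the Green operator.  The limits hold along every
   fine grid, so that those for (u, v) and (v, u) can be taken along the same. *)
Record kernel_spec (ell : Sprime R -> R) (kappa g : R) : Prop := {
  ker_ell : forall nn, fine_seq nn -> forall f : Sprime R,
    pairing (ph2 s t u v (k + M0.+1) (nn k)) f @[k --> \oo] --> ell f;
  ker_g : forall nn, fine_seq nn ->
    Qf (k + M0.+1) (ph1 s t u (k + M0.+1) (nn k)) v @[k --> \oo] --> g;
  ker_kappa : forall nn, fine_seq nn ->
    expR (- var2 s t u v (k + M0.+1) (nn k)) @[k --> \oo] --> kappa;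
  ker_energy : kappa * \int[nu0]_f cos (ell f) =
    expR (- (2^-1 * Qf M0 u u + 2^-1 * Qf M0 v v + g)) }.

Let path_limit D nn : path D (fun=> cst 0) -> fine_seq nn ->
  pairing (W2 nn k) (D 0) @[k --> \oo] -->
  \sum_(x <- win M0) u x * D t x + \sum_(x <- win M0) v x * D s x.
Proof.
move=> HD fn; have [C HC] := phase_det s0 st su sv HD.
apply: (@cvg_inv_bound _ _ _ C M0) => k.
by rewrite (pairing_supp _ (@supp_W2 nn k)) distrC; exact: HC (fn k).
Qed.

(** With Q the Green form of the evolved test function, exp (- Q / 2) is the expectation of a cosine
    under the law of gamma and tends to [q], while by the energy identity exp (- Q / 2) exp (- var2)
    tends to exp (- K). Dividing gives the limit of exp (- var2). *)
Lemma kernel_exists : exists ell kappa g, kernel_spec ell kappa g.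
Proof.
have [S HS] := choice det.
pose ell (f : Sprime R) := \sum_(x <- win M0) u x * S f t x + \sum_(x <- win M0) v x * S f s x.
have cell nn : fine_seq nn -> forall f : Sprime R, pairing (W2 nn k) f @[k --> \oo] --> ell f.
  by move=> fn f; have [pf ef] := HS f; have := path_limit pf fn; rewrite ef.
have GvT : tempered (pot M0 v).
  by apply: (@bound_tempered R 0 (8 * wnorm M0 0 v)) => x; rewrite /wt expr0 mulr1; exact: pot_abs.
pose Gv : Sprime R := MkSprime GvT.
have [pG eG] := HS Gv.
pose g := \sum_(x <- win M0) u x * S Gv (t - s) x.
have cg nn : fine_seq nn ->
    Qf (k + M0.+1) (ph1 s t u (k + M0.+1) (nn k)) v @[k --> \oo] --> g.
  move=> fn; have [C HC] := phase1_det s0 st su sv pG.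
  apply: (@cvg_inv_bound _ _ _ C M0) => k; rewrite distrC.
  apply: le_trans (HC _ _ (fn k)); rewrite le_eqVlt; apply/orP; left; apply/eqP.
  congr (`|_ - _|); rewrite /Qf eG; apply: eq_bigr => x _; congr (_ * _).
  by rewrite /pot (win_supp (M := M0))//; [lia|move=> y yM; rewrite sv// mulr0].
pose q := \int[nu0]_f cos (ell f).
have mW nn k : measurable_fun setT (fun f : Sprime R => pairing (W2 nn k) f).
  by apply: measurable_pairing; exact: supp_schwartz (@supp_W2 nn k).
have mell : measurable_fun setT ell.
  apply: (measurable_fun_cvg (h := fun k (f : Sprime R) => pairing (W2 nn0 k) f)).
    exact: mW.
  by move=> f _; exact: cell.
have cq nn : fine_seq nn -> expR (- (Q2 nn k / 2)) @[k --> \oo] --> q.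
  move=> fn; rewrite (_ : (fun k => _) = (fun k => \int[nu0]_f cos (pairing (W2 nn k) f))); last first.
    apply/funext => k; have := nu0P 0 (@supp_W2 nn k); rewrite cos0 mulr1 => <-.
    by apply: eq_Rintegral => f _; rewrite addr0.
  apply: (Eexp_cvg (M := 1)).
  - by move=> k; apply: measurableT_comp => //; exact: measurable_cos.
  - by apply: measurableT_comp => //; exact: measurable_cos.
  - by move=> k f; exact: cos_abs_le1.
  - apply: aeW => f; apply: (cvg_comp (fun k => pairing (W2 nn k) f) (@cos R)).
      exact: cell.
    exact: continuous_cos.
pose K := 2^-1 * Qf M0 u u + 2^-1 * Qf M0 v v + g.
have cK nn : fine_seq nn -> expR (- (Q2 nn k / 2)) * expR (- var2 s t u v (k + M0.+1) (nn k))
    @[k --> \oo] --> expR (- K).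
  move=> fn; have [C HC] := phase_energy s0 st su sv.
  rewrite (_ : (fun k => _) = (fun k => expR (- (2^-1 * Q2 nn k + var2 s t u v (k + M0.+1) (nn k))))); last first.
    by apply/funext => k; rewrite -expRD; congr expR; field.
  apply: (cvg_comp _ (@expR R)); last exact: continuous_expR.
  apply: (@cvgN _ R^o).
  have h1 : 2^-1 * Q2 nn k + var2 s t u v (k + M0.+1) (nn k) - (2^-1 * Qf M0 u u + 2^-1 * Qf M0 v v +
      Qf (k + M0.+1) (ph1 s t u (k + M0.+1) (nn k)) v) @[k --> \oo] --> (0 : R).
    by apply: (@cvg_inv_bound _ _ _ C M0) => k; rewrite subr0; exact: HC (fn k).
  have h2 : (2^-1 * Qf M0 u u + 2^-1 * Qf M0 v v +
      Qf (k + M0.+1) (ph1 s t u (k + M0.+1) (nn k)) v) @[k --> \oo] --> K.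
    by apply: cvgD; [exact: cvg_cst|exact: cg].
  have := cvgD h1 h2; rewrite add0r => /(_ _); apply: cvg_eqfun => k.
  exact: subrK.
have V0 nn k : 0 <= var2 s t u v (k + M0.+1) (nn k).
  have sq (h : R) w : 0 <= \sum_(i < nn k) \sum_(x <- win (k + M0.+1)) eul h (k + M0.+1) i w x ^+ 2.
    by apply: sumr_ge0 => i _; apply: sumr_ge0 => x _; exact: sqr_ge0.
  by rewrite addr_ge0// mulr_ge0 ?sq// divr_ge0// subr_ge0.
(* The variance is nonnegative, so [q] is at least exp (- K). *)
have q0 : 0 < q.
  apply: lt_le_trans (expR_gt0 (- K)) _.
  have h1 := cK nn0 fine_nn0; have h2 := cq nn0 fine_nn0.
  rewrite -(cvg_lim _ h1)// -(cvg_lim _ h2)//.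
  apply: ler_lim; [by apply/cvg_ex; exists (expR (- K))|by apply/cvg_ex; exists q|].
  by apply: nearW => k; rewrite ler_piMr ?expR_ge0// -[leRHS]expR0 ler_expR oppr_le0.
exists ell, (expR (- K) / q), g; split=> //.
- move=> nn fn; rewrite (_ : (fun k => _) = (fun k => expR (- (Q2 nn k / 2)) *
      expR (- var2 s t u v (k + M0.+1) (nn k)) / expR (- (Q2 nn k / 2)))); last first.
    by apply/funext => k; rewrite mulrAC mulfV ?mul1r// gt_eqF// expR_gt0.
  apply: cvgM; first exact: cK.
  by apply: cvgV; [rewrite gt_eqF|exact: cq].
- by rewrite divfK// gt_eqF.
Qed.

Variables (ell : Sprime R -> R) (kappa g : R).
Hypothesis ker : kernel_spec ell kappa g.

Lemma measurable_ell : measurable_fun setT ell.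
Proof.
apply: (measurable_fun_cvg (h := fun k (f : Sprime R) => pairing (W2 nn0 k) f)).
  by move=> k; apply: measurable_pairing; exact: supp_schwartz (@supp_W2 nn0 k).
by move=> f _; exact: (ker_ell ker fine_nn0).
Qed.

Let cvg_cos_ell d (Om : measurableType d) (P : probability Om R) (phi0 : Om -> Sprime R) c nn :
  measurable_fun setT phi0 -> fine_seq nn ->
  \int[P]_w cos (pairing (W2 nn k) (phi0 w) + c) @[k --> \oo] --> \int[P]_w cos (ell (phi0 w) + c).
Proof.
move=> m0 fn; apply: (Eexp_cvg (M := 1)).
- move=> k; apply: measurableT_comp; first exact: measurable_cos.
  apply: measurable_funD => //.
  exact: (measurableT_comp (measurable_pairing (supp_schwartz (@supp_W2 nn k))) m0).
- apply: measurableT_comp; first exact: measurable_cos.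
  by apply: measurable_funD => //; exact: (measurableT_comp measurable_ell m0).
- by move=> k w; exact: cos_abs_le1.
- apply: aeW => w; apply: (cvg_comp (fun k => pairing (W2 nn k) (phi0 w) + c) (@cos R)).
    by apply: cvgD; [exact: (@ker_ell _ _ _ ker nn fn (phi0 w))|exact: cvg_cst].
  exact: continuous_cos.
Qed.

Lemma kernel_solution d (Om : measurableType d) (P : probability Om R)
    (B : int -> R -> Om -> R) (phi0 : Om -> Sprime R) (phi : R -> Om -> Sprime R) c :
  brownian_family P B -> measurable_fun setT phi0 ->
  independent2 P (sigma_of [set: unit] (fun=> phi0))
    (sigma_of ([set: int] `*` `[0, +oo[) (fun p => B p.1 p.2)) ->
  solution P (@conductance R) B phi0 phi ->
  \int[P]_w cos (pairing u (phi t w) + pairing v (phi s w) + c) =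
  kappa * \int[P]_w cos (ell (phi0 w) + c).
Proof.
move=> hB m0 ind hphi.
have [nn [fn H]] := main_limit hB m0 ind hphi s0 st su sv c.
under eq_Rintegral do rewrite (pairing_supp _ su) (pairing_supp _ sv).
apply/esym/(cvg_unique _ _ H) => //; apply: cvgM; first exact: (ker_kappa ker fn).
apply: cvg_eqfun (@cvg_cos_ell _ _ P phi0 c nn m0 fn) => k.
by apply: eq_Rintegral => w _; rewrite (pairing_supp _ (@supp_W2 nn k)).
Qed.

(** Before the limit, the integral under [nu] is the one under the law of gamma times an explicit
    function of the two window sums against f1 and f2. These sums converge by duality along the
    rotating paths, and kappa times the gamma part is given by [ker_energy]. *)
Lemma kernel_law (nu : probability (Sprime R) R) alpha beta c :
  osc_law alpha beta nu ->
  let z1 := pairing u (rotate 1 0 t) + pairing v (rotate 1 0 s) in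
  let z2 := pairing u (rotate 0 1 t) + pairing v (rotate 0 1 s) in
  kappa * \int[nu]_f cos (ell f + c) =
  expR (- (2^-1 * Qf M0 u u + 2^-1 * Qf M0 v v + g)) *
  expR (- (beta ^+ 2 * (z1 ^+ 2 + z2 ^+ 2) / 2)) * cos (alpha * z1 + c).
Proof.
move=> nuP z1 z2; rewrite -(ker_energy ker).
have fn := fine_nn0.
have rot0 a b : rotate a b 0 = (fun x => a * osc1 x + b * osc2 x) :> (int -> R).
  by apply/funext => x; rewrite /rotate cos0 sin0; ring.
have c1 : \sum_(x <- win (k + M0.+1)) W2 nn0 k x * osc1 x @[k --> \oo] --> z1.
  have := path_limit (rotate_path 1 0) fn.
  rewrite -!pairing_supp// rot0; apply: cvg_eqfun => k.
  rewrite (pairing_supp _ (@supp_W2 nn0 k)); apply: eq_bigr => x _; ring.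
have c2 : \sum_(x <- win (k + M0.+1)) W2 nn0 k x * osc2 x @[k --> \oo] --> z2.
  have := path_limit (rotate_path 0 1) fn.
  rewrite -!pairing_supp// rot0; apply: cvg_eqfun => k.
  rewrite (pairing_supp _ (@supp_W2 nn0 k)); apply: eq_bigr => x _; ring.
have l1 := @cvg_cos_ell _ _ nu id c nn0 (@measurable_id _ _ setT) fn.
have l0 := @cvg_cos_ell _ _ nu0 id 0 nn0 (@measurable_id _ _ setT) fn.
rewrite -mulrA -mulrA; congr (_ * _).
apply: (cvg_unique _ l1) => //.
rewrite (_ : (fun k => _) = (fun k => \int[nu0]_f cos (pairing (W2 nn0 k) f + 0) *
  (expR (- (beta ^+ 2 * ((\sum_(x <- win (k + M0.+1)) W2 nn0 k x * osc1 x) ^+ 2 +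
     (\sum_(x <- win (k + M0.+1)) W2 nn0 k x * osc2 x) ^+ 2) / 2)) *
   cos (alpha * (\sum_(x <- win (k + M0.+1)) W2 nn0 k x * osc1 x) + c)))); last first.
  apply/funext => k; rewrite (nuP _ _ c (@supp_W2 nn0 k)) (nu0P 0 (@supp_W2 nn0 k)).
  by rewrite cos0 mulr1 mulrA -expRD; congr (expR _ * _); field.
apply: cvgM.
  by under [in X in _ --> X]eq_Rintegral do rewrite -[ell _]addr0; exact: l0.
apply: cvgM.
  apply: (cvg_comp _ (@expR R)); last exact: continuous_expR.
  apply: (@cvgN _ R^o); apply: cvgM; last exact: cvg_cst.
  apply: cvgM; first exact: cvg_cst.
  by rewrite !expr2; under eq_fun do rewrite !expr2; apply: cvgD; apply: cvgM.
apply: (cvg_comp _ (@cos R)); last exact: continuous_cos.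
by apply: cvgD; [apply: cvgM => //; exact: cvg_cst|exact: cvg_cst].
Qed.

End Kernel.

Lemma pairing0 (R : realType) (f : int -> R) : pairing (fun=> 0) f = 0.
Proof. by rewrite (@pairing_supp R 0)// big_nil. Qed.

Lemma measurable_solution (R : realType) d (Om : measurableType d) (P : probability Om R)
    (B : int -> R -> Om -> R) phi0 phi (t : R) :
  solution P (@conductance R) B phi0 phi -> 0 <= t -> measurable_fun setT (phi t).
Proof.
by move=> hphi t0 _ A mA; rewrite setTI; have [] := solution_adapted hphi t0 mA.
Qed.

Lemma independent2_cst (R : realType) d (Om : measurableType d) (P : probability Om R)
    (f : Sprime R) (B : int -> R -> Om -> R) : brownian_family P B ->
  independent2 P (sigma_of [set: unit] (fun=> (fun=> f) : Om -> Sprime R))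
    (sigma_of ([set: int] `*` `[0, +oo[) (fun p => B p.1 p.2)).
Proof.
move=> [hB _] E1 E2 HE1 HE2.
have [->|->] : E1 = setT \/ E1 = set0.
  move: E1 HE1; apply: smallest_sub => /=.
    split=> [|A [->|->]|A HA]; [by right| | |].
    - by right; rewrite setDT.
    - by left; rewrite setD0.
    - have [[n An]|H] := pselect (exists n, A n = setT).
        by left; apply/seteqP; split=> // w _; exists n => //; rewrite An.
      right; apply/seteqP; split=> // w [n _]; have [An|->//] := HA n.
      by case: H; exists n.
  move=> _ [_ _ [A _ <-]]; rewrite setTI.
  by have [fA|fA] := pselect (A f); [left|right]; apply/seteqP; split.
- by rewrite setTI probability_setT mul1e.
- by rewrite set0I measure0 mul0e.
Qed.

(** * Stationarity, reversibility and periodicity *)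

Section Stationarity.
Context {R : realType} {d : measure_display} {Om : measurableType d}.
Variables (P : probability Om R) (B : int -> R -> Om -> R).
Hypothesis hB : brownian_family P B.
Variable Phi : Sprime R -> R -> Om -> Sprime R.
Hypothesis hPhi : forall f : Sprime R, solution P (@conductance R) B (fun=> f) (Phi f).

(** Subtracting the solution started from 0 cancels the noise. One sample point outside two null
    sets is enough, and it exists since the total mass is 1. *)
Lemma det_exists (f : Sprime R) : exists D, path D (fun=> cst 0) /\ D 0 = f.
Proof.
have [N1 [mN1 N10 H1]] := solution_path (hPhi f).
have [N2 [mN2 N20 H2]] := solution_path (hPhi (MkSprime (@tempered0 R))).
have PN : P (N1 `|` N2) = 0%E.
  by rewrite measureU0.
have [w Nw] : exists w, ~ (N1 `|` N2) w.
  apply: contrapT => H; have := @probability_setT _ _ _ P.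
  rewrite (_ : setT = N1 `|` N2) ?PN; last first.
    by apply/seteqP; split=> // w _; apply: contrapT => Nw; apply: H; exists w.
  by move=> /eqP; rewrite eq_sym onee_eq0.
have [p1 e1] : path (fun t => Phi f t w) (fun x t => Num.sqrt 2 * B x t w) /\
    Phi f 0 w = f by apply: contrapT => h; apply: Nw; left; exact: H1.
have [p2 e2] : path (fun t => Phi (MkSprime (@tempered0 R)) t w)
    (fun x t => Num.sqrt 2 * B x t w) /\ Phi (MkSprime (@tempered0 R)) 0 w =
    MkSprime (@tempered0 R).
  by apply: contrapT => h; apply: Nw; right; exact: H2.
exists (fun t x => Phi f t w x - Phi (MkSprime (@tempered0 R)) t w x); split.
  exact: pathB p1 p2.
by apply/funext => x; rewrite e1 e2 subr0.
Qed.

Let mPhi f t : 0 <= t -> measurable_fun setT (Phi f t).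
Proof. exact: measurable_solution. Qed.

Section TwoTimes.
Variables (s t : R) (u v : int -> R) (M0 : nat).
Hypotheses (s0 : 0 <= s) (st : s <= t) (su : supp M0 u) (sv : supp M0 v).

(** The expectation from [f] is kappa cos (ell f + c), which makes it measurable in [f]. The cross
    term g is exposed only as a limit, since reversibility uses its symmetry and not its value. *)
Lemma two_time_law : exists g,
  [/\ forall nn, fine_seq t M0 nn ->
    Qf (k + M0.+1) (ph1 s t u (k + M0.+1) (nn k)) v @[k --> \oo] --> g,
    forall c, measurable_fun setT (fun f =>
      \int[P]_w cos (pairing u (Phi f t w) + pairing v (Phi f s w) + c)) &
    forall alpha beta nu, osc_law alpha beta nu ->
    let z1 := pairing u (rotate 1 0 t) + pairing v (rotate 1 0 s) in
    let z2 := pairing u (rotate 0 1 t) + pairing v (rotate 0 1 s) in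
    let law c := expR (- (2^-1 * Qf M0 u u + 2^-1 * Qf M0 v v + g)) *
      expR (- (beta ^+ 2 * (z1 ^+ 2 + z2 ^+ 2) / 2)) * cos (alpha * z1 + c) in
    (forall c, \int[nu]_f (\int[P]_w cos (pairing u (Phi f t w) + pairing v (Phi f s w) + c)) =
      law c) /\
    forall d' (Om' : measurableType d') (P' : probability Om' R) (B' : int -> R -> Om' -> R)
      (phi0 : Om' -> Sprime R) (phi : R -> Om' -> Sprime R) c,
    brownian_family P' B' -> has_law P' phi0 nu ->
    independent2 P' (sigma_of [set: unit] (fun=> phi0))
      (sigma_of ([set: int] `*` `[0, +oo[) (fun p => B' p.1 p.2)) ->
    solution P' (@conductance R) B' phi0 phi ->
    \int[P']_w cos (pairing u (phi t w) + pairing v (phi s w) + c) = law c].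
Proof.
have [nu0 nu0P'] := stationary_law hB 0 0.
have nu0P M w c : supp M w ->
    \int[nu0]_f cos (pairing w f + c) = expR (- (Qf M w w / 2)) * cos c.
  by move=> /nu0P' ->; rewrite expr0n/= !mul0r addr0 add0r.
have [ell [kappa [g ker]]] := kernel_exists det_exists s0 st su sv nu0P.
have mell := measurable_ell s0 st su sv ker.
have EPhi f c : \int[P]_w cos (pairing u (Phi f t w) + pairing v (Phi f s w) + c) =
    kappa * cos (ell f + c).
  rewrite (kernel_solution s0 st su sv ker c hB _ (@independent2_cst _ _ _ P f B hB) (hPhi f)); last exact: measurable_cst.
  by rewrite Eexp_cst.
exists g; split=> [|c|alpha beta nu nuP z1 z2 law].
- exact: ker_g ker.
- rewrite (_ : (fun f => _) = (fun f => kappa * cos (ell f + c))); last by apply/funext => f.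
  apply: measurable_funM => //; apply: measurableT_comp; first exact: measurable_cos.
  exact: measurable_funD.
have bell c : bmeas (fun f => cos (ell f + c)).
  by apply: bmeas_cos; exact: measurable_funD.
have lawE c : kappa * \int[nu]_f cos (ell f + c) = law c.
  exact: (kernel_law s0 st su sv nu0P ker c nuP).
split=> [c|d' Om' P' B' phi0 phi c hB' l0 ind hphi].
  by under eq_Rintegral do rewrite EPhi; rewrite EexpZ.
rewrite (kernel_solution s0 st su sv ker c hB' _ ind hphi); last by case: l0.
by rewrite -(Eexp_pushforward l0 (bell c)).
Qed.

End TwoTimes.

Let mean u M (f : int -> R) := \sum_(x <- win M) u x * f x.

(** The case s = 0, v = 0, where the cross term vanishes. A rotation preserves the sum of the two
    squares, so time enters only through the mean, with factor alpha. *)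
Lemma one_time_law (t : R) (u : int -> R) M : 0 <= t -> supp M u ->
  (forall c, measurable_fun setT (fun f => \int[P]_w cos (pairing u (Phi f t w) + c))) /\
  forall alpha beta nu, osc_law alpha beta nu ->
  let law c := expR (- ((Qf M u u + beta ^+ 2 * (mean u M osc1 ^+ 2 + mean u M osc2 ^+ 2)) / 2)) *
    cos (alpha * (cos t * mean u M osc1 - sin t * mean u M osc2) + c) in
  (forall c, \int[nu]_f (\int[P]_w cos (pairing u (Phi f t w) + c)) = law c) /\
  forall d' (Om' : measurableType d') (P' : probability Om' R) (B' : int -> R -> Om' -> R)
    (phi0 : Om' -> Sprime R) (phi : R -> Om' -> Sprime R) c,
  brownian_family P' B' -> has_law P' phi0 nu ->
  independent2 P' (sigma_of [set: unit] (fun=> phi0))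
    (sigma_of ([set: int] `*` `[0, +oo[) (fun p => B' p.1 p.2)) ->
  solution P' (@conductance R) B' phi0 phi ->
  \int[P']_w cos (pairing u (phi t w) + c) = law c.
Proof.
move=> t0 su; have s0 : supp M (fun=> 0 : R) by [].
have [g [cg mE law]] := two_time_law (lexx 0) t0 su s0.
have add0 (X : int -> R) (Y : int -> R) c :
    cos (pairing u X + c) = cos (pairing u X + pairing (fun=> 0) Y + c).
  by rewrite pairing0 addr0.
have Q0 M' w : Qf M' w (fun=> 0) = 0 :> R.
  by rewrite /Qf big1// => x _; rewrite /pot big1 ?mulr0// => y _; rewrite mulr0.
have g0 : g = 0.
  have fn : fine_seq t M (fun k => nmin t (k + M.+1)) by move=> k; split; rewrite ?leqnn//; lia.
  apply: (cvg_unique _ (cg _ fn)) => //.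
  by apply: (cvg_eqfun (f := fun=> 0)) => [k|]; [rewrite Q0|exact: cvg_cst].
split=> [c|alpha beta nu nuP law1].
  rewrite (_ : (fun f => _) = fun f =>
      \int[P]_w cos (pairing u (Phi f t w) + pairing (fun=> 0) (Phi f 0 w) + c))//.
  by apply/funext => f; apply: eq_Rintegral => w _; exact: add0.
have [lawnu lawP] := law _ _ _ nuP; have lawE c : law1 c = expR (- (2^-1 * Qf M u u +
      2^-1 * Qf M (fun=> 0) (fun=> 0) + g)) * expR (- (beta ^+ 2 *
      ((pairing u (rotate 1 0 t) + pairing (fun=> 0) (rotate 1 0 0)) ^+ 2 +
      (pairing u (rotate 0 1 t) + pairing (fun=> 0) (rotate 0 1 0)) ^+ 2) / 2)) *
    cos (alpha * (pairing u (rotate 1 0 t) + pairing (fun=> 0) (rotate 1 0 0)) + c).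
  have rot a b : pairing u (rotate a b t) =
      (a * cos t + b * sin t) * mean u M osc1 + (b * cos t - a * sin t) * mean u M osc2.
    rewrite (pairing_supp _ su) !mulr_sumr -big_split; apply: eq_bigr => x _.
    by rewrite /rotate /=; ring.
  rewrite g0 Q0 !pairing0 !rot -expRD /law1.
  have := cos2Dsin2 t; set a := cos t; set b := sin t => ab.
  congr (expR _ * cos _); last by ring.
  set A1 := mean _ _ _; set A2 := mean _ _ _.
  rewrite [in RHS](_ : _ ^+ 2 + _ ^+ 2 = (a ^+ 2 + b ^+ 2) * (A1 ^+ 2 + A2 ^+ 2)); last ring.
  by rewrite ab; field.
split=> [c|d' Om' P' B' phi0 phi c hB' l0 ind hphi].
  rewrite lawE -lawnu; apply: eq_Rintegral => f _.
  by apply: eq_Rintegral => w _; exact: add0.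
rewrite lawE -(lawP _ _ _ _ _ _ _ hB' l0 ind hphi).
by apply: eq_Rintegral => w _; exact: add0.
Qed.

(** For alpha = 0 the law at time t no longer involves t. The monotone class also carries the
    measurability of the expectation in the starting point, as the solutions are chosen separately
    for each [f]. *)
Lemma osc_stationary beta nu : osc_law 0 beta nu -> stationary P Phi nu.
Proof.
move=> nuP t F t0 mF bF.
pose E (F : Sprime R -> R) f := \int[P]_w F (Phi f t w).
pose H F := [/\ bmeas F, measurable_fun setT (E F) & \int[nu]_f E F f = \int[nu]_f F f].
have bPhi (F' : Sprime R -> R) f : bmeas F' -> bmeas (fun w => F' (Phi f t w)).
  by move=> [mF' [M FM]]; split; [exact: measurableT_comp mF' (mPhi f t0)|exists M].
have bE (F' : Sprime R -> R) : bmeas F' -> measurable_fun setT (E F') -> bmeas (E F').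
  move=> bF' mE; split=> //; have [mF' [M FM]] := bF'.
  by exists M => f; apply: Eexp_abs_le => //; have [] := bPhi F' f bF'.
have bH : bclass H.
  split=> [F1 F2 a b [b1 m1 e1] [b2 m2 e2]|F_ F' M HF FM Fc].
    have EL : E (fun f => a * F1 f + b * F2 f) = (fun f => a * E F1 f + b * E F2 f).
      apply/funext => f; rewrite /E EexpD ?EexpZ//; try exact: bPhi.
      - by apply: bmeasZ; exact: bPhi.
      - by apply: bmeasZ; exact: bPhi.
    split; rewrite ?EL.
    - by apply: bmeasD; exact: bmeasZ.
    - by apply: measurable_funD; exact: measurable_funM.
    - rewrite EexpD ?EexpZ ?e1 ?e2 ?EexpD ?EexpZ//; try exact: bmeasZ; try exact: bE.
      by apply: bmeasZ; exact: bE.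
      by apply: bmeasZ; exact: bE.
  have mF_ n : measurable_fun setT (F_ n) by have [[]] := HF n.
  have mE_ n : measurable_fun setT (E (F_ n)) by have [] := HF n.
  have mF' : measurable_fun setT F' by apply: (measurable_fun_cvg mF_).
  have bF' : bmeas F' by split=> //; exists M => f; exact: cvg_abs_le (Fc f) (FM^~ f).
  have cE f : E (F_ n) f @[n --> \oo] --> E F' f.
    apply: (Eexp_cvg (M := M)).
    - by move=> n; exact: measurableT_comp (mF_ n) (mPhi f t0).
    - exact: measurableT_comp mF' (mPhi f t0).
    - by move=> n w; exact: FM.
    - by apply: aeW => w; exact: Fc.
  have mE : measurable_fun setT (E F') by apply: (measurable_fun_cvg mE_).
  split=> //.
  have c1 : \int[nu]_f E (F_ n) f @[n --> \oo] --> \int[nu]_f E F' f.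
    apply: (Eexp_cvg (M := M)) => //; last exact: aeW.
    move=> n f; apply: Eexp_abs_le => //; exact: measurableT_comp (mF_ n) (mPhi f t0).
  have c2 : \int[nu]_f F_ n f @[n --> \oo] --> \int[nu]_f F' f.
    by apply: (Eexp_cvg (M := M)) => //; exact: aeW.
  apply: (cvg_unique _ c1) => //; apply: cvg_eqfun c2 => n; by have [_ _ ->] := HF n.
have [_ mE eE] : H F.
  apply: (Sprime_class bH) => [M u c su|]; last by split.
  have [mE law] := one_time_law t0 su; have [lawnu _] := law _ _ _ nuP; split; last 1 first.
  - by apply: etrans (lawnu c) _; apply: etrans _ (esym (nuP M u c su)); rewrite !mul0r.
  - by apply: bmeas_cos; apply: measurable_funD => //; apply: measurable_pairing; exact: supp_schwartz su.
  - exact: mE.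
have bF' : bmeas F by split.
rewrite (EexpE _ bF') -eE -EexpE; last exact: bE.
apply: eq_integral => f _; rewrite unlock EexpE//.
exact: bPhi.
Qed.

Lemma two_time_sym (s t : R) (u v : int -> R) M0 (g1 g2 : R) :
  0 <= s -> s <= t -> supp M0 u -> supp M0 v ->
  (forall nn, fine_seq t M0 nn ->
    Qf (k + M0.+1) (ph1 s t u (k + M0.+1) (nn k)) v @[k --> \oo] --> g1) ->
  (forall nn, fine_seq t M0 nn ->
    Qf (k + M0.+1) (ph1 s t v (k + M0.+1) (nn k)) u @[k --> \oo] --> g2) -> g1 = g2.
Proof.
move=> s0 st su sv c1 c2.
have fn : fine_seq t M0 (fun k => nmin t (k + M0.+1)) by move=> k; split; rewrite ?leqnn//; lia.
have [C HC] := phase1_sym s0 st su sv.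
apply/eqP; rewrite -subr_eq0; apply/eqP.
have c0 : Qf (k + M0.+1) (ph1 s t u (k + M0.+1) (nmin t (k + M0.+1))) v -
    Qf (k + M0.+1) (ph1 s t v (k + M0.+1) (nmin t (k + M0.+1))) u @[k --> \oo] --> (0 : R).
  by apply: (@cvg_inv_bound _ _ _ C M0) => k; rewrite subr0; exact: HC (fn k).
by apply: (cvg_unique _ _ c0) => //; apply: cvgB; [exact: c1|exact: c2].
Qed.

(** For truncated test functions both sides are explicit and agree by symmetry of the cross term;
    dominated convergence, inside and outside, removes the truncation. *)
Lemma reversible_cos nu (s t : R) (u v : int -> R) c : osc_law 0 0 nu ->
  0 <= s -> s <= t -> schwartz u -> schwartz v ->
  \int[nu]_f (\int[P]_w cos (pairing u (Phi f t w) + pairing v (Phi f s w) + c)) =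
  \int[nu]_f (\int[P]_w cos (pairing v (Phi f t w) + pairing u (Phi f s w) + c)).
Proof.
move=> nuP s0 st; have t0 := le_trans s0 st.
pose J (u v : int -> R) f := \int[P]_w cos (pairing u (Phi f t w) + pairing v (Phi f s w) + c).
have mJ M u1 v1 : supp M u1 -> supp M v1 -> measurable_fun setT (J u1 v1).
  by move=> su sv; have [g [_ mE _]] := two_time_law s0 st su sv; exact: mE.
have cJ u1 v1 : schwartz u1 -> schwartz v1 ->
    \int[nu]_f J (trunc M u1) (trunc M v1) f @[M --> \oo] --> \int[nu]_f J u1 v1 f.
  move=> us vs.
  have mX M u2 r : 0 <= r -> forall f, measurable_fun setT (fun w => pairing (trunc M u2) (Phi f r w)).
    move=> r0 f; exact: (measurableT_comp
      (measurable_pairing (supp_schwartz (@supp_trunc R M u2))) (mPhi f r0)).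
  have mY u2 r : schwartz u2 -> 0 <= r -> forall f, measurable_fun setT (fun w => pairing u2 (Phi f r w)).
    by move=> us2 r0 f; exact: (measurableT_comp (measurable_pairing us2) (mPhi f r0)).
  have c1 f : J (trunc M u1) (trunc M v1) f @[M --> \oo] --> J u1 v1 f.
    apply: (Eexp_cvg (M := 1)).
    - move=> M; apply: measurableT_comp; first exact: measurable_cos.
      by apply: measurable_funD => //; apply: measurable_funD; exact: mX.
    - apply: measurableT_comp; first exact: measurable_cos.
      by apply: measurable_funD => //; apply: measurable_funD; exact: mY.
    - by move=> M w; exact: cos_abs_le1.
    - apply: aeW => w; apply: (cvg_comp (fun M => pairing (trunc M u1) (Phi f t w) +
          pairing (trunc M v1) (Phi f s w) + c) (@cos R)); last exact: continuous_cos.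
      apply: cvgD; last exact: cvg_cst.
      by apply: cvgD; apply: pairing_trunc => //; exact: Sprime_tempered.
  have mJt M : measurable_fun setT (J (trunc M u1) (trunc M v1)).
    by apply: (@mJ M); exact: supp_trunc.
  have J1 M f : `|J (trunc M u1) (trunc M v1) f| <= 1.
    apply: Eexp_abs_le => [|w]; last exact: cos_abs_le1.
    apply: measurableT_comp; first exact: measurable_cos.
    by apply: measurable_funD => //; apply: measurable_funD; exact: mX.
  apply: (Eexp_cvg (M := 1)) => //; last exact: aeW.
  exact: (measurable_fun_cvg mJt).
move=> us vs; apply: (cvg_unique _ (cJ u v us vs)) => //.
apply: cvg_eqfun (cJ v u vs us) => M.
have su := @supp_trunc R M u; have sv := @supp_trunc R M v.
have [g1 [c1 _ l1]] := two_time_law s0 st su sv.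
have [g2 [c2 _ l2]] := two_time_law s0 st sv su.
have [e1 _] := l1 _ _ _ nuP; have [e2 _] := l2 _ _ _ nuP.
rewrite /J e1 e2 (two_time_sym s0 st su sv c1 c2) expr0n/= !mul0r.
by rewrite [2^-1 * _ + 2^-1 * _]addrC.
Qed.

Lemma osc_reversible nu : osc_law 0 0 nu -> reversible P Phi nu.
Proof.
move=> nuP s t u v s0 st us vs.
have sinE (a : R) : sin a = cos (a + - (pi / 2)).
  by rewrite cosD cosN sinN cos_pihalf sin_pihalf; ring.
have tr c := reversible_cos c nuP s0 (ltW st) us vs.
pose X f w := pairing u (Phi f t w) + pairing v (Phi f s w).
pose Y f w := pairing u (Phi f s w) + pairing v (Phi f t w).
have trXY c : \int[nu]_f (\int[P]_w cos (X f w + c)) = \int[nu]_f (\int[P]_w cos (Y f w + c)).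
  rewrite (tr c); apply: eq_Rintegral => f _; apply: eq_Rintegral => w _.
  by rewrite /Y [pairing u _ + _]addrC.
have c1 : \int[nu]_f (\int[P]_w cos (X f w)) = \int[nu]_f (\int[P]_w cos (Y f w)).
  have := trXY 0; under eq_Rintegral do under eq_Rintegral do rewrite addr0.
  by under [in RHS]eq_Rintegral do under eq_Rintegral do rewrite addr0.
have c2 : \int[nu]_f (\int[P]_w sin (X f w)) = \int[nu]_f (\int[P]_w sin (Y f w)).
  under eq_Rintegral do under eq_Rintegral do rewrite sinE; rewrite trXY.
  by under eq_Rintegral do under eq_Rintegral do rewrite -sinE.
exact: (f_equal2 (@Complex R) c1 c2).
Qed.

(** Compare the sites 0 and 1 over a quarter turn. As f(0) = 1 and f(1) = 1 + i, |i f(0) + f(1)|^2 =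
    5 but |f(0) + i f(1)|^2 = 1, while the Green terms on both sides agree. *)
Lemma osc_not_reversible nu : osc_law 0 1 nu -> ~ reversible P Phi nu.
Proof.
move=> nuP rev.
have pi2 : (0 : R) < pi / 2 by rewrite divr_gt0// pi_gt0.
have su : supp 2 (@delta R 0) by apply: supp_le (@supp_delta R 0).
have sv : supp 2 (@delta R 1) by apply: supp_le (@supp_delta R 1).
pose X f w := pairing (delta 0) (Phi f (pi / 2) w) + pairing (delta 1) (Phi f 0 w).
pose Y f w := pairing (delta 0) (Phi f 0 w) + pairing (delta 1) (Phi f (pi / 2) w).
have : \int[nu]_f (\int[P]_w cos (X f w)) = \int[nu]_f (\int[P]_w cos (Y f w)).
  exact: (congr1 (@complex.Re R) (rev 0 (pi / 2) (delta 0) (delta 1) (lexx 0) pi2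
    (supp_schwartz su) (supp_schwartz sv))).
have [g1 [c1 _ l1]] := two_time_law (lexx 0) (ltW pi2) su sv.
have [g2 [c2 _ l2]] := two_time_law (lexx 0) (ltW pi2) sv su.
have [e1 _] := l1 _ _ _ nuP; have [e2 _] := l2 _ _ _ nuP.
have -> : \int[nu]_f (\int[P]_w cos (X f w)) = \int[nu]_f (\int[P]_w
    cos (pairing (delta 0) (Phi f (pi / 2) w) + pairing (delta 1) (Phi f 0 w) + 0)).
  by apply: eq_Rintegral => f _; apply: eq_Rintegral => w _; rewrite addr0.
have -> : \int[nu]_f (\int[P]_w cos (Y f w)) = \int[nu]_f (\int[P]_w
    cos (pairing (delta 1) (Phi f (pi / 2) w) + pairing (delta 0) (Phi f 0 w) + 0)).
  by apply: eq_Rintegral => f _; apply: eq_Rintegral => w _; rewrite addr0 addrC.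
rewrite e1 e2 -(two_time_sym (lexx 0) (ltW pi2) su sv c1 c2) !addr0 !mul0r !cos0 !mulr1 -!expRD.
rewrite !pairing_delta /rotate cos_pihalf sin_pihalf cos0 sin0.
have -> : osc1 0 = 1 :> R by [].
have -> : osc2 0 = 0 :> R by [].
have [-> ->] : osc1 1 = 1 :> R /\ osc2 1 = 1 :> R by rewrite /osc1 /osc2 /= /cond; split; field.
by move=> /(@expR_inj R); rewrite !expr2; lra.
Qed.

(** Uniqueness of characteristic functions on S', obtained by reaching indicators through
    [Sprime_class]. *)
Lemma has_law_cos (nu : probability (Sprime R) R) d' (Om' : measurableType d')
    (P' : probability Om' R) (X : Om' -> Sprime R) : measurable_fun setT X ->
  (forall M u c, supp M u ->
    \int[P']_w cos (pairing u (X w) + c) = \int[nu]_f cos (pairing u f + c)) ->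
  has_law P' X nu.
Proof.
move=> mX HX; split=> // A mA.
pose H F := bmeas F /\ \int[P']_w F (X w) = \int[nu]_f F f.
have bX (F : Sprime R -> R) : bmeas F -> bmeas (fun w => F (X w)).
  by move=> [mF [M FM]]; split; [exact: measurableT_comp mF mX|exists M].
have bH : bclass H.
  split=> [F1 F2 a b [b1 e1] [b2 e2]|F_ F M HF FM Fc].
    have Z1 := bmeasZ a b1; have Z2 := bmeasZ b b2; split; first exact: bmeasD.
    by rewrite (EexpD P' (bX _ Z1) (bX _ Z2)) !EexpZ ?EexpD ?EexpZ ?e1 ?e2//; exact: bX.
  have mF_ n : measurable_fun setT (F_ n) by have [[]] := HF n.
  have mF : measurable_fun setT F by apply: (measurable_fun_cvg mF_).
  split; first by split=> //; exists M => f; exact: cvg_abs_le (Fc f) (FM^~ f).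
  have c1 : \int[P']_w F_ n (X w) @[n --> \oo] --> \int[P']_w F (X w).
    apply: (Eexp_cvg (M := M)) => [n||n w|]; last by apply: aeW => w; exact: Fc.
    - exact: measurableT_comp (mF_ n) mX.
    - exact: measurableT_comp mF mX.
    - exact: FM.
  have c2 : \int[nu]_f F_ n f @[n --> \oo] --> \int[nu]_f F f.
    by apply: (Eexp_cvg (M := M)) => //; exact: aeW.
  apply: (cvg_unique _ c1) => //; apply: cvg_eqfun c2 => n; by have [_ ->] := HF n.
have [_] : H \1_A.
  apply: (Sprime_class bH) => [M u c su|]; last exact: bmeas_indic.
  split; last exact: HX su.
  by apply: bmeas_cos; apply: measurable_funD => //; apply: measurable_pairing; exact: supp_schwartz su.
have mXA : measurable (X @^-1` A) by rewrite -[X @^-1` A]setTI; exact: mX.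
have -> : \int[P']_w \1_A (X w) = \int[P']_w \1_(X @^-1` A) w by [].
rewrite !Eexp_indic// => e.
by rewrite -[LHS]fineK ?e ?fineK//; exact: fin_num_measure.
Qed.

Lemma osc_periodic nu : osc_law 1 0 nu ->
  forall (d' : measure_display) (Om' : measurableType d')
    (P' : probability Om' R) (B' : int -> R -> Om' -> R)
    (phi0 : Om' -> Sprime R) (phi : R -> Om' -> Sprime R),
  brownian_family P' B' -> has_law P' phi0 nu ->
  independent2 P' (sigma_of [set: unit] (fun=> phi0))
    (sigma_of ([set: int] `*` `[0, +oo[) (fun p => B' p.1 p.2)) ->
  solution P' (@conductance R) B' phi0 phi ->
  (forall t : R, 0 < t < 2 * pi -> ~ has_law P' (phi t) nu) /\
  has_law P' (phi (2 * pi)) nu.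
Proof.
move=> nuP d' Om' P' B' phi0 phi hB' l0 ind hphi.
have pi0 : (0 : R) < pi := pi_gt0 R.
split=> [t /andP[t0 t2] lt|].
- have su := @supp_delta R 0.
  have [_ law] := one_time_law (ltW t0) su; have [_ lawP] := law _ _ _ nuP.
  (* The phase -1 cancels the initial mean f1(0) = 1, so equality of the laws forces cos (cos t - 1)
     = 1. *)
  have := lawP _ _ _ _ _ _ (-1) hB' l0 ind hphi.
  have bc : bmeas (fun f : Sprime R => cos (pairing (delta 0) f - 1)).
    by apply: bmeas_cos; apply: measurable_funD => //; apply: measurable_pairing; exact: supp_schwartz su.
  rewrite -(Eexp_pushforward lt bc) (nuP _ _ _ su) /mean -!(pairing_supp _ su) !pairing_delta.
  have -> : osc1 0 = 1 :> R by [].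
  have -> : osc2 0 = 0 :> R by [].
  rewrite !mul1r mulr1 mulr0 subr0 subrr cos0 => /mulfI.
  rewrite gt_eqF ?expR_gt0// => /(_ isT) e.
  (* 1 - cos t lies in [0, 2], inside [0, pi], where cosine is injective. *)
  have ct : cos t = 1.
    apply/eqP; rewrite -subr_eq0 -oppr_eq0 opprB; apply/eqP; apply: cos_inj.
    + rewrite in_itv/= subr_ge0 cos_le1/=.
      have := pi_ge2 R; have := cos_geN1 t; lra.
    + by rewrite in_itv/= lexx ltW.
    + by rewrite -cosN opprB -e cos0.
  have [tp|tp] := leP t pi.
    suff : t = 0 by move=> h; rewrite h ltxx in t0.
    by apply: cos_inj; rewrite ?in_itv/= ?lexx ?(ltW pi0) ?(ltW t0)// ct cos0.
  suff : 2 * pi - t = 0 by move: t2; lra.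
  apply: cos_inj.
  + by rewrite in_itv/=; move: tp t2; lra.
  + by rewrite in_itv/= lexx ltW.
  + by rewrite cosB mulr_natl cos2pi sin2pi ct mul0r mulr1 addr0 cos0.
- have t0 : 0 <= 2 * pi :> R by rewrite mulr_ge0// ltW.
  apply: has_law_cos (measurable_solution hphi t0) _ => M u c su.
  have [_ law] := one_time_law t0 su; have [_ lawP] := law _ _ _ nuP.
  rewrite (lawP _ _ _ _ _ _ c hB' l0 ind hphi) (nuP _ _ _ su).
  by rewrite mulr_natl cos2pi sin2pi mul0r subr0 !mul1r.
Qed.

End Stationarity.

Theorem theorem2p9 (R : realType)
    (d : measure_display) (Om : measurableType d) (P : probability Om R)
    (B : int -> R -> Om -> R) (hB : brownian_family P B)
    (Phi : Sprime R -> R -> Om -> Sprime R)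
    (hPhi : forall f : Sprime R,
      solution P (@conductance R) B (fun=> f) (Phi f)) :
  (exists nu : probability (Sprime R) R,
    stationary P Phi nu /\ reversible P Phi nu) /\
  (exists nu : probability (Sprime R) R,
    stationary P Phi nu /\ ~ reversible P Phi nu) /\
  (exists (nu0 : probability (Sprime R) R) (tau : R), 0 < tau /\
    forall (d' : measure_display) (Om' : measurableType d')
      (P' : probability Om' R) (B' : int -> R -> Om' -> R)
      (phi0 : Om' -> Sprime R) (phi : R -> Om' -> Sprime R),
    brownian_family P' B' ->
    has_law P' phi0 nu0 ->
    independent2 P' (sigma_of [set: unit] (fun=> phi0))
      (sigma_of ([set: int] `*` `[0, +oo[) (fun p => B' p.1 p.2)) ->
    solution P' (@conductance R) B' phi0 phi ->
    (forall t : R, 0 < t < tau -> ~ has_law P' (phi t) nu0) /\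
    has_law P' (phi tau) nu0).
Proof.
have [nu00 h00] := stationary_law hB 0 0.
have [nu01 h01] := stationary_law hB 0 1.
have [nu10 h10] := stationary_law hB 1 0.
have st00 := osc_stationary hB hPhi h00.
have st01 := osc_stationary hB hPhi h01.
have rev00 := osc_reversible hB hPhi h00.
have rev01 := osc_not_reversible hB hPhi h01.
have per10 := osc_periodic hB hPhi h10.
split; [by exists nu00|split; [by exists nu01|exists nu10, (2 * pi); split=> //]].
by rewrite mulr_gt0// pi_gt0.
Qed.
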